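(* Let $d\ge 3$, let $(A,b)$ be a random environment on $(\Omega,\mathcal F,\mathbb P)$ satisfying all the standing assumptions listed in the context, and let the constants $L_0,c_0,\eta_0$ be fixed as in the context. Then there exists a subset $\Omega'\subset\Omega$ of full $\mathbb P$-probability such that, for every $\omega\in\Omega'$, the constant functions are the only bounded functions $w:\mathbb R^d\times(-\infty,\infty)\to\mathbb R$ (with $w(\cdot,t)$ Borel measurable for each $t$) satisfying, for every $x\in\mathbb R^d$, $s\ge0$ and $t\in(-\infty,\infty)$, $$w(x,t+s)=\int_{\mathbb R^d}p_{s,\omega}(x,y)\,w(y,t)\,dy=P_{x,\omega}\left(w(X_s,t)\right)$$ (for $s=0$ the right-hand side is understood as $w(x,t)$).
   Context: Environment. $d\ge3$. $(\Omega,\mathcal F,\mathbb P)$ is a probability space with an ergodic group of measure-preserving transformations $\{\tau_x:\Omega\to\Omega\}_{x\in\mathbb R^d}$; $A:\mathbb R^d\times\Omega\to\mathcal S(d)$ (symmetric $d\times d$ matrices) and $b:\mathbb R^d\times\Omega\to\mathbb R^d$ are bi-measurable, $\mathcal F=\sigma(A(x,\cdot),b(x,\cdot)\mid x\in\mathbb R^d)$, and: (stationarity) $A(x+y,\omega)=A(x,\tau_y\omega)$, $b(x+y,\omega)=b(x,\tau_y\omega)$ for all $x,y,\omega$; (boundedness, Lipschitz) there is $C>0$ with $|b(y,\omega)|\le C$, $|A(y,\omega)|\le C$, $|b(x,\omega)-b(y,\omega)|\le C|x-y|$, $|A(x,\omega)-A(y,\omega)|\le C|x-y|$ for all $x,y,\omega$;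 (ellipticity) there is $\nu>1$ with $\frac1\nu I\le A(y,\omega)\le\nu I$ for all $y,\omega$; (finite range dependence) there is $R>0$ such that, whenever $U,V\subset\mathbb R^d$ have distance $\ge R$, the sigma algebras $\sigma(A(x,\cdot),b(x,\cdot)\mid x\in U)$ and $\sigma(A(x,\cdot),b(x,\cdot)\mid x\in V)$ are independent; (restricted isotropy) for every orthogonal transformation $r$ of $\mathbb R^d$ preserving the coordinate axes and every $x\in\mathbb R^d$, $(A(rx,\omega),b(rx,\omega))$ and $(rA(x,\omega)r^t,rb(x,\omega))$ have the same law; (perturbation) $|b(y,\omega)|\le\eta_0$ and $|A(y,\omega)-I|\le\eta_0$ for all $y,\omega$. Here $|M|=\mathrm{tr}(MM^t)^{1/2}$. Diffusion. For each $\omega$, $p_{t,\omega}(x,y)$ ($t>0$) is the Green's function (fundamental solution) of $u_t-\frac12\mathrm{tr}(A(x,\omega)D^2u)+b(x,\omega)\cdot Du=0$ on $\mathbb R^d\times(0,\infty)$: the solution with initial data $f$ is $u(x,t)=\int p_{t,\omega}(x,y)f(y)\,dy$. $P_{x,\omega}$ is the law on $C([0,\infty);\mathbb R^d)$, with canonical path $X_t$, solving the (well-posed) martingale problem started at $x$ for the generator $\frac12\sum_{i,j}a_{ij}(y,\omega)\partial_{y_i}\partial_{y_j}-\sum_ib_i(y,\omega)\partial_{y_i}$; $P_{x,\omega}(F)$ also denotes the expectation of a random variable $F$, so $u(x,t)=P_{x,\omega}(f(X_t))$. $\mathbb E_0$ is expectation under the annealed law $\mathbb P\ltimes P_{0,\omega}$.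 $X_t^*=\max_{0\le s\le t}|X_s-X_0|$. Parameters. Fix $\beta\in(0,\frac12]$, $a\in(0,\frac{\beta}{1000d}]$, an integer $m_0\ge2$ with $(1+a)^{m_0-2}\le100<(1+a)^{m_0-1}$, $\delta=\frac5{32}\beta$, $M_0\ge100d(1+a)^{m_0+2}$. Let $L_0$ be a large integer multiple of $5$; with $[\cdot]$ the integer part, $\ell_n=5[L_n^a/5]$, $L_{n+1}=\ell_nL_n$; $\kappa_n=\exp(c_0(\log\log L_n)^2)$, $\tilde\kappa_n=\exp(2c_0(\log\log L_n)^2)$, $D_n=L_n\kappa_n$, $\tilde D_n=L_n\tilde\kappa_n$. $T_n=\inf\{s\ge0:|X_s-X_0|\ge\tilde D_n\}$ and $\alpha_n=\frac1{dL_n^2}\mathbb E_0[|X_{T_n\wedge L_n^2}|^2]$. $|f|_n=\sup_x|f(x)|+L_n^\beta\sup_{x\ne y}\frac{|f(x)-f(y)|}{|x-y|^\beta}$. $\chi(y)=1\wedge(2-|y|)_+$, $\chi_{n,x}(y)=\chi\big(\frac{y-x}{30\sqrt dL_n}\big)$. Controls for a triple $(x,\omega,n)$. Hölder control: for every $f\in C^{0,\beta}(\mathbb R^d)$, with $u$ the solution of the random equation above and $u_n$ the solution of $\partial_tu_n=\frac{\alpha_n}2\Delta u_n$, both with initial data $f$, $|\chi_{n,x}(\cdot)(u(\cdot,L_n^2)-u_n(\cdot,L_n^2))|_n\le L_n^{-\delta}|f|_n$. Localization control: for all $v\ge D_n$ and $|y-x|\le30\sqrt dL_n$, $P_{y,\omega}(X^*_{L_n^2}\ge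 v)\le\exp(-v/D_n)$. $\mathcal B_n(x)$ is the event that both controls hold for $(x,\omega,n)$. Fixed constants. $L_0,c_0$ (sufficiently large) and $\eta_0>0$ (sufficiently small) are fixed so that for all $n\ge0$: $\frac12L_n^{1+a}\le L_{n+1}\le2L_n^{1+a}$; $L_n<D_n<\tilde D_n<L_{n+1}$, $4\tilde\kappa_n<\tilde\kappa_{n+1}$, $3\tilde D_{n+1}<L_{n+1}^2$; $\frac1{2\nu}\le\alpha_n\le2\nu$ and $|\alpha_{n+1}-\alpha_n|\le L_n^{-(1+\frac9{10})\delta}$ (so $\overline\alpha=\lim_n\alpha_n\in[\frac1{2\nu},2\nu]$ exists); and $\mathbb P(\Omega\setminus\mathcal B_n(0))\le L_n^{-M_0}$. (Such a choice is possible by a theorem of Sznitman and Zeitouni.) *)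

(* Defs.v *)
From HB Require Import structures.
From mathcomp Require Import all_boot all_order all_algebra.
From mathcomp Require Import all_classical all_reals all_analysis.
From mathcomp Require Import measurable_realfun.

Set Implicit Arguments.
Unset Strict Implicit.
Unset Printing Implicit Defensive.

Import Order.TTheory GRing.Theory Num.Theory.
Import numFieldNormedType.Exports.

Local Open Scope classical_set_scope.
Local Open Scope ring_scope.

(* |M| = tr (M M^t)^(1/2); on column vectors this is the Euclidean norm.
   The library norm `|M| on matrices is the sup norm, hence this definition. *)
Definition enorm {R : realType} {m n : nat} (M : 'M[R]_(m, n)) : R :=
  Num.sqrt (\tr (M *m M^T)).

Notation Borel T := (g_sigma_algebraType (@open T)).

Section generated.
Context {T I : Type} {d : measure_display} {V : measurableType d}.
Implicit Types (U : set I) (f : I -> T -> V).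

Definition family_events U f : set_system T :=
  \bigcup_(i in U) preimage_set_system setT (f i) measurable.

Definition sigma_family U f : set_system T := <<s family_events U f >>.
End generated.

Section borel_matrix.
Context {R : realType} {m n : nat}.

Lemma measurable_mx_coord i j :
  measurable_fun (setT : set (Borel 'M[R]_(m, n)))
    (fun M : 'M[R]_(m, n) => M i j).
Proof.
apply: (measurability _ (RGenOpens.measurableE R)).
move=> _ [_ [a [b ->]] <-]; rewrite setTI.
apply: sub_sigma_algebra.
apply: open_comp; last exact: interval_open.
by move=> M _; exact: coord_continuous.
Qed.

Lemma open_mx_bigcup (U : set 'M[R]_(m, n)) : open U ->
  U = \bigcup_(q in [set q : 'M[rat]_(m, n) * nat |
         ball (map_mx ratr q.1 : 'M[R]_(m, n)) (q.2.+1%:R^-1) `<=` U])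
        ball (map_mx ratr q.1 : 'M[R]_(m, n)) (q.2.+1%:R^-1).
Proof.
move=> oU; apply/seteqP; split=> [x Ux|x [q /= qU]]; last exact: qU.
have /nbhs_ballP[e /= e0 xeU] : nbhs x U by exact: open_nbhs_nbhs.
pose k := Num.truncn (2 / e).
have k0 : 0 < k.+1%:R^-1 :> R by rewrite invr_gt0.
have ke : k.+1%:R^-1 + k.+1%:R^-1 <= e.
  have -> : k.+1%:R^-1 + k.+1%:R^-1 = 2 / k.+1%:R :> R.
    by rewrite mulr_natl mulr2n.
  by rewrite ler_pdivrMr ?ltr0n// mulrC -ler_pdivrMr// ltW// truncnS_gt.
have /choice[q qP] : forall ij : 'I_m * 'I_n, exists q : rat,
    ball (x ij.1 ij.2) (k.+1%:R^-1) (ratr q : R).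
  move=> ij.
  have /rat_in_itvoo[q] : x ij.1 ij.2 - k.+1%:R^-1 < x ij.1 ij.2 + k.+1%:R^-1.
    by rewrite ltrD2l (@lt_trans _ _ 0)// oppr_lt0.
  rewrite in_itv/= => qx; exists q.
  by rewrite /ball/= ltr_distlC.
pose Q : 'M[rat]_(m, n) := \matrix_(i, j) q (i, j).
exists (Q, k) => /=.
  move=> y Qy; apply: xeU; apply: le_ball ke _ _.
  apply: ball_triangle Qy => -; split=> // i j.
  by rewrite !mxE; exact: (qP (i, j)).
apply: ball_sym; split=> // i j.
by rewrite !mxE; exact: (qP (i, j)).
Qed.

Lemma measurable_fun_mx {d : measure_display} {T : measurableType d}
    (f : T -> 'M[R]_(m, n)) :
  (forall i j, measurable_fun setT (fun t => f t i j)) ->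
  measurable_fun setT (f : T -> Borel 'M[R]_(m, n)).
Proof.
move=> mf.
apply: (@measurability _ _ T (Borel 'M[R]_(m, n)) setT f (@open _) erefl).
move=> _ [U oU <-]; rewrite setTI (open_mx_bigcup oU) preimage_bigcup.
rewrite bigcup_mkcond; apply: countable_bigcupT_measurable => [|q].
  exact: countableP.
case: ifPn => // _.
set c := map_mx _ _; set e := _^-1.
have e0 : 0 < e by rewrite invr_gt0.
have -> : f @^-1` ball c e = \bigcap_(ij in [set: 'I_m * 'I_n])
    ((fun t => f t ij.1 ij.2) @^-1` ball (c ij.1 ij.2) e).
  apply/seteqP; split => t /=; first by move=> [_ ft] ij _; exact: ft.
  by move=> ft; split=> // i j; exact: (ft (i, j)).
apply: fin_bigcap_measurable => [|ij _]; first exact: finite_finset.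
rewrite -[X in measurable X]setTI; apply: mf => //.
by apply: measurable_realfun.open_measurable; exact: ball_open.
Qed.
End borel_matrix.

Section lebesgue_step.
Context {R : realType} {n : nat}.
Variable m : {sigma_finite_measure set (Borel 'cV[R]_n) -> \bar R}.
Local Open Scope ereal_scope.

Definition stack (z : measurableTypeR R * Borel 'cV[R]_n) :
    Borel 'cV[R]_n.+1 :=
  col_mx (z.1%:M : 'cV[R]_1) (z.2 : 'cV[R]_n).

Definition unstack (x : Borel 'cV[R]_n.+1) :
    measurableTypeR R * Borel 'cV[R]_n :=
  ((x : 'cV[R]_(1 + n)) ord0 ord0, dsubmx (x : 'cV[R]_(1 + n))).

Lemma stackK : cancel stack unstack.
Proof.
move=> [a y]; rewrite /unstack /stack/= col_mxKd; congr (_, _).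
have -> : ord0 = lshift n (ord0 : 'I_1) by exact/val_inj.
by rewrite col_mxEu mxE eqxx mulr1n.
Qed.

Lemma unstackK : cancel unstack stack.
Proof.
move=> x; rewrite /stack /unstack/=.
rewrite (_ : _%:M = usubmx (x : 'cV[R]_(1 + n))) ?vsubmxK//.
apply/matrixP => i j; rewrite !mxE !ord1 eqxx mulr1n.
by congr (x _ _); exact/val_inj.
Qed.

Lemma measurable_stack : measurable_fun setT stack.
Proof.
apply: measurable_fun_mx => i j.
have [k ik|k ik] := split_ordP (i : 'I_(1 + n)).
  rewrite [X in measurable_fun _ X](_ : _ = fst); first exact: measurable_fst.
  apply/funext => z; rewrite ik; apply: etrans (col_mxEu _ _ _ _) _.
  by rewrite mxE !ord1 eqxx mulr1n.
rewrite [X in measurable_fun _ X](_ : _ =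
    (fun M : 'cV[R]_n => M k j) \o snd); last first.
  by apply/funext => z; rewrite ik; exact: col_mxEd.
exact: measurableT_comp (measurable_mx_coord k j) measurable_snd.
Qed.

Lemma measurable_unstack : measurable_fun setT unstack.
Proof.
apply/measurable_fun_pairP; split.
  exact: (measurable_mx_coord (ord0 : 'I_n.+1) (ord0 : 'I_1)).
apply: measurable_fun_mx => i j.
rewrite [X in measurable_fun _ X](_ : _ =
    (fun M : 'cV[R]_n.+1 => M (rshift 1 i : 'I_n.+1) j)); last first.
  by apply/funext => x; rewrite mxE.
exact: measurable_mx_coord.
Qed.

(* one-dimensional Lebesgue measure times m, carried to R^(n+1) *)
Definition lebesgue_step := pushforward (lebesgue_measure \x m) stack.

Let lebesgue_step0 : lebesgue_step set0 = 0.
Proof. by rewrite /lebesgue_step /pushforward preimage_set0 measure0. Qed.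

Let lebesgue_step_ge0 A : 0 <= lebesgue_step A.
Proof. by rewrite /lebesgue_step /pushforward; exact: measure_ge0. Qed.

Let lebesgue_step_sigma_additive : semi_sigma_additive lebesgue_step.
Proof.
have mstack A : measurable A -> measurable (stack @^-1` A).
  by move=> mA; rewrite -[X in measurable X]setTI; exact: measurable_stack.
move=> F mF tF mUF; rewrite /lebesgue_step /pushforward preimage_bigcup.
apply: measure_semi_sigma_additive.
- by move=> k; exact: mstack.
- apply/trivIsetP => /= i j _ _ ij; rewrite -preimage_setI.
  by move/trivIsetP : tF => /(_ _ _ _ _ ij) ->//; rewrite preimage_set0.
- by rewrite -preimage_bigcup; exact: mstack.
Qed.

HB.instance Definition _ := isMeasure.Build _ _ _
  lebesgue_step lebesgue_step0 lebesgue_step_ge0 lebesgue_step_sigma_additive.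

Let lebesgue_step_sigma_finite : sigma_finite setT lebesgue_step.
Proof.
have /sigma_finiteP[F [TF ndF Foo]] :=
  sigma_finiteT (lebesgue_measure : {sigma_finite_measure set _ -> \bar R}).
have /sigma_finiteP[G [TG ndG Goo]] := sigma_finiteT m.
exists (fun k => unstack @^-1` (F k `*` G k)).
  apply/esym/seteqP; split=> // x _.
  have : [set: measurableTypeR R] (unstack x).1 by [].
  have : [set: Borel 'cV[R]_n] (unstack x).2 by [].
  rewrite TF TG => -[k _ Gk] [l _ Fl]; exists (maxn k l) => //; split.
    by move: Fl; exact/subsetPset/ndF/leq_maxr.
  by move: Gk; exact/subsetPset/ndG/leq_maxl.
move=> k; have [mF Fk] := Foo k; have [mG Gk] := Goo k; split.
  by rewrite -[X in measurable X]setTI; apply: measurable_unstack => //;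
    exact: measurableX.
rewrite /lebesgue_step /pushforward (_ : stack @^-1` _ = F k `*` G k).
  by rewrite product_measure1E// lte_mul_pinfty// ge0_fin_numE.
rewrite -comp_preimage (_ : unstack \o stack = id) ?preimage_id//.
by apply/funext => z; exact: stackK.
Qed.

HB.instance Definition _ := Measure_isSigmaFinite.Build _ _ _ lebesgue_step
  lebesgue_step_sigma_finite.

End lebesgue_step.

Fixpoint lebesgue_cV {R : realType} (n : nat) :
    {sigma_finite_measure set (Borel 'cV[R]_n) -> \bar R} :=
  match n with
  | 0 => \d_(0 : Borel 'cV[R]_0)
  | n'.+1 => lebesgue_step (lebesgue_cV n')
  end.

Section parabolic.
Context {R : realType} {d : nat}.
Implicit Types (f phi : 'cV[R]_d -> R) (u : 'cV[R]_d -> R -> R).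
Implicit Types (A : 'cV[R]_d -> 'M[R]_d) (b : 'cV[R]_d -> 'cV[R]_d).

Definition partial (i : 'I_d) f (x : 'cV[R]_d) : R := 'D_(delta_mx i ord0) f x.

Definition gradient f x : 'cV[R]_d := \col_i partial i f x.

Definition hessian f x : 'M[R]_d := \matrix_(i, j) partial i (partial j f) x.

Definition generator A b f x : R :=
  2^-1 * \tr (A x *m hessian f x) - ((b x)^T *m gradient f x) ord0 ord0.

Definition C2 f : Prop :=
  [/\ continuous f,
      forall i x, derivable f x (delta_mx i ord0),
      forall i, continuous (partial i f),
      forall i j x, derivable (partial j f) x (delta_mx i ord0) &
      forall i j, continuous (partial i (partial j f))].

Definition compactly_supported f : Prop :=
  exists2 K : set 'cV[R]_d, compact K & forall x, ~ K x -> f x = 0.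

(* classical (C^{2,1}) solutions of u_t = 1/2 tr (A D^2 u) - b . D u on
   R^d x (0, oo) *)
Record classical_solution A b u : Prop := {
  solution_derivable_time : forall (x : 'cV[R]_d) (t : R), 0 < t ->
    derivable (u x) t 1 ;
  solution_derivable_space : forall i (x : 'cV[R]_d) (t : R), 0 < t ->
    derivable (u ^~ t) x (delta_mx i ord0) ;
  solution_derivable_space2 : forall i j (x : 'cV[R]_d) (t : R), 0 < t ->
    derivable (partial j (u ^~ t)) x (delta_mx i ord0) ;
  solution_continuous : forall (x : 'cV[R]_d) (t : R), 0 < t ->
    {for (x, t), continuous (fun z : 'cV[R]_d * R => u z.1 z.2)} ;
  solution_continuous_time : forall (x : 'cV[R]_d) (t : R), 0 < t ->
    {for (x, t), continuous (fun z : 'cV[R]_d * R => derive1 (u z.1) z.2)} ;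
  solution_continuous_space : forall i (x : 'cV[R]_d) (t : R), 0 < t ->
    {for (x, t), continuous
      (fun z : 'cV[R]_d * R => partial i (u ^~ z.2) z.1)} ;
  solution_continuous_space2 : forall i j (x : 'cV[R]_d) (t : R), 0 < t ->
    {for (x, t), continuous
      (fun z : 'cV[R]_d * R => partial i (partial j (u ^~ z.2)) z.1)} ;
  solution_equation : forall (x : 'cV[R]_d) (t : R), 0 < t ->
    derive1 (u x) t = generator A b (u ^~ t) x }.

(* "The solution with initial data f" is the bounded classical one: the Cauchy
   problem is well posed in this class, but not among all functions. *)
Record cauchy_solution A b f u : Prop := {
  cauchy_classical : classical_solution A b u ;
  cauchy_initial : forall x, u x 0 = f x ;
  cauchy_continuous : {within [set z : 'cV[R]_d * R | 0 <= z.2],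
    continuous (fun z => u z.1 z.2)} ;
  cauchy_bounded : exists M : R, forall (x : 'cV[R]_d) (t : R), 0 <= t ->
    `|u x t| <= M }.

Definition green_op (p : R -> 'cV[R]_d -> 'cV[R]_d -> R) (t : R) f x : R :=
  if t == 0 then f x
  else \int[lebesgue_cV d]_(y in [set: Borel 'cV[R]_d]) (p t x y * f y).

Record greens_function A b (p : R -> 'cV[R]_d -> 'cV[R]_d -> R) : Prop := {
  green_integrable : forall (t : R) (x : 'cV[R]_d), 0 < t ->
    (lebesgue_cV d).-integrable [set: Borel 'cV[R]_d] (EFin \o p t x) ;
  green_solution : forall y, classical_solution A b (fun x t => p t x y) ;
  green_cauchy : forall f, continuous f ->
    (exists M : R, forall x, `|f x| <= M) ->
    cauchy_solution A b f (fun x t => green_op p t f x) }.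

End parabolic.

(* A path on [0, oo) is represented by its extension to R that is constant on
   (-oo, 0]. *)
Definition cpath (R : realType) (d : nat) : Type :=
  {X : R -> 'cV[R]_d | continuous X /\ forall t, t <= 0 -> X t = X 0}.

Lemma const_path_subproof (R : realType) (d : nat) :
  continuous (fun _ : R => 0 : 'cV[R]_d) /\
  forall t : R, t <= 0 -> (fun _ : R => 0 : 'cV[R]_d) t = 0.
Proof. by split => // t; exact: cst_continuous. Qed.

HB.instance Definition _ (R : realType) (d : nat) := gen_eqMixin (cpath R d).
HB.instance Definition _ (R : realType) (d : nat) :=
  gen_choiceMixin (cpath R d).
HB.instance Definition _ (R : realType) (d : nat) :=
  isPointed.Build (cpath R d) (exist _ _ (const_path_subproof R d)).

Definition position {R : realType} {d : nat} (t : R) (X : cpath R d) :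
  Borel 'cV[R]_d := sval X t.

Notation PathSpace R d :=
  (g_sigma_algebraType (family_events `[0 : R, +oo[ (@position R d))).

Section martingale_problem.
Context {R : realType} {d : nat}.
Implicit Types (A : 'cV[R]_d -> 'M[R]_d) (b : 'cV[R]_d -> 'cV[R]_d).
Implicit Types (Q : probability (PathSpace R d) R).

Definition martingale_part A b (phi : 'cV[R]_d -> R) (t : R)
    (X : PathSpace R d) : R :=
  phi (position t X) - phi (position 0 X) -
  \int[lebesgue_measure]_(r in `[0, t]) generator A b phi (position r X).

(* The martingale property is stated as equality of the integrals over every
   event of the canonical filtration. *)
Record martingale_solution A b (x : 'cV[R]_d) Q : Prop := {
  martingale_start : Q [set X | position 0 X = x] = 1%E ;
  martingale_property : forall phi, C2 phi -> compactly_supported phi ->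
    forall s t : R, 0 <= s -> s <= t ->
    forall E : set (PathSpace R d), sigma_family `[0, s] (@position R d) E ->
    \int[Q]_(X in E) martingale_part A b phi t X =
    \int[Q]_(X in E) martingale_part A b phi s X }.

Definition diffusion_law A b (x : 'cV[R]_d) Q : Prop :=
  martingale_solution A b x Q /\
  forall Q', martingale_solution A b x Q' ->
    forall E, measurable E -> Q' E = Q E.

Definition running_max (t : R) (X : PathSpace R d) : R :=
  sup [set enorm (position s X - position 0 X) | s in `[0, t]].

Definition exit_time (r : R) (X : PathSpace R d) : \bar R :=
  ereal_inf [set s%:E | s in [set s : R |
    0 <= s /\ r <= enorm (position s X - position 0 X)]].

End martingale_problem.

Section environment.
Context {R : realType} {d : nat} {disp : measure_display}.
Context {Omega : measurableType disp}.
Variables (P : probability Omega R) (tau : 'cV[R]_d -> Omega -> Omega).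
Variables (A : 'cV[R]_d -> Omega -> 'M[R]_d).
Variables (b : 'cV[R]_d -> Omega -> 'cV[R]_d).

Definition coeff (x : 'cV[R]_d) (w : Omega) :
  Borel 'M[R]_d * Borel 'cV[R]_d := (A x w, b x w).

Definition axis_isometry (r : 'M[R]_d) : Prop :=
  r *m r^T = 1%:M /\
  forall i, exists j (c : R),
    r *m delta_mx i ord0 = c *: delta_mx j ord0 :> 'cV[R]_d.

Record random_environment (nu eta0 : R) : Prop := {
  env_tau0 : forall w, tau 0 w = w ;
  env_tauD : forall x y w, tau (x + y) w = tau x (tau y w) ;
  env_tau_measurable : forall x, measurable_fun setT (tau x) ;
  env_tau_preserving : forall x E, measurable E -> P (tau x @^-1` E) = P E ;
  env_ergodic : forall E, measurable E ->
    (forall x, tau x @^-1` E = E) -> P E = 0%E \/ P E = 1%E ;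
  env_symmetric : forall x w, (A x w)^T = A x w ;
  env_bimeasurable : measurable_fun setT
    (fun z : Borel 'cV[R]_d * Omega => coeff z.1 z.2) ;
  env_generated : @measurable _ Omega = sigma_family setT coeff ;
  env_stationary : forall x y w,
    A (x + y) w = A x (tau y w) /\ b (x + y) w = b x (tau y w) ;
  env_bounded_lipschitz : exists2 C : R, 0 < C & forall x y w,
    [/\ enorm (b y w) <= C, enorm (A y w) <= C,
        enorm (b x w - b y w) <= C * enorm (x - y) &
        enorm (A x w - A y w) <= C * enorm (x - y)] ;
  env_nu : 1 < nu ;
  env_elliptic : forall y w (xi : 'cV[R]_d),
    nu^-1 * enorm xi ^+ 2 <= (xi^T *m A y w *m xi) ord0 ord0
      <= nu * enorm xi ^+ 2 ;
  env_finite_range : exists2 rho : R, 0 < rho & forall U V : set 'cV[R]_d,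
    (forall x y, U x -> V y -> rho <= enorm (x - y)) ->
    forall E F, sigma_family U coeff E -> sigma_family V coeff F ->
    P (E `&` F) = (P E * P F)%E ;
  env_isotropic : forall r, axis_isometry r -> forall x,
    forall B : set (Borel 'M[R]_d * Borel 'cV[R]_d), measurable B ->
    P [set w | B (A (r *m x) w, b (r *m x) w)] =
    P [set w | B (r *m A x w *m r^T, r *m b x w)] ;
  env_perturbation : forall y w,
    enorm (b y w) <= eta0 /\ enorm (A y w - 1%:M) <= eta0 }.

End environment.

Record parameters (R : realType) := {
  beta : R ;
  expo : R ; (* the exponent a *)
  m0 : nat ;
  M0 : R ;
  L0 : nat ;
  c0 : R }.

Section scales.
Context {R : realType} (k : parameters R).

Record admissible (d : nat) : Prop := {
  adm_beta : 0 < beta k <= 2^-1 ;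
  adm_expo : 0 < expo k <= beta k / (1000 * d%:R) ;
  adm_m0 : (2 <= m0 k)%N ;
  adm_m0_expo : (1 + expo k) ^+ (m0 k - 2) <= 100 < (1 + expo k) ^+ (m0 k - 1) ;
  adm_M0 : 100 * d%:R * (1 + expo k) ^+ (m0 k + 2) <= M0 k ;
  adm_L0 : (0 < L0 k)%N /\ (5 %| L0 k)%N }.

Definition delta : R := 5 / 32 * beta k.

Fixpoint scale (n : nat) : nat :=
  match n with
  | 0 => L0 k
  | n'.+1 => (5 * Num.truncn ((scale n')%:R `^ expo k / 5) * scale n')%N
  end.

Definition L (n : nat) : R := (scale n)%:R.

Definition kappa (n : nat) : R := expR (c0 k * ln (ln (L n)) ^+ 2).

Definition tkappa (n : nat) : R := expR (2 * c0 k * ln (ln (L n)) ^+ 2).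

Definition D (n : nat) : R := L n * kappa n.

Definition tD (n : nat) : R := L n * tkappa n.

Definition holder_norm {d : nat} (l : R) (f : 'cV[R]_d -> R) : \bar R :=
  (ereal_sup [set `|f x|%:E | x in setT] +
   (l `^ beta k)%:E *
   ereal_sup [set (`|f z.1 - f z.2| / enorm (z.1 - z.2) `^ beta k)%:E |
     z in [set z : 'cV[R]_d * 'cV[R]_d | z.1 != z.2]])%E.

Definition cutoff {d : nat} (n : nat) (x y : 'cV[R]_d) : R :=
  let chi z := Num.min 1 (Num.max 0 (2 - enorm z)) in
  chi ((30 * Num.sqrt d%:R * L n)^-1 *: (y - x)).

Section controls.
Context {d : nat} {disp : measure_display} {Omega : measurableType disp}.
Variables (P : probability Omega R).
Variables (A : 'cV[R]_d -> Omega -> 'M[R]_d).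
Variables (b : 'cV[R]_d -> Omega -> 'cV[R]_d).
Variables (Q : 'cV[R]_d -> Omega -> probability (PathSpace R d) R).

Definition alpha (n : nat) : R :=
  (d%:R * L n ^+ 2)^-1 *
  fine (\int[P]_w \int[Q 0 w]_X
    (enorm (position (fine (mine (exit_time (tD n) X) (L n ^+ 2)%:E)) X)
       ^+ 2)%:E)%E.

Definition holder_control (n : nat) (x : 'cV[R]_d) (w : Omega) : Prop :=
  forall f u un : _,
    (holder_norm 1 f < +oo)%E ->
    cauchy_solution (A ^~ w) (b ^~ w) f u ->
    cauchy_solution (fun=> (alpha n)%:M) (fun=> 0) f un ->
    (holder_norm (L n)
       (fun y => cutoff n x y * (u y (L n ^+ 2)%R - un y (L n ^+ 2)%R))%R
     <= (L n `^ (- delta))%:E * holder_norm (L n) f)%E.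

Definition localization_control (n : nat) (x : 'cV[R]_d) (w : Omega) : Prop :=
  forall (v : R) (y : 'cV[R]_d), D n <= v ->
    enorm (y - x) <= 30 * Num.sqrt d%:R * L n ->
    (Q y w [set X | (v <= running_max (L n ^+ 2) X)%R]
      <= (expR (- (v / D n)))%:E)%E.

Definition control_event (n : nat) (x : 'cV[R]_d) : set Omega :=
  [set w | holder_control n x w /\ localization_control n x w].

Record fixed_constants (nu : R) : Prop := {
  scale_growth : forall n,
    2^-1 * L n `^ (1 + expo k) <= L n.+1 <= 2 * L n `^ (1 + expo k) ;
  scale_order : forall n, [/\ L n < D n, D n < tD n & tD n < L n.+1] ;
  scale_kappa : forall n, 4 * tkappa n < tkappa n.+1 ;
  scale_tD : forall n, 3 * tD n.+1 < L n.+1 ^+ 2 ;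
  alpha_bounds : forall n, (2 * nu)^-1 <= alpha n <= 2 * nu ;
  alpha_cauchy : forall n,
    `|alpha n.+1 - alpha n| <= L n `^ (- ((1 + 9 / 10) * delta)) ;
  control_measurable : forall n, measurable (control_event n 0) ;
  control_probability : forall n,
    (P (~` control_event n 0) <= (L n `^ (- M0 k))%:E)%E }.

End controls.
End scales.

Record entire_bounded_solution {R : realType} {d : nat}
    (p : R -> 'cV[R]_d -> 'cV[R]_d -> R)
    (Q : 'cV[R]_d -> probability (PathSpace R d) R)
    (v : 'cV[R]_d -> R -> R) : Prop := {
  entire_bounded : exists M : R, forall x t, `|v x t| <= M ;
  entire_borel : forall t,
    measurable_fun [set: Borel 'cV[R]_d] (fun x : 'cV[R]_d => v x t) ;
  entire_green : forall x s t, 0 <= s ->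
    v x (t + s) = green_op p s (v ^~ t) x ;
  entire_diffusion : forall x s t, 0 <= s ->
    v x (t + s) = \int[Q x]_(X in [set: PathSpace R d]) v (position s X) t }.

(* Main.v *)
Require Import Defs.
From mathcomp Require Import all_boot all_order all_algebra.
From mathcomp Require Import all_classical all_reals all_analysis.
From mathcomp Require Import measurable_realfun.
From mathcomp Require Import ring lra.

Set Implicit Arguments.
Unset Strict Implicit.
Unset Printing Implicit Defensive.

Import Order.TTheory GRing.Theory Num.Theory.
Import numFieldNormedType.Exports.

Local Open Scope classical_set_scope.
Local Open Scope ring_scope.

(** Let w be a bounded entire solution, |w| <= M.  A single application of the
    Hoelder control at a large scale L = L_n shows that w(., t) hardly varies at
    distances much smaller than L.

    First, w(., t) is Lipschitz with a constant K' depending on the environment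
    only through its ellipticity, its Lipschitz constant and its bounds, and in
    particular not on t.  Indeed w(., t) is the solution at time 1 of the random
    equation with the initial data w(., t - 1), and the gradient of a bounded
    solution at time 1 is controlled by the supremum of its data
    (gradient_estimate).  This is proved by doubling the variables: at a maximum
    of the penalized difference u(x,t) - u(y,t) the two equations are coupled by
    reflection in the direction x - y (trace_coupling_le), where the concavity of
    the penalty dominates all other terms because A is uniformly elliptic and
    Lipschitz.  The argument requires data continuous up to time 0; it extends to
    Borel data since it bounds the total variation of p_1(x, .) - p_1(y, .)
    (exists_green_lipschitz).

    Next, put f = w(., t - L^2), so that w(., t) is the solution u at time L^2
    with the data f.  As f is bounded and K'-Lipschitz, |f|_n is at most
    M + L^beta (d K' + 2 M).  At a scale where the Hoelder control holds,
    u(., L^2) differs from the heat flow u_n(., L^2) by a function whose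
    beta-Hoelder seminorm near 0 is at most L^(- beta - delta) |f|_n, which is
    of order L^(- delta).  The gradient of u_n(., L^2) is of order M / L, by
    gradient_estimate again (heat_gradient_le).  Hence w(x, t) - w(y, t) is of
    order L^(- delta) + L^(- 1) for fixed x and y (scale_estimate_lipschitz).

    The control holds at infinitely many scales almost surely, because the
    probability that it fails at the scale L_n tends to 0
    (limsup_full_probability).  So w(., t) is constant for each t; it is then
    constant in t as well, since p_s(x, .) has integral 1 (green_op_cst), which
    follows from the maximum principle and also gives the converse implication.

    The comparison with the heat flow presupposes that the heat equation with
    the data f is solvable.  It is solved explicitly for trigonometric polynomials
    only (trig_poly_cauchy); these are dense in the required sense, with the same
    supremum and the same Lipschitz constant in each coordinate, by Bernstein
    approximation in the variables sin (x_i / r) (trig_poly_approx). *)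

(** * Euclidean geometry of column vectors *)

Section euclid.
Context {R : realType} {d : nat}.
Implicit Types (x y z : 'cV[R]_d) (A B M : 'M[R]_d).

Definition dot x y : R := (x^T *m y) ord0 ord0.

Definition bform M x y : R := (x^T *m M *m y) ord0 ord0.

Lemma dotE x y : dot x y = \sum_i x i ord0 * y i ord0.
Proof. by rewrite /dot mxE; apply: eq_bigr => i _; rewrite mxE. Qed.

Lemma dotC x y : dot x y = dot y x.
Proof. by rewrite !dotE; apply: eq_bigr => i _; rewrite mulrC. Qed.

Lemma dotDl x y z : dot (x + y) z = dot x z + dot y z.
Proof. by rewrite /dot linearD mulmxDl mxE. Qed.

Lemma dotZl a x z : dot (a *: x) z = a * dot x z.
Proof. by rewrite /dot linearZ/= -scalemxAl mxE. Qed.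

Lemma dotNl x z : dot (- x) z = - dot x z.
Proof. by rewrite -scaleN1r dotZl mulN1r. Qed.

Lemma dotBl x y z : dot (x - y) z = dot x z - dot y z.
Proof. by rewrite dotDl dotNl. Qed.

Lemma dotDr x y z : dot z (x + y) = dot z x + dot z y.
Proof. by rewrite dotC dotDl !(dotC z). Qed.

Lemma dotZr a x z : dot z (a *: x) = a * dot z x.
Proof. by rewrite dotC dotZl dotC. Qed.

Lemma dotNr x z : dot z (- x) = - dot z x.
Proof. by rewrite dotC dotNl dotC. Qed.

Lemma dot0l x : dot 0 x = 0.
Proof. by rewrite /dot trmx0 mul0mx mxE. Qed.

Lemma dot_ge0 x : 0 <= dot x x.
Proof. by rewrite dotE sumr_ge0// => i _; rewrite -expr2 sqr_ge0. Qed.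

Lemma bformDl M x y z : bform M (x + y) z = bform M x z + bform M y z.
Proof. by rewrite /bform linearD !mulmxDl mxE. Qed.

Lemma bformDr M x y z : bform M z (x + y) = bform M z x + bform M z y.
Proof. by rewrite /bform mulmxDr mxE. Qed.

Lemma bformZl M a x z : bform M (a *: x) z = a * bform M x z.
Proof. by rewrite /bform linearZ/= -!scalemxAl mxE. Qed.

Lemma bformZr M a x z : bform M z (a *: x) = a * bform M z x.
Proof. by rewrite /bform -!scalemxAr mxE. Qed.

Lemma bformNN M x : bform M (- x) (- x) = bform M x x.
Proof. by rewrite -scaleN1r bformZl bformZr !mulN1r opprK. Qed.

Lemma bformDm A B x y : bform (A + B) x y = bform A x y + bform B x y.
Proof. by rewrite /bform mulmxDr mulmxDl mxE. Qed.

Lemma bformZm a B x y : bform (a *: B) x y = a * bform B x y.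
Proof. by rewrite /bform -scalemxAr -scalemxAl mxE. Qed.

Lemma bformNm B x y : bform (- B) x y = - bform B x y.
Proof. by rewrite -scaleN1r bformZm mulN1r. Qed.

Lemma bformBm A B x y : bform (A - B) x y = bform A x y - bform B x y.
Proof. by rewrite bformDm bformNm. Qed.

Lemma bform_scalar a x y : bform a%:M x y = a * dot x y.
Proof. by rewrite /bform mul_mx_scalar -scalemxAl mxE. Qed.

Lemma bform_rank1 x y z t : bform (x *m y^T) z t = dot z x * dot y t.
Proof. by rewrite /bform mulmxA -mulmxA mxE big_ord1. Qed.

Lemma bform_sym M x y : M^T = M -> bform M x y = bform M y x.
Proof.
move=> sM; rewrite /bform; transitivity ((x^T *m M *m y)^T ord0 ord0).
  by rewrite [RHS]mxE.
by rewrite !trmx_mul trmxK sM mulmxA.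
Qed.

Lemma bform_dot M x y : bform M x y = dot x (M *m y).
Proof. by rewrite /bform /dot mulmxA. Qed.

Lemma bform_delta M i : bform M (delta_mx i ord0) (delta_mx i ord0) = M i i.
Proof.
by rewrite /bform trmx_delta -rowE -colE !mxE.
Qed.

Lemma dot_delta i x : dot (delta_mx i ord0) x = x i ord0.
Proof. by rewrite /dot trmx_delta -rowE mxE. Qed.

Lemma trace_bform M :
  \tr M = \sum_i bform M (delta_mx i ord0) (delta_mx i ord0).
Proof. by apply: eq_bigr => i _; rewrite bform_delta. Qed.

Lemma discriminant_le (q m a : R) :
  0 <= a -> (forall s : R, 0 <= q + 2 * s * m + s ^+ 2 * a) -> m ^+ 2 <= q * a.
Proof.
rewrite le_eqVlt => /orP[/eqP <-|a0] H.
  have [-> | m0] := eqVneq m 0; first by rewrite expr0n/= mulr0.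
  have := H (- (q + 1) / (2 * m)).
  have -> : q + 2 * (- (q + 1) / (2 * m)) * m + (- (q + 1) / (2 * m)) ^+ 2 * 0
    = - 1 by field.
  by rewrite oppr_ge0 ler10.
have := H (- m / a).
have -> : q + 2 * (- m / a) * m + (- m / a) ^+ 2 * a = (q * a - m ^+ 2) / a.
  by field; rewrite gt_eqF.
by rewrite pmulr_lge0 ?invr_gt0// subr_ge0.
Qed.

Lemma cauchy_schwarz_psd B x y : B^T = B -> (forall z, 0 <= bform B z z) ->
  bform B x y ^+ 2 <= bform B x x * bform B y y.
Proof.
move=> sB pB; apply: discriminant_le => // s.
have := pB (x + s *: y); rewrite !(bformDl, bformDr, bformZl, bformZr).
by rewrite (bform_sym y x)//; congr (_ <= _); ring.
Qed.

(** Gaussian elimination of the nonzero columns of B, one at a time: each step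
    splits off a nonnegative multiple of a rank one matrix v v^T, on which
    tr (v v^T M) = v^T M v. *)
Lemma trace_psd_mul_le0 B M : B^T = B -> (forall z, 0 <= bform B z z) ->
  (forall z, bform M z z <= 0) -> \tr (B *m M) <= 0.
Proof.
move=> + + nM.
suff H (l : seq 'I_d) : forall B, B^T = B -> (forall z, 0 <= bform B z z) ->
    (forall i, i \notin l -> B *m delta_mx i ord0 = 0 :> 'cV_d) ->
    \tr (B *m M) <= 0.
  by move=> sB pB; apply: (H (enum 'I_d) B) => // i; rewrite mem_enum.
elim: l => [|i l IH] {}B sB pB B0.
  suff -> : B = 0 by rewrite mul0mx mxtrace0.
  apply/matrixP => j1 j2; have := B0 j2 isT.
  by move=> /matrixP/(_ j1 ord0); rewrite -colE !mxE.
pose e : 'cV[R]_d := delta_mx i ord0.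
pose v := B *m e; pose a := bform B e e.
have a0 : 0 <= a by exact: pB.
have vE z : dot z v = bform B z e by rewrite bform_dot.
have cs z : dot z v ^+ 2 <= bform B z z * a.
  by rewrite vE; exact: cauchy_schwarz_psd.
have v0 : a = 0 -> v = 0.
  move=> aE; apply/matrixP => j1 j2; rewrite ord1 [in RHS]mxE.
  have := cs (delta_mx j1 ord0); rewrite aE mulr0 dot_delta.
  by rewrite real_exprn_even_le0 ?num_real//= => /eqP.
pose B' := B - a^-1 *: (v *m v^T).
have -> : B = B' + a^-1 *: (v *m v^T) by rewrite /B' subrK.
rewrite mulmxDl mxtraceD -scalemxAl mxtraceZ -mulmxA (mxtrace_mulC v).
rewrite [X in _ + _ * X](_ : _ = bform M v v); last first.
  by rewrite /mxtrace big_ord1.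
rewrite -[leRHS]addr0; apply: lerD; last first.
  by rewrite mulr_ge0_le0// invr_ge0.
apply: IH => [|z|j jl].
- by rewrite /B' linearB/= linearZ/= trmx_mul trmxK sB.
- rewrite bformBm bformZm bform_rank1 (dotC v) -expr2.
  have [/v0 ->|an0] := eqVneq a 0.
    by rewrite dotC dot0l expr0n/= mulr0 subr0.
  have ap : 0 < a by rewrite lt_def an0.
  rewrite subr_ge0 -(ler_pM2r ap) mulrAC mulVf// mul1r.
  exact: cs.
- have vvE : v *m v^T *m delta_mx j ord0 =
      bform B e (delta_mx j ord0) *: v :> 'cV_d.
    rewrite -mulmxA (_ : v^T *m _ = (bform B e (delta_mx j ord0))%:M).
      by rewrite mul_mx_scalar.
    apply/matrixP => j1 j2; rewrite !ord1 [RHS]mxE eqxx mulr1n.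
    rewrite -[LHS]/(dot v (delta_mx j ord0)).
    by rewrite dotC vE bform_sym.
  rewrite /B' mulmxBl -scalemxAl vvE.
  have [ji|ji] := eqVneq j i.
    have [a00|an0] := eqVneq a 0.
      by rewrite (v0 a00) !scaler0 subr0 ji -/e -/v (v0 a00).
    by rewrite ji -/e -/v -/a scalerA mulVf// scale1r subrr.
  have Bj : B *m delta_mx j ord0 = 0 :> 'cV_d.
    by apply: B0; rewrite inE negb_or ji.
  by rewrite bform_dot Bj dotC dot0l scale0r scaler0 subr0.
Qed.

Lemma trace_psd_mul_le B M c : B^T = B -> (forall z, 0 <= bform B z z) ->
  (forall z, bform M z z <= c * dot z z) -> \tr (B *m M) <= c * \tr B.
Proof.
move=> sB pB MC; rewrite -subr_le0.
have -> : \tr (B *m M) - c * \tr B = \tr (B *m (M - c%:M)).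
  by rewrite mulmxBr mul_mx_scalar mxtraceD raddfN/= mxtraceZ.
apply: trace_psd_mul_le0 => // z.
by rewrite bformBm bform_scalar subr_le0.
Qed.

Lemma trace_le M c : (forall z, bform M z z <= c * dot z z) ->
  \tr M <= d%:R * c.
Proof.
move=> Mc; rewrite trace_bform (_ : d%:R * c = \sum_(i < d) c).
  apply: ler_sum => i _; apply: le_trans (Mc _) _.
  by rewrite dot_delta mxE !eqxx mulr1.
by rewrite sumr_const card_ord mulr_natl.
Qed.

Lemma enormE x : enorm x = Num.sqrt (dot x x).
Proof.
by rewrite /enorm mxtrace_mulC /mxtrace big_ord1.
Qed.

Lemma enorm_sqr x : enorm x ^+ 2 = dot x x.
Proof. by rewrite enormE sqr_sqrtr// dot_ge0. Qed.

Lemma enorm_ge0 m n (M : 'M[R]_(m, n)) : 0 <= enorm M.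
Proof. exact: sqrtr_ge0. Qed.

Lemma enorm0 : enorm (0 : 'cV[R]_d) = 0.
Proof. by rewrite enormE dot0l sqrtr0. Qed.

Lemma enorm_gt0 x : (0 < enorm x) = (x != 0).
Proof.
rewrite enormE sqrtr_gt0 lt_def dot_ge0 andbT; congr (~~ _).
apply/eqP/eqP => [|->]; last by rewrite dot0l.
rewrite dotE => /eqP; rewrite psumr_eq0; last first.
  by move=> i _; rewrite -expr2 sqr_ge0.
move=> /allP x0; apply/matrixP => i j; rewrite ord1 mxE.
have /(_ (mem_index_enum i)) := x0 i.
by rewrite mulf_eq0 orbb => /eqP.
Qed.

Lemma enormN x : enorm (- x) = enorm x.
Proof. by rewrite !enormE dotNl dotNr opprK. Qed.

Lemma enormZ a x : enorm (a *: x) = `|a| * enorm x.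
Proof.
by rewrite !enormE dotZl dotZr mulrA -expr2 sqrtrM ?sqr_ge0// sqrtr_sqr.
Qed.

Lemma enormBC x y : enorm (x - y) = enorm (y - x).
Proof. by rewrite -enormN opprB. Qed.

Lemma dot_sqr_le x y : dot x y ^+ 2 <= dot x x * dot y y.
Proof.
have := @cauchy_schwarz_psd 1%:M x y; rewrite !bform_scalar !mul1r; apply.
  by rewrite trmx1.
by move=> z; rewrite bform_scalar mul1r dot_ge0.
Qed.

Lemma dot_le x y : dot x y <= enorm x * enorm y.
Proof.
have h : 0 <= enorm x * enorm y by rewrite mulr_ge0// enorm_ge0.
have [xy|xy] := leP (dot x y) 0; first exact: le_trans h.
rewrite -(@ler_pXn2r _ 2)// ?nnegrE; last exact: ltW.
rewrite exprMn !enorm_sqr.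
exact: dot_sqr_le.
Qed.

Lemma coord_le_enorm x i : `|x i ord0| <= enorm x.
Proof.
rewrite enormE -sqrtr_sqr ler_sqrt ?dot_ge0// dotE (bigD1 i)//= -expr2.
by rewrite lerDl sumr_ge0// => j _; rewrite -expr2 sqr_ge0.
Qed.

Lemma bform_enorm_le M x : bform M x x <= enorm M * dot x x.
Proof.
rewrite -enorm_sqr bform_dot; apply: le_trans (dot_le _ _) _.
rewrite mulrC expr2 mulrA ler_wpM2r ?enorm_ge0//.
rewrite -(@ler_pXn2r _ 2)// ?nnegrE ?enorm_ge0 ?mulr_ge0 ?enorm_ge0//.
rewrite exprMn !enorm_sqr /enorm sqr_sqrtr; last first.
  rewrite /mxtrace sumr_ge0// => i _; rewrite mxE sumr_ge0// => j _.
  by rewrite mxE -expr2 sqr_ge0.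
rewrite dotE /mxtrace mulr_suml; apply: ler_sum => i _.
rewrite -expr2 (_ : (M *m x) i ord0 = dot (row i M)^T x); last first.
  by rewrite dotE mxE; apply: eq_bigr => j _; rewrite !mxE.
apply: le_trans (dot_sqr_le _ _) _.
rewrite [X in X * _](_ : _ = (M *m M^T) i i)//.
by rewrite dotE mxE; apply: eq_bigr => j _; rewrite !mxE.
Qed.

End euclid.

(** * Directional derivatives from continuous partial derivatives *)

Section directional.
Context {R : realType} {V : normedModType R}.
Implicit Types (f : V -> R) (x y h e : V).

Lemma is_derive_line f x e (s df : R) :
  is_derive (x + s *: e) e f df ->
  is_derive s 1 (fun t : R => f (x + t *: e)) df.
Proof.
move=> [dfe <-].
have E : (fun h : R => h^-1 *: (((fun t : R => f (x + t *: e)) \o shift s)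
    (h *: 1) - f (x + s *: e))) =
  (fun h : R => h^-1 *: ((f \o shift (x + s *: e)) (h *: e) - f (x + s *: e))).
  apply/funext => h /=; congr (_ *: (f _ - _)).
  by rewrite [h *: 1]mulr1 scalerDl addrCA.
by apply: DeriveDef; rewrite /derivable/derive E.
Qed.

Lemma mvt_line f x e (c : R) : (forall y, derivable f y e) ->
  exists2 t : R, `|t| <= `|c| & f (x + c *: e) - f x = c * 'D_e f (x + t *: e).
Proof.
move=> df; pose g t := f (x + t *: e).
have dg (t : R) : is_derive t 1 g ('D_e f (x + t *: e)).
  by apply: is_derive_line; exact/derivableP/df.
have cg (i : interval R) : {within [set` i], continuous g}.
  by apply: derivable_within_continuous => t _.
have g0 : g 0 = f x by rewrite /g scale0r addr0.
have [c0|c0] := leP 0 c.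
  have [t] := MVT_segment c0 (fun t _ => dg t) (cg _).
  rewrite in_itv/= => /andP[t0 tc]; rewrite subr0 g0 => E.
  by exists t; [rewrite !ger0_norm// (le_trans t0)|rewrite E mulrC].
have [t] := MVT_segment (ltW c0) (fun t _ => dg t) (cg _).
rewrite in_itv/= => /andP[t0 tc]; rewrite sub0r g0 => E; exists t.
  by rewrite (ler0_norm (ltW c0)) ler0_norm// lerN2.
by rewrite -opprB E mulrN opprK mulrC.
Qed.

(** The increment is split at x + s h: the first piece gives the derivative
    along h, and the mean value theorem on the second piece, parallel to e,
    gives an intermediate value that tends to the one at x. *)
Lemma is_derive_addZ f x h e (c a : R) :
  is_derive x h f a -> (forall y, derivable f y e) ->
  {for x, continuous ('D_e f)} ->
  is_derive x (h + c *: e) f (a + c * 'D_e f x).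
Proof.
move=> [dfh <-] dfe cfe.
suff H : (fun s : R => s^-1 *: ((f \o shift x) (s *: (h + c *: e)) - f x))
    @ 0^' --> 'D_h f x + c * 'D_e f x.
  by apply: DeriveDef; [apply/cvg_ex; eexists; exact: H|exact: cvg_lim H].
rewrite (_ : (fun s : R => _) = (fun s : R =>
    s^-1 *: ((f \o shift x) (s *: h) - f x) +
    s^-1 *: (f (x + s *: h + (s * c) *: e) - f (x + s *: h)))); last first.
  apply/funext => s /=; rewrite -scalerDr (addrC (s *: h)).
  have -> : s *: (h + c *: e) + x = x + s *: h + (s * c) *: e.
    by rewrite scalerDr scalerA addrC addrA.
  by congr (_ *: _); ring.
apply: cvgD; first exact: dfh.
apply/cvgrPdist_lt => eps eps0.
pose q := eps / (`|c| + 1).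
have q0 : 0 < q by rewrite divr_gt0// ltr_wpDl.
have /cvgrPdist_lt/(_ _ q0)/nbhs_ballP[r /= r0 Hr] := cfe.
pose B := `|h| + `|c| * `|e| + 1.
have B0 : 0 < B by rewrite ltr_wpDl// addr_ge0// mulr_ge0.
have rB : 0 < r / B by rewrite divr_gt0.
exists (r / B) => //= s; rewrite /ball_/= sub0r normrN => sr s0.
have [t tsc ->] := @mvt_line f (x + s *: h) e (s * c) dfe.
rewrite [_ *: _]mulrA mulrA mulVf// mul1r -mulrBr normrM.
apply: (@le_lt_trans _ _ (`|c| * q)); last first.
  rewrite /q mulrC -mulrA gtr_pMr// mulrC ltr_pdivrMr ?ltr_wpDl//.
  by rewrite mul1r ltrDl.
rewrite ler_wpM2l// ltW//; apply: Hr.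
rewrite -ball_normE/= -addrA opprD addrA subrr sub0r normrN.
apply: (@le_lt_trans _ _ (`|s| * B)); last by rewrite -ltr_pdivlMr.
apply: le_trans (ler_normD _ _) _; rewrite !normrZ !mulrDr mulr1 -addrA.
rewrite lerD2l -[leLHS]addr0 lerD// mulrA ler_wpM2r//.
by rewrite -normrM.
Qed.

End directional.

Section gradient_theory.
Context {R : realType} {d : nat}.
Implicit Types (f : 'cV[R]_d -> R) (x y xi eta : 'cV[R]_d).

Lemma col_sum_delta x : x = \sum_i x i ord0 *: delta_mx i ord0.
Proof.
by rewrite {1}[x]matrix_sum_delta; apply: eq_bigr => i _; rewrite big_ord1.
Qed.

Lemma is_derive_gradient f x xi :
  (forall i y, derivable f y (delta_mx i ord0)) ->
  (forall i, {for x, continuous (partial i f)}) ->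
  is_derive x xi f (dot xi (gradient f x)).
Proof.
move=> df cf; rewrite dotE [in X in is_derive _ X](col_sum_delta xi).
elim: (index_enum _) => [|i s IH].
  by rewrite !big_nil; exact: is_derive0.
rewrite !big_cons addrC [X in is_derive _ _ _ X]addrC [gradient _ _ _ _]mxE.
by apply: is_derive_addZ => //; exact: cf.
Qed.

Lemma is_derive_hessian f x xi : C2 f ->
  is_derive x xi (fun y => dot xi (gradient f y)) (bform (hessian f x) xi xi).
Proof.
move=> [_ _ _ df2 cf2].
rewrite (_ : (fun y => _) = (fun y => \sum_j xi j ord0 * partial j f y)).
  rewrite (_ : bform _ _ _ = \sum_j xi j ord0 * dot xi (gradient (partial j f) x)).
    pose h (j : 'I_d) (y : 'cV[R]_d) := xi j ord0 * partial j f y.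
    have dh j : is_derive x xi (h j)
        (xi j ord0 * dot xi (gradient (partial j f) x)).
      apply: (@is_deriveZ _ _ _ (partial j f) (xi j ord0)).
      by apply: is_derive_gradient => [//|i]; exact: cf2.
    rewrite (_ : (fun y => _) = \sum_j h j); first exact: is_derive_sum.
    by apply/funext => y; rewrite fct_sumE.
  rewrite bform_dot dotE; under eq_bigr do rewrite mxE mulr_sumr.
  rewrite exchange_big/=; apply: eq_bigr => j _; rewrite dotE mulr_sumr.
  by apply: eq_bigr => i _; rewrite !mxE; ring.
by apply/funext => y; rewrite dotE; apply: eq_bigr => j _; rewrite mxE.
Qed.

End gradient_theory.

(** * First and second order conditions at a point of contact *)

Section contact.
Context {R : realType}.
Implicit Types g dg : R -> R.

Lemma is_derive_parabola (k a c s : R) :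
  is_derive s 1 (fun t : R => k + a * t + c * t ^+ 2) (a + 2 * c * s).
Proof.
rewrite (_ : (fun t => _) = cst k + a *: id + c *: (id ^+ 2)).
  have D1 : is_derive s 1 (@id R) 1 by exact: is_derive_id.
  have D2 : is_derive s 1 ((@id R) ^+ 2) ((2%:R * s ^+ 1) *: 1).
    exact: is_deriveX.
  apply: (is_derive_eq (is_deriveD (is_deriveD (is_derive_cst k s 1)
    (is_deriveZ a D1)) (is_deriveZ c D2))).
  by rewrite add0r /GRing.scale/=; ring.
by apply/funext => t; rewrite !fctE.
Qed.

Lemma contact_parabola g dg (ddg a c : R) :
  (forall s : R, is_derive s 1 g (dg s)) -> is_derive (0 : R) 1 dg ddg ->
  (\forall s \near (0 : R), g s <= g 0 + a * s + c * s ^+ 2) ->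
  dg 0 = a /\ ddg <= 2 * c.
Proof.
move=> Dg Ddg /nbhs_ballP[r /= r0 Hr].
pose G s := g s - (g 0 + a * s + c * s ^+ 2).
pose dG s := dg s - (a + 2 * c * s).
have DG (s : R) : is_derive s 1 G (dG s).
  by apply: is_deriveB; exact: is_derive_parabola.
have G0 : G 0 = 0 by rewrite /G expr0n/= !mulr0 !addr0 subrr.
have Gle s : `|s| < r -> G s <= 0.
  by move=> sr; rewrite subr_le0; apply: Hr; rewrite /ball/= sub0r normrN.
have rI : (0 : R) \in `]- r, r[ by rewrite in_itv/= oppr_lt0 r0.
have dG0 : dG 0 = 0.
  have : is_derive (0 : R) 1 G 0.
    apply: (@derive1_at_max _ G (- r) r) => // [|t].
      by rewrite -subr_ge0 opprK addr_ge0// ltW.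
    by rewrite in_itv/= => tr; rewrite G0 Gle// ltr_norml.
  by move=> /@derive_val; rewrite (@derive_val _ _ _ _ _ _ _ (DG 0)).
have dg0 : dg 0 = a by move/eqP: dG0; rewrite /dG mulr0 addr0 subr_eq0 => /eqP.
split=> //; rewrite leNgt; apply/negP => cd.
have : is_derive (0 : R) 1 dG (ddg - 2 * c).
  apply: is_deriveB; rewrite (_ : (fun s => _) =
    (fun s => a + (2 * c) * s + 0 * s ^+ 2)).
    apply: (is_derive_eq (is_derive_parabola a (2 * c) 0 0)).
    by rewrite !mulr0 addr0.
  by apply/funext => t; rewrite mul0r addr0.
case=> + dE; rewrite /derivable => dGc.
have eta0 : 0 < ddg - 2 * c by rewrite subr_gt0.
have : (fun h : R => h^-1 *: ((dG \o shift 0) (h *: 1) - dG 0)) @ 0^' -->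
    ddg - 2 * c by rewrite -dE; exact: dGc.
move=> /cvgr_gt/(_ _ eta0)[q /= q0 Hq].
pose s := Num.min (q / 2) (r / 2).
have s0 : 0 < s by rewrite lt_min !divr_gt0.
have sq : s < q by rewrite gt_min ltr_pdivrMr// ltr_pMr// ltr1n.
have sr : s < r.
  by rewrite gt_min orbC ltr_pdivrMr// ltr_pMr// ltr1n.
have cG : {within `[0, s], continuous G}.
  by apply: derivable_within_continuous => t _; case: (DG t).
have [t] := MVT s0 (fun t _ => DG t) cG; rewrite in_itv/= => /andP[t0 ts].
rewrite G0 !subr0 => GE.
have := Gle s; rewrite GE gtr0_norm// => /(_ sr); rewrite leNgt => /negP; apply.
rewrite mulr_gt0//.
have := Hq t; rewrite /ball_/= sub0r normrN gtr0_norm// (lt_trans ts sq) => /(_ isT).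
rewrite gt_eqF// => /(_ isT); rewrite dG0 subr0/= addr0 [t *: 1]mulr1.
by rewrite [_ *: _]mulrC pmulr_lgt0 ?invr_gt0.
Qed.

Lemma derive1_ge_left_max g (t a : R) : derivable g t 1 ->
  (\forall s \near t, s <= t -> g s <= g t + a * (s - t)) -> a <= derive1 g t.
Proof.
move=> dg H; rewrite leNgt; apply/negP => ga.
have : (fun h : R => h^-1 *: ((g \o shift t) h - g t)) @ 0^' --> derive1 g t.
  by rewrite derive1E; move: dg; rewrite /derivable/derive/=;
    under eq_fun do rewrite [_%:A]mulr1.
move=> /cvgr_lt/(_ _ ga)[q /= q0 Hq].
case/nbhs_ballP : H => r /= r0 Hr.
pose s := - Num.min (q / 2) (r / 2).
have s0 : s < 0 by rewrite oppr_lt0 lt_min !divr_gt0.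
have sq : `|s| < q.
  by rewrite ltr0_norm// opprK gt_min ltr_pdivrMr// ltr_pMr// ltr1n.
have sr : `|s| < r.
  by rewrite ltr0_norm// opprK gt_min orbC ltr_pdivrMr// ltr_pMr// ltr1n.
have := Hr (s + t); rewrite /ball/= opprD addrCA subrr addr0 normrN => /(_ sr).
rewrite gerDr addrK => /(_ (ltW s0)) Hg.
have := Hq s; rewrite /ball_/= sub0r normrN => /(_ sq); rewrite lt_eqF// => /(_ isT)/=.
rewrite [_ *: _]mulrC ltr_ndivrMr// ltNge => /negP; apply.
by rewrite lerBlDl.
Qed.

End contact.

Section contact_pair.
Context {R : realType} {d : nat}.
Implicit Types (f : 'cV[R]_d -> R) (x y xi eta : 'cV[R]_d).

Lemma contact_pair f1 f2 x y xi eta (a c : R) : C2 f1 -> C2 f2 ->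
  (\forall s \near (0 : R),
    f1 (x + s *: xi) - f2 (y + s *: eta) <= f1 x - f2 y + a * s + c * s ^+ 2) ->
  dot xi (gradient f1 x) - dot eta (gradient f2 y) = a /\
  bform (hessian f1 x) xi xi - bform (hessian f2 y) eta eta <= 2 * c.
Proof.
move=> C1 C2 H.
have D1 f z h (s : R) : Defs.C2 f -> is_derive s 1 (fun s : R => f (z + s *: h))
    (dot h (gradient f (z + s *: h))).
  move=> [_ df cf _ _]; apply: is_derive_line.
  by apply: is_derive_gradient => [//|i]; exact: cf.
have D2 f z h : Defs.C2 f ->
    is_derive (0 : R) 1 (fun s : R => dot h (gradient f (z + s *: h)))
    (bform (hessian f z) h h).
  move=> Cf; apply: (@is_derive_line _ _ (fun y => dot h (gradient f y))).
  by rewrite scale0r addr0; exact: is_derive_hessian.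
have := @contact_parabola _ (fun s => f1 (x + s *: xi) - f2 (y + s *: eta))
  (fun s => dot xi (gradient f1 (x + s *: xi)) -
            dot eta (gradient f2 (y + s *: eta)))
  (bform (hessian f1 x) xi xi - bform (hessian f2 y) eta eta) a c.
rewrite !scale0r !addr0; apply => // [s|].
- by apply: is_deriveB; exact: D1.
- by apply: is_deriveB; exact: D2.
Qed.

End contact_pair.

(** * The maximum principle for bounded classical solutions *)

Lemma exists_small3 {R : realType} (a1 a2 a3 s1 s2 s3 : R) :
  0 <= a1 -> 0 <= a2 -> 0 <= a3 -> 0 < s1 -> 0 < s2 -> 0 < s3 ->
  exists2 eps : R, 0 < eps & [/\ eps * a1 <= s1, eps * a2 <= s2 & eps * a3 <= s3].
Proof.
move=> a10 a20 a30 s10 s20 s30; pose q a s : R := s / (a + 1).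
have q0 a s : 0 <= a -> 0 < s -> 0 < q a s.
  by move=> a0 s0; rewrite divr_gt0// ltr_wpDl.
pose eps := Num.min (q a1 s1) (Num.min (q a2 s2) (q a3 s3)).
have eps0 : 0 < eps by rewrite !lt_min !q0.
have : eps <= eps by []; rewrite {2}/eps !le_min => /and3P[e1 e2 e3].
have P a s : 0 <= a -> eps <= q a s -> eps * a <= s.
  move=> a0; rewrite ler_pdivlMr ?ltr_wpDl//; apply: le_trans.
  by apply: ler_wpM2l; [exact: ltW|rewrite lerDl].
by exists eps => //; split; exact: P.
Qed.

Section topology_of_columns.
Context {R : realType}.

Lemma continuous_trmx m n : continuous (trmx : 'M[R]_(m, n) -> 'M[R]_(n, m)).
Proof.
move=> M s /= /(nbhs_ballP M^T)[e e0 es]; apply/nbhs_ballP.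
by exists e => //= N [_ MN]; apply: es; split=> // i j; rewrite !mxE; exact: MN.
Qed.

Definition box {d : nat} (r : R) : set 'cV[R]_d :=
  [set x | forall i, `|x i ord0| <= r].

Lemma compact_box d r : compact (@box d r).
Proof.
have -> : @box d r = trmx @` [set v : 'rV[R]_d |
    forall i, (fun=> `[- r, r]%classic) i (v ord0 i)].
  apply/seteqP; split => [x xr|_ [v vr <-]] /=.
    exists x^T; last by rewrite trmxK.
    by move=> i /=; rewrite in_itv/= mxE -ler_norml.
  by move=> i; rewrite mxE; have := vr i; rewrite /= in_itv/= -ler_norml.
apply: continuous_compact; first exact/continuous_subspaceT/continuous_trmx.
by apply: (@rV_compact _ _ (fun=> `[- r, r]%classic)) => i; exact: segment_compact.
Qed.

Lemma continuous_sum {T : topologicalType} {I : Type} (s : seq I)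
    (f : I -> T -> R) : (forall i, continuous (f i)) ->
  continuous (fun z => \sum_(i <- s) f i z).
Proof.
move=> cf z; elim: s => [|i s IH].
  by under eq_fun do rewrite big_nil; exact: cvg_cst.
have -> : (fun z => \sum_(j <- i :: s) f j z) =
    (fun z => f i z + \sum_(j <- s) f j z).
  by apply/funext => w; rewrite big_cons.
by apply: cvgD IH; exact: cf.
Qed.

Lemma continuous_dot {T : topologicalType} {d} (f g : T -> 'cV[R]_d) :
  continuous f -> continuous g -> continuous (fun z => dot (f z) (g z)).
Proof.
move=> cf cg; rewrite (_ : (fun _ => _) =
  (fun z => \sum_i f z i ord0 * g z i ord0)); last first.
  by apply/funext => z; rewrite dotE.
have cc (h : T -> 'cV[R]_d) i : continuous h ->
    continuous (fun z => h z i ord0).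
  move=> ch z; apply: (@continuous_comp _ _ _ h (fun M : 'cV[R]_d => M i ord0)).
    exact: ch.
  exact: coord_continuous.
by apply: continuous_sum => i z; apply: cvgM; exact: cc.
Qed.

Lemma continuous_enorm {T : topologicalType} {d} (f : T -> 'cV[R]_d) :
  continuous f -> continuous (fun z => enorm (f z)).
Proof.
move=> cf z.
rewrite (_ : (fun z => _) = (fun z => Num.sqrt (dot (f z) (f z)))); last first.
  by apply/funext => w; rewrite enormE.
apply: (@continuous_comp _ _ _ (fun z => dot (f z) (f z)) Num.sqrt).
  exact: continuous_dot.
exact: sqrt_continuous.
Qed.

(** Continuity up to time 0 is used through this extension by the initial value
    to negative times. *)
Lemma continuous_clamp_time d (u : 'cV[R]_d -> R -> R) :
  {within [set z : 'cV[R]_d * R | 0 <= z.2], continuous (fun z => u z.1 z.2)} ->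
  continuous (fun z : 'cV[R]_d * R => u z.1 (Num.max 0 z.2)).
Proof.
move=> /subspace_continuousP cu z.
have z0 : [set z : 'cV[R]_d * R | 0 <= z.2] (z.1, Num.max 0 z.2).
  by rewrite /= le_max lexx.
have cr : (fun w : 'cV[R]_d * R => (w.1, Num.max 0 w.2)) @ z -->
    (z.1, Num.max 0 z.2).
  apply: (@cvg_pair _ _ _ (nbhs z) (nbhs z.1) (nbhs (Num.max 0 z.2))).
    exact: cvg_fst.
  apply: (@continuous_max _ _ (cst 0) (@snd 'cV[R]_d R)); first exact: cvg_cst.
  exact: cvg_snd.
move=> B /(cu _ z0); rewrite /within /= => /cr /=; rewrite !nbhs_simpl/=.
by apply: filterS => w; apply; rewrite le_max lexx.
Qed.

End topology_of_columns.

Section classical_solution_theory.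
Context {R : realType} {d : nat}.
Implicit Types (A : 'cV[R]_d -> 'M[R]_d) (b : 'cV[R]_d -> 'cV[R]_d).

Lemma classical_solution_C2 A b u (t : R) :
  classical_solution A b u -> 0 < t -> C2 (u ^~ t).
Proof.
move=> S t0.
have sec (h : 'cV[R]_d * R -> R) x : {for (x, t), continuous h} ->
    {for x, continuous (fun y => h (y, t))}.
  move=> ch; apply: (@continuous_comp _ _ _ (fun y => (y, t)) h) => //.
  apply: (@cvg_pair _ _ _ (nbhs x) (nbhs x) (nbhs t)); first exact: cvg_id.
  exact: cvg_cst.
split=> [x|i x|i x|i j x|i j x].
- exact: (sec (fun z => u z.1 z.2) x (@solution_continuous _ _ _ _ _ S x t t0)).
- exact: (solution_derivable_space S).
- exact: (sec (fun z => partial i (u ^~ z.2) z.1) x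
    (@solution_continuous_space _ _ _ _ _ S i x t t0)).
- exact: (solution_derivable_space2 S).
- exact: (sec (fun z => partial i (partial j (u ^~ z.2)) z.1) x
    (@solution_continuous_space2 _ _ _ _ _ S i j x t t0)).
Qed.

(** The structural bounds on the coefficients that all estimates below depend
    on; lip serves both as a Lipschitz constant of A, in the sense of quadratic
    forms, and of b. *)
Record parabolic_bounds A b (lam Lam lip bd : R) : Prop := {
  pb_lam : 0 < lam ;
  pb_lip : 0 <= lip ;
  pb_bd : 0 <= bd ;
  pb_sym : forall x, (A x)^T = A x ;
  pb_ge : forall x xi, lam * dot xi xi <= bform (A x) xi xi ;
  pb_le : forall x xi, bform (A x) xi xi <= Lam * dot xi xi ;
  pb_lipA : forall x y xi,
    bform (A x - A y) xi xi <= lip * enorm (x - y) * dot xi xi ;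
  pb_drift : forall x, enorm (b x) <= bd ;
  pb_lipb : forall x y, enorm (b x - b y) <= lip * enorm (x - y) }.

Lemma pb_psd A b lam Lam lip bd : parabolic_bounds A b lam Lam lip bd ->
  forall x xi, 0 <= bform (A x) xi xi.
Proof.
move=> H x xi; apply: le_trans (pb_ge H x xi).
by rewrite mulr_ge0 ?dot_ge0// ltW// (pb_lam H).
Qed.

Lemma generatorE A b f x :
  generator A b f x = 2^-1 * \tr (A x *m hessian f x) - dot (b x) (gradient f x).
Proof. by []. Qed.

Lemma pb_Lam_ge0 A b lam Lam lip bd : (0 < d)%N ->
  parabolic_bounds A b lam Lam lip bd -> 0 <= Lam.
Proof.
move=> d0 H; have := pb_le H 0 (delta_mx (Ordinal d0) ord0).
rewrite dot_delta mxE !eqxx mulr1; apply: le_trans; exact: pb_psd H _ _.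
Qed.

(** Penalizing by eta t + eps |x|^2 forces a positive maximum of the penalized
    u - m at some (x, t) with t > 0, where the equation would give
    eta <= eps d Lam + 2 eps |x| bd.  The last term tends to 0 with eps because
    eps |x|^2 stays bounded by N at such a point. *)
Lemma maximum_principle A b lam Lam lip bd f u (m : R) : (0 < d)%N ->
  parabolic_bounds A b lam Lam lip bd -> cauchy_solution A b f u ->
  (forall x, f x <= m) -> forall x (t : R), 0 <= t -> u x t <= m.
Proof.
move=> d0 H S fm x0 t0 t0_ge0; rewrite leNgt; apply/negP => um.
have [Mu uMu] := cauchy_bounded S; have CS := cauchy_classical S.
have Lam0 := pb_Lam_ge0 d0 H; have bd0 := pb_bd H.
have t0_gt0 : 0 < t0.
  rewrite lt_def t0_ge0 andbT; apply/eqP => t00; move: um.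
  by rewrite t00 (cauchy_initial S) ltNge fm.
pose N := Mu + `|m|; pose de := u x0 t0 - m; pose eta := de / (2 * t0).
have de0 : 0 < de by rewrite subr_gt0.
have eta0 : 0 < eta by rewrite divr_gt0// mulr_gt0.
have N0 : 0 <= N.
  by rewrite addr_ge0//; apply: le_trans (uMu x0 t0 t0_ge0).
have uN x t : 0 <= t -> u x t - m <= N.
  move=> tge0; apply: lerD; first exact: le_trans (ler_norm _) (uMu _ _ tge0).
  by rewrite (le_trans (ler_norm _))// normrN.
pose q := eta / (8 * (bd + 1)).
have q0 : 0 < q by rewrite divr_gt0// mulr_gt0// ltr_wpDl.
(* the three conditions: a positive value at (x0, t0), smallness of the drift
   term at the maximum, smallness of the second order term *)
have [eps eps0 [ee1 ee2 ee3]] : exists2 eps : R, 0 < eps &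
    [/\ eps * dot x0 x0 <= de / 4, eps * N <= q ^+ 2 &
        eps * (d%:R * Lam) <= eta / 4].
  apply: exists_small3 => //; [exact: dot_ge0|exact: mulr_ge0|exact: divr_gt0|
    exact: exprn_gt0|exact: divr_gt0].
pose Phi x t := u x t - m - eta * t - eps * dot x x.
pose F (z : 'cV[R]_d * R) := u z.1 (Num.max 0 z.2) - m - eta * z.2 -
  eps * dot z.1 z.1.
have cF : continuous F.
  move=> z; apply: cvgB; [apply: cvgB; [apply: cvgB|]|].
  - exact: continuous_clamp_time (cauchy_continuous S) z.
  - exact: cvg_cst.
  - by apply: cvgM; [exact: cvg_cst|exact: cvg_snd].
  - apply: cvgM; first exact: cvg_cst.
    by apply: continuous_dot => w; exact: cvg_fst.
have FPhi x t : 0 <= t -> F (x, t) = Phi x t.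
  by move=> tge0; rewrite /F /Phi/= max_r.
have Phi0 : 0 < Phi x0 t0.
  rewrite /Phi -/de (_ : eta * t0 = de / 2); last first.
    by rewrite /eta; field; rewrite gt_eqF.
  by move: ee1 de0; lra.
pose r := N / eps + 1.
have r1 : 1 <= r by rewrite lerDr divr_ge0// ltW.
have Phi_box x t : 0 <= t -> 0 < Phi x t -> eps * dot x x < N /\ box r x.
  move=> tge0 P0; have exN : eps * dot x x < N.
    apply: lt_le_trans (uN x t tge0).
    move: P0; rewrite /Phi subr_gt0 => /lt_le_trans; apply.
    by rewrite gerBl// mulr_ge0// ltW.
  split=> // i; rewrite leNgt; apply/negP => rx; move: exN; rewrite ltNge.
  move=> /negP; apply; rewrite mulrC -ler_pdivrMr// -enorm_sqr.
  have rx' : r <= enorm x by apply: ltW; apply: lt_le_trans rx (coord_le_enorm _ _).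
  apply: (@le_trans _ _ (r * r)); last by rewrite expr2 ler_pM// (le_trans ler01).
  by apply: (@le_trans _ _ r); rewrite ?lerDl ?ler_peMr// (le_trans ler01).
have [z0 z0K z0F] : exists2 z, z \in box r `*` `[0, t0]%classic &
    forall w, w \in box r `*` `[0, t0]%classic -> F w <= F z.
  apply: compact_EVT_max; last exact: continuous_subspaceT.
    exists (x0, t0); split=> /=; first by have [] := Phi_box _ _ t0_ge0 Phi0.
    by rewrite in_itv/= t0_ge0 lexx.
  by apply: compact_setX; [exact: compact_box|exact: segment_compact].
case: z0 z0K z0F => x t; rewrite inE => -[/= _].
rewrite in_itv/= => /andP[tge0 tt0] maxF.
have max w s : 0 <= s <= t0 -> Phi w s <= Phi x t.
  move=> /andP[s0 st0].
  have bx0 : box r x0 by have [] := Phi_box _ _ t0_ge0 Phi0.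
  have Pxt : 0 < Phi x t.
    apply: lt_le_trans Phi0 _; rewrite -!FPhi//; apply: maxF.
    by rewrite inE; split => //=; rewrite in_itv/= t0_ge0 lexx.
  have [Pw|Pw] := leP (Phi w s) 0; first by rewrite (le_trans Pw)// ltW.
  rewrite -!FPhi//; apply: maxF; rewrite inE; split=> /=.
    by have [] := Phi_box _ _ s0 Pw.
  by rewrite in_itv/= s0.
have Pxt : 0 < Phi x t by apply: lt_le_trans Phi0 _; apply: max; rewrite t0_ge0 lexx.
have [epsN _] := Phi_box _ _ tge0 Pxt.
have t_gt0 : 0 < t.
  rewrite lt_def tge0 andbT; apply/eqP => t00; move: Pxt.
  rewrite t00 /Phi mulr0 subr0 (cauchy_initial S) ltNge => /negP; apply.
  rewrite subr_le0 (@le_trans _ _ 0) ?subr_le0//.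
  by rewrite mulr_ge0 ?dot_ge0// ltW.
have ut : eta <= derive1 (u x) t.
  apply: derive1_ge_left_max; first exact: (solution_derivable_time CS).
  near=> s => st; have : 0 < s by near: s; exact: lt_nbhsr.
  move=> s0; have : Phi x s <= Phi x t.
    by apply: max; rewrite ltW//= (le_trans st).
  by rewrite /Phi; lra.
have ctc xi : dot xi (gradient (u ^~ t) x) = 2 * eps * dot x xi /\
    bform (hessian (u ^~ t) x) xi xi <= 2 * eps * dot xi xi.
  have C := classical_solution_C2 CS t_gt0.
  have := @contact_pair R d (u ^~ t) (u ^~ t) x x xi 0
    (2 * eps * dot x xi) (eps * dot xi xi) C C.
  rewrite dot0l /bform trmx0 !mulmx0 [X in _ - X <= _]mxE !subr0 -/(bform _ _ _).
  rewrite [2 * (_ * _)]mulrA; apply.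
  near=> s; rewrite scaler0 addr0.
  have := max (x + s *: xi) t; rewrite tge0 tt0 => /(_ isT).
  rewrite /Phi !(dotDl, dotDr, dotZl, dotZr) (dotC xi x); nra.
have := ut; rewrite (solution_equation CS)// generatorE.
have trH : \tr (A x *m hessian (u ^~ t) x) <= 2 * eps * (d%:R * Lam).
  apply: le_trans (trace_psd_mul_le (pb_sym H x) (pb_psd H x)
    (fun xi => (ctc xi).2)) _.
  have eps2 : 0 <= 2 * eps by rewrite mulr_ge0// ltW.
  by rewrite ler_wpM2l//; apply: trace_le; exact: (pb_le H).
have [-> _] := ctc (b x).
have exq : eps * enorm x <= q.
  suff : (eps * enorm x) ^+ 2 <= q ^+ 2.
    have h : 0 <= eps * enorm x by rewrite mulr_ge0 ?enorm_ge0// (ltW eps0).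
    by rewrite ler_sqr// nnegrE (ltW q0).
  rewrite exprMn enorm_sqr expr2 -mulrA; apply: le_trans ee2.
  by rewrite ler_wpM2l// ltW.
have qbd : q * bd <= eta / 8.
  have <- : q * (bd + 1) = eta / 8.
    by rewrite /q; field; rewrite gt_eqF// ltr_wpDl.
  by rewrite ler_wpM2l ?lerDl// (ltW q0).
have drift : - (2 * eps * dot x (b x)) <= 2 * (q * bd).
  rewrite -mulrA -mulrN ler_wpM2l// -mulrN -dotNr.
  apply: (@le_trans _ _ (eps * (enorm x * bd))); last first.
    by rewrite mulrA; exact: (ler_wpM2r bd0 exq).
  apply: ler_wpM2l; first exact: ltW.
  apply: le_trans (dot_le _ _) _; apply: ler_wpM2l; first exact: enorm_ge0.
  by rewrite enormN (pb_drift H).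
by apply/negP; rewrite -ltNge; lra.
Unshelve. all: by end_near. Qed.

End classical_solution_theory.

(** * A gradient estimate by doubling the variables *)

Section gradient_estimate.
Context {R : realType} {d : nat}.
Implicit Types (A : 'cV[R]_d -> 'M[R]_d) (b : 'cV[R]_d -> 'cV[R]_d).
Implicit Types (e x y xi eta : 'cV[R]_d).

(** The coupling behind the estimate.  Write A1 = (lam/2) e e^T + B + h and
    A2 = (lam/2) e e^T + B + E with B, E >= 0: the parts e e^T are coupled by
    reflection, which is where the strong bound - p1 is available, the parts B
    are coupled synchronously, and the remainders of size h independently. *)
Lemma trace_coupling_le (A1 A2 X Y : 'M[R]_d) e (lam Lam h p1 p2 p3 : R) :
  0 < lam -> 0 <= h <= lam / 2 -> 0 <= p2 -> 0 <= p3 ->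
  A1^T = A1 -> A2^T = A2 ->
  (forall xi, lam * dot xi xi <= bform A1 xi xi) ->
  (forall xi, bform A1 xi xi <= Lam * dot xi xi) ->
  (forall xi, bform (A1 - A2) xi xi <= h * dot xi xi) ->
  (forall xi, bform (A2 - A1) xi xi <= h * dot xi xi) ->
  dot e e = 1 -> bform X e e - bform Y e e <= - p1 ->
  (forall xi, bform X xi xi - bform Y xi xi <= p2 * dot xi xi) ->
  (forall xi, bform X xi xi <= p3 * dot xi xi) ->
  (forall xi, - bform Y xi xi <= p3 * dot xi xi) ->
  \tr (A1 *m X) - \tr (A2 *m Y) <=
    - (lam / 2 * p1) + d%:R * Lam * p2 + 3 * d%:R * h * p3.
Proof.
move=> lam0 /andP[h0 hlam] p20 p30 s1 s2 ge1 le1 l12 l21 ee1 Xe XY Xle Yle.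
pose B := A1 - (lam / 2) *: (e *m e^T) - h%:M.
pose E := A2 - A1 + h%:M.
have lam20 : 0 <= lam / 2 by rewrite divr_ge0// ltW.
have sym_e : (e *m e^T)^T = e *m e^T by rewrite trmx_mul trmxK.
have sB : B^T = B by rewrite /B !linearB/= linearZ/= sym_e tr_scalar_mx s1.
have sE : E^T = E by rewrite /E linearD/= linearB/= tr_scalar_mx s1 s2.
have BE xi : bform B xi xi =
    bform A1 xi xi - lam / 2 * dot xi e ^+ 2 - h * dot xi xi.
  by rewrite /B !bformBm bformZm bform_rank1 bform_scalar (dotC e) -expr2.
have pB xi : 0 <= bform B xi xi.
  rewrite BE; have := ge1 xi; have := dot_sqr_le xi e; rewrite ee1 mulr1.
  move=> cs ge; have := dot_ge0 xi; nra.
have pE xi : 0 <= bform E xi xi.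
  by have := l12 xi; rewrite /E !(bformDm, bformNm) bform_scalar; lra.
have trB : \tr B <= d%:R * Lam.
  apply: trace_le => xi; rewrite BE; have := le1 xi; have := sqr_ge0 (dot xi e).
  by have := dot_ge0 xi; nra.
have trE : \tr E <= d%:R * (2 * h).
  by apply: trace_le => xi; rewrite /E bformDm bform_scalar; have := l21 xi; lra.
have tree M : \tr (e *m e^T *m M) = bform M e e.
  by rewrite -mulmxA (mxtrace_mulC e) /mxtrace big_ord1.
have -> : \tr (A1 *m X) - \tr (A2 *m Y) =
  lam / 2 * (bform X e e - bform Y e e) + \tr (B *m (X - Y)) + h * \tr X +
  \tr (E *m - Y).
  have -> : A2 = (lam / 2) *: (e *m e^T) + B + E.
    by rewrite /E /B; apply/matrixP => i j; rewrite !mxE; ring.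
  rewrite {1}(_ : A1 = (lam / 2) *: (e *m e^T) + B + h%:M); last first.
    by rewrite /B; apply/matrixP => i j; rewrite !mxE; ring.
  rewrite !mulmxDl !mxtraceD -!scalemxAl !mxtraceZ !tree mulmxBr mulmxN.
  by rewrite mul_scalar_mx mxtraceZ !raddfB/= !raddfN/=; ring.
have t1 : \tr (B *m (X - Y)) <= d%:R * Lam * p2.
  apply: (@le_trans _ _ (p2 * \tr B)); last by rewrite mulrC ler_wpM2r.
  by apply: trace_psd_mul_le => // xi; rewrite bformBm.
have t2 : h * \tr X <= h * (d%:R * p3).
  by apply: ler_wpM2l => //; exact: trace_le.
have t3 : \tr (E *m - Y) <= d%:R * (2 * h) * p3.
  apply: (@le_trans _ _ (p3 * \tr E)); last by rewrite mulrC ler_wpM2r.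
  by apply: trace_psd_mul_le => // xi; rewrite bformNm.
have t4 : lam / 2 * (bform X e e - bform Y e e) <= - (lam / 2 * p1).
  by rewrite -mulrN; apply: ler_wpM2l.
by lra.
Qed.

(** The concave profile r - c r^2, increasing for r <= 1/(2c), with slope
    between 0 and 1 and second derivative - 2c. *)
Definition profile (c r : R) := r - c * r ^+ 2.

Lemma continuous_profile c : continuous (profile c).
Proof.
move=> r; apply: cvgB; first exact: cvg_id.
by apply: cvgM; [exact: cvg_cst|exact: exprn_continuous].
Qed.

Lemma enormD_sqr (z zeta : 'cV[R]_d) (s : R) : enorm (z + s *: zeta) ^+ 2 =
  enorm z ^+ 2 + 2 * dot z zeta * s + dot zeta zeta * s ^+ 2.
Proof.
by rewrite !enorm_sqr !(dotDl, dotDr, dotZl, dotZr) (dotC zeta z); ring.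
Qed.

Lemma profile_le_tangent c (r r' : R) : 0 < r ->
  profile c r' <= profile c r + ((2 * r)^-1 - c) * (r' ^+ 2 - r ^+ 2).
Proof.
move=> r0; rewrite -subr_ge0.
have -> : profile c r + ((2 * r)^-1 - c) * (r' ^+ 2 - r ^+ 2) - profile c r' =
    (2 * r)^-1 * (r' - r) ^+ 2.
  by rewrite /profile; field; rewrite gt_eqF.
by rewrite mulr_ge0 ?sqr_ge0// invr_ge0 mulr_ge0// ltW.
Qed.

Lemma enorm_radial (z : 'cV[R]_d) (r s : R) : enorm z = r -> 0 < r ->
  0 <= r + s -> enorm (z + s *: (r^-1 *: z)) = r + s.
Proof.
move=> zr r0 rs.
have -> : z + s *: (r^-1 *: z) = ((r + s) / r) *: z.
  rewrite scalerA -[z in z + _]scale1r -scalerDl mulrDl divff ?gt_eqF//.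
rewrite enormZ zr ger0_norm; last by rewrite divr_ge0// ltW.
by rewrite divfK// gt_eqF.
Qed.

Definition doubled u (K c M T eps : R) x y t := u x t - u y t -
  K * profile c (enorm (x - y)) - 2 * M * (1 - t / T) -
  eps * (dot x x + dot y y).

Section positive_maximum.
Variables (u : 'cV[R]_d -> R -> R) (K c M T eps : R).
Hypothesis cu : {within [set z : 'cV[R]_d * R | 0 <= z.2],
  continuous (fun z => u z.1 z.2)}.
Hypothesis uM : forall x t, 0 <= t -> `|u x t| <= M.
Hypotheses (T0 : 0 < T) (c0 : 0 < c) (eps0 : 0 < eps) (M0 : 0 <= M).
Hypothesis KM : 8 * c * M <= K.

Let r0 := (2 * c)^-1.
Let Phi := doubled u K c M T eps.
Let rho := 2 * M / eps + 1.

Local Ltac lra_goal := clear - d Phi rho cu uM T0 c0 eps0 M0 KM; intros; lra.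
Local Ltac nra_goal := clear - d Phi rho cu uM T0 c0 eps0 M0 KM; intros; nra.

Lemma cut_radiusE : c * r0 = 1 / 2.
Proof. by rewrite /r0; field; rewrite gt_eqF. Qed.

Lemma cut_radius_gt0 : 0 < r0.
Proof. by rewrite invr_gt0 mulr_gt0. Qed.

Lemma slope_ge0 : 0 <= K.
Proof. by apply: le_trans KM; rewrite !mulr_ge0// ltW. Qed.

Lemma osc_le x y t : 0 <= t -> u x t - u y t <= 2 * M.
Proof.
move=> t0; have := uM x t0; have := uM y t0.
by rewrite !ler_norml => /andP[+ _] /andP[_ +]; lra_goal.
Qed.

Lemma profile_ge0 r : 0 <= r -> r <= r0 -> 0 <= profile c r.
Proof.
move=> rge0 rr0; rewrite /profile subr_ge0 expr2 mulrA ler_piMl//.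
by have := ler_wpM2l (ltW c0) rr0; rewrite cut_radiusE; lra_goal.
Qed.

Lemma time_penalty_ge0 t : t <= T -> 0 <= 2 * M * (1 - t / T).
Proof. by move=> tT; rewrite !mulr_ge0// subr_ge0 ler_pdivrMr// mul1r. Qed.

Lemma le_profile_max : 2 * M <= K * profile c r0.
Proof.
have -> : profile c r0 = r0 / 2 by rewrite /profile expr2 mulrA cut_radiusE; field.
have -> : 2 * M = 8 * c * M * (r0 / 2).
  rewrite (_ : 8 * c * M * (r0 / 2) = 4 * M * (c * r0)); last by field.
  by rewrite cut_radiusE; field.
by apply: ler_wpM2r => //; rewrite divr_ge0// ltW// cut_radius_gt0.
Qed.

Lemma penalty_in_box (v : 'cV[R]_d) : eps * dot v v <= 2 * M -> box rho v.
Proof.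
move=> ev i; apply: (le_trans (coord_le_enorm _ _)).
have : enorm v ^+ 2 <= 2 * M / eps by rewrite enorm_sqr ler_pdivlMr// mulrC.
have : 0 <= 2 * M / eps by rewrite divr_ge0 ?mulr_ge0// ltW.
by rewrite /rho; have := enorm_ge0 v; nra_goal.
Qed.

Lemma penalties_ge0 x y t : t <= T -> enorm (x - y) <= r0 ->
  [/\ 0 <= K * profile c (enorm (x - y)), 0 <= 2 * M * (1 - t / T) &
      0 <= eps * (dot x x + dot y y)].
Proof.
move=> tT xyr; split; last by rewrite mulr_ge0 ?addr_ge0 ?dot_ge0// ltW.
  apply: mulr_ge0; first exact: slope_ge0.
  by apply: profile_ge0 => //; exact: enorm_ge0.
exact: time_penalty_ge0.
Qed.

Lemma doubled_gt0_bounded x y t : 0 <= t <= T -> enorm (x - y) <= r0 ->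
  0 < Phi x y t -> eps * (dot x x + dot y y) <= 2 * M.
Proof.
move=> /andP[t0 tT] xyr P0; have [h1 h2 h3] := penalties_ge0 tT xyr.
by have := osc_le x y t0; move: P0 h1 h2; rewrite /Phi /doubled; lra_goal.
Qed.

Lemma penalty_in_boxes x y : eps * (dot x x + dot y y) <= 2 * M -> box rho x /\ box rho y.
Proof.
rewrite mulrDr => xy; have := mulr_ge0 (ltW eps0) (dot_ge0 x).
have := mulr_ge0 (ltW eps0) (dot_ge0 y) => y0 x0.
by split; apply: penalty_in_box; move: xy y0 x0; lra_goal.
Qed.

(** The domain is cut off at |x - y| = 1/(2c), where the profile is maximal; by
    the choice of K the doubled function is nonpositive there, as it is on the
    diagonal and at time 0. *)
Lemma exists_doubled_max x0 y0 : enorm (x0 - y0) <= r0 -> 0 < Phi x0 y0 T ->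
  exists x y t, [/\ 0 < t <= T, 0 < enorm (x - y) < r0,
    eps * (dot x x + dot y y) <= 2 * M &
    forall x' y' s, 0 <= s <= T -> enorm (x' - y') <= r0 ->
      Phi x' y' s <= Phi x y t].
Proof.
move=> xyr0 Phi0.
pose U := (('cV[R]_d * 'cV[R]_d) * R)%type.
pose F (w : U) := u w.1.1 (Num.max 0 w.2) - u w.1.2 (Num.max 0 w.2) -
  K * profile c (enorm (w.1.1 - w.1.2)) - 2 * M * (1 - w.2 / T) -
  eps * (dot w.1.1 w.1.1 + dot w.1.2 w.1.2).
have FPhi x y t : 0 <= t -> F ((x, y), t) = Phi x y t.
  by move=> t0; rewrite /F /Phi/= max_r.
have c11 : continuous (fun w : U => w.1.1).
  move=> w; apply: (@continuous_comp _ _ _ fst fst); exact: cvg_fst.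
have c12 : continuous (fun w : U => w.1.2).
  move=> w; apply: (@continuous_comp _ _ _ fst snd); first exact: cvg_fst.
  exact: cvg_snd.
have cz : continuous (fun w : U => w.1.1 - w.1.2).
  by move=> w; apply: cvgB; [exact: c11|exact: c12].
have cut (g : U -> 'cV[R]_d) : continuous g ->
    continuous (fun w : U => u (g w) (Num.max 0 w.2)).
  move=> cg w; apply: (@continuous_comp _ _ _ (fun w : U => (g w, w.2))
    (fun z : 'cV[R]_d * R => u z.1 (Num.max 0 z.2))).
    apply: (@cvg_pair _ _ _ (nbhs w) (nbhs (g w)) (nbhs w.2)); first exact: cg.
    exact: cvg_snd.
  exact: continuous_clamp_time cu _.
have cF : continuous F.
  move=> w; apply: cvgB; [apply: cvgB; [apply: cvgB; [apply: cvgB|]|]|].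
  - exact: cut c11 w.
  - exact: cut c12 w.
  - apply: cvgM; first exact: cvg_cst.
    apply: (@continuous_comp _ _ _ (fun w : U => enorm (w.1.1 - w.1.2))).
      exact: continuous_enorm.
    exact: continuous_profile.
  - apply: cvgM; first exact: cvg_cst.
    apply: cvgB; first exact: cvg_cst.
    by apply: cvgM; [exact: cvg_snd|exact: cvg_cst].
  - apply: cvgM; first exact: cvg_cst.
    by apply: cvgD; [exact: (continuous_dot c11 c11)|exact: (continuous_dot c12 c12)].
pose Kset : set U := ((box rho `*` box rho) `*` `[0, T]%classic) `&`
  [set w | enorm (w.1.1 - w.1.2) <= r0].
have T01 : (0 <= T <= T) by rewrite lexx ltW.
have in_Kset x y t : 0 <= t <= T -> enorm (x - y) <= r0 -> 0 < Phi x y t ->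
    ((x, y), t) \in Kset.
  move=> tT xyr P0; rewrite inE; split => //; split => /=; last by rewrite in_itv.
  by apply: penalty_in_boxes; exact: doubled_gt0_bounded P0.
have [[[x y] t] + w0F] : exists2 w, w \in Kset &
    forall w', w' \in Kset -> F w' <= F w.
  apply: compact_EVT_max; last exact: continuous_subspaceT.
    by exists ((x0, y0), T); exact/set_mem/in_Kset.
  apply: compact_closedI.
    apply: compact_setX; last exact: segment_compact.
    by apply: compact_setX; exact: compact_box.
  apply: (@preimage_closed _ _ (fun w : U => enorm (w.1.1 - w.1.2)) [set r | r <= r0]).
    by move=> w _; exact: continuous_enorm.
  exact: closed_le.
rewrite inE => -[[/= _]]; rewrite in_itv/= => /andP[t_ge0 tT] xyr.
have max0 : Phi x0 y0 T <= Phi x y t.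
  by rewrite -!FPhi ?(ltW T0)//; apply: w0F; exact: in_Kset.
have Pxyt := lt_le_trans Phi0 max0.
have [h1 h2 h3] := penalties_ge0 tT xyr.
have osc := osc_le x y t_ge0.
exists x, y, t; split.
- rewrite tT andbT lt_def t_ge0 andbT; apply/eqP => t00; move: Pxyt h1 h3 osc.
  by rewrite t00 /Phi /doubled mul0r subr0 mulr1; lra_goal.
- rewrite enorm_gt0 subr_eq0; apply/andP; split.
    apply/eqP => xy; move: Pxyt h2 h3.
    rewrite /Phi /doubled xy !subrr enorm0 /profile expr0n/= mulr0 subrr mulr0 sub0r.
    by lra_goal.
  rewrite lt_def xyr andbT eq_sym; apply/eqP => rr0; move: Pxyt h2 h3 osc.
  by rewrite /Phi /doubled rr0; have := le_profile_max; lra_goal.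
- by apply: doubled_gt0_bounded Pxyt => //; rewrite t_ge0.
- move=> x' y' s s0T xy'; have [P|P] := leP (Phi x' y' s) 0.
    by apply: (le_trans P); exact: ltW.
  rewrite -!FPhi//; last by case/andP: s0T.
  by apply: w0F; exact: in_Kset.
Qed.

End positive_maximum.

Section contact_at_maximum.
Variables (u : 'cV[R]_d -> R -> R) (K c M T eps r0 : R) (x y : 'cV[R]_d) (t : R).
Let z := x - y.
Let r := enorm z.
Let kap := (2 * r)^-1 - c.
Let e := r^-1 *: z.
Hypotheses (K0 : 0 <= K) (r_gt0 : 0 < r) (r_lt : r < r0).
Hypothesis C : C2 (u ^~ t).
Hypothesis max : forall x' y', enorm (x' - y') <= r0 ->
  doubled u K c M T eps x' y' t <= doubled u K c M T eps x y t.

Local Ltac lra_goal := clear - d kap e K0 r_gt0 r_lt C max; intros; lra.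

Lemma increment_le xi eta s : enorm (z + s *: (xi - eta)) <= r0 ->
  u (x + s *: xi) t - u (y + s *: eta) t <= u x t - u y t +
  K * (profile c (enorm (z + s *: (xi - eta))) - profile c r) +
  eps * (2 * (dot x xi + dot y eta) * s +
         (dot xi xi + dot eta eta) * s ^+ 2).
Proof.
move=> zs; have zE : x + s *: xi - (y + s *: eta) = z + s *: (xi - eta).
  by rewrite opprD addrACA -scalerBr.
have := @max (x + s *: xi) (y + s *: eta); rewrite zE => /(_ zs).
rewrite /doubled zE -/z -/r !(dotDl, dotDr, dotZl, dotZr) (dotC xi x) (dotC eta y).
by lra_goal.
Qed.

Lemma near_cut_radius zeta : \forall s \near (0 : R), enorm (z + s *: zeta) <= r0.
Proof.
have cg : continuous (fun s : R => enorm (z + s *: zeta)).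
  apply: continuous_enorm => s; apply: cvgD; first exact: cvg_cst.
  exact: scalel_continuous.
have := cg 0; rewrite /continuous_at scale0r addr0 => /cvgr_le; exact.
Qed.

Lemma contact_at_doubled_max xi eta :
  dot xi (gradient (u ^~ t) x) - dot eta (gradient (u ^~ t) y) =
    2 * K * kap * dot z (xi - eta) + 2 * eps * (dot x xi + dot y eta) /\
  bform (hessian (u ^~ t) x) xi xi - bform (hessian (u ^~ t) y) eta eta <=
    2 * (K * kap * dot (xi - eta) (xi - eta) + eps * (dot xi xi + dot eta eta)).
Proof.
apply: contact_pair => //; near=> s.
have zs : enorm (z + s *: (xi - eta)) <= r0 by near: s; exact: near_cut_radius.
apply: le_trans (increment_le zs) _.
have := ler_wpM2l K0 (@profile_le_tangent c r (enorm (z + s *: (xi - eta))) r_gt0).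
rewrite enormD_sqr -/r -/kap.
move: (profile _ _) (profile _ _) (dot _ _) (dot _ _) (dot _ _) (dot _ _).
by lra_goal.
Unshelve. all: by end_near. Qed.

(** In the direction of z the profile itself, and not its tangent majorant, is
    compared with: this is where its concavity is gained. *)
Lemma radial_contact_at_doubled_max :
  bform (hessian (u ^~ t) x) e e - bform (hessian (u ^~ t) y) e e <=
    - (8 * c * K - 4 * eps).
Proof.
have ee1 : dot e e = 1.
  by rewrite /e dotZl dotZr -enorm_sqr -/r expr2 mulKf ?mulVf// gt_eqF.
rewrite -[X in _ - X](bformNN _ e).
have -> : - (8 * c * K - 4 * eps) = 2 * (- (4 * c * K) + 2 * eps) by ring.
have [|_] := @contact_pair _ _ (u ^~ t) (u ^~ t) x y e (- e)
  (K * (2 - 4 * c * r) + 2 * eps * (dot x e - dot y e))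
  (- (4 * c * K) + 2 * eps) C C; last by [].
near=> s.
have zs : enorm (z + s *: (e - - e)) <= r0 by near: s; exact: near_cut_radius.
have s1 : 0 <= r + 2 * s.
  have : `|s| <= r / 2.
    near: s; apply/nbhs_ballP; exists (r / 2); first by rewrite /= divr_gt0.
    by move=> v; rewrite /ball/= sub0r normrN => /ltW.
  by rewrite ler_norml => /andP[+ _]; lra_goal.
apply: le_trans (increment_le zs) _.
have -> : enorm (z + s *: (e - - e)) = r + 2 * s.
  have -> : s *: (e - - e) = (2 * s) *: e.
    by rewrite opprK -mulr2n -scaler_nat scalerA mulrC.
  by rewrite /e enorm_radial.
rewrite !dotNr dotNl ee1 /profile.
move: (dot _ _) (dot _ _) => p1 p2.
by rewrite le_eqVlt; apply/orP; left; apply/eqP; ring.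
Unshelve. all: by end_near. Qed.

End contact_at_maximum.

(** The doubling-of-variables bound of Ishii and Lions: at a positive maximum of
      u(x,t) - u(y,t) - K profile(|x-y|) - 2M (1 - t/T) - eps (|x|^2 + |y|^2)
    with 0 < |x-y| < 1/(2c), the equation and trace_coupling_le bound
    d/dt (u(x,t) - u(y,t)) >= - 2M/T from above by - 2 lam c K plus lower order
    terms and terms vanishing with eps.  The term 2M (1 - t/T) absorbs the
    initial data, of which only the supremum enters. *)
Lemma gradient_estimate A b lam Lam lip bd f u (M c K T : R) : (0 < d)%N ->
  parabolic_bounds A b lam Lam lip bd -> cauchy_solution A b f u ->
  (forall x t, 0 <= t -> `|u x t| <= M) -> 0 < T -> 0 < c -> 0 <= M ->
  lip / (2 * c) <= lam / 2 -> 8 * c * M <= K ->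
  K * lip * (3 / 2 * d%:R + (2 * c)^-1) + 2 * M / T < 2 * lam * c * K ->
  forall x y, u x T - u y T <= K * enorm (x - y).
Proof.
move=> d0 H S uM T0 c0 M0 lip_c KM slack x0 y0.
have CS := cauchy_classical S; have Lam0 := pb_Lam_ge0 d0 H.
have lam0 := pb_lam H; have lip0 := pb_lip H; have bd0 := pb_bd H.
have K0 : 0 <= K by apply: le_trans KM; rewrite !mulr_ge0// ltW.
pose r0 := (2 * c)^-1.
have r0_gt0 : 0 < r0 by rewrite invr_gt0 mulr_gt0.
have cr0 : c * r0 = 1 / 2 by rewrite /r0; field; rewrite gt_eqF.
have prof_le r : profile c r <= r.
  by rewrite /profile gerBl mulr_ge0 ?sqr_ge0// ltW.
have [far|near] := leP r0 (enorm (x0 - y0)).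
  apply: (le_trans (osc_le uM _ _ (ltW T0))).
  apply: (le_trans (le_profile_max c0 KM)); apply: ler_wpM2l => //.
  exact: le_trans far.
rewrite leNgt; apply/negP => big.
pose de := u x0 T - u y0 T - K * enorm (x0 - y0).
have de0 : 0 < de by rewrite subr_gt0.
pose th := 2 * lam * c * K - (K * lip * (3 / 2 * d%:R + r0) + 2 * M / T).
have th0 : 0 < th by rewrite subr_gt0.
pose q := th / (8 * (bd + 1)).
have q0 : 0 < q by rewrite divr_gt0// mulr_gt0// ltr_wpDl.
have qbd : q * bd <= th / 8.
  have <- : q * (bd + 1) = th / 8.
    by rewrite /q invfM mulrA divfK// gt_eqF// ltr_wpDl.
  by apply: ler_wpM2l; rewrite ?lerDl// ltW.
(* the three conditions: a positive value at (x0, y0, T), smallness of the drift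
   terms at the maximum, smallness of all other terms containing eps *)
have [eps eps0 [ee1 ee2 ee3]] : exists2 eps : R, 0 < eps &
    [/\ eps * (dot x0 x0 + dot y0 y0) <= de / 2, eps * (2 * M) <= q ^+ 2 &
        eps * (lam + 2 * d%:R * Lam + 3 * d%:R * lip * r0) <= th / 4].
  apply: exists_small3; rewrite ?addr_ge0 ?dot_ge0 ?mulr_ge0 ?divr_gt0 ?exprn_gt0//.
  exact: ltW.
  exact: ltW.
have Phi0 : 0 < doubled u K c M T eps x0 y0 T.
  rewrite /doubled divff ?gt_eqF// subrr mulr0 subr0.
  have p := ler_wpM2l K0 (prof_le (enorm (x0 - y0))).
  by move: ee1 de0 p; rewrite /de; clear - d; lra.
have [x [y [t [/andP[t_gt0 tT] /andP[r_gt0 r_lt] epsN max]]]] :=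
  exists_doubled_max (cauchy_continuous S) uM T0 c0 eps0 M0 KM (ltW near) Phi0.
have C := classical_solution_C2 CS t_gt0.
have t0T : 0 <= t <= T by rewrite tT ltW.
have maxt x' y' : enorm (x' - y') <= r0 ->
  doubled u K c M T eps x' y' t <= doubled u K c M T eps x y t by exact: max.
pose z := x - y; pose r := enorm z; pose e := r^-1 *: z.
pose kap := (2 * r)^-1 - c.
have ctc := contact_at_doubled_max K0 r_gt0 r_lt C maxt.
have ctce := radial_contact_at_doubled_max r_gt0 r_lt C maxt.
have rkap : 2 * r * kap = 1 - 2 * (c * r).
  by rewrite /kap; field; rewrite gt_eqF.
have cr_ge0 : 0 <= c * r by rewrite mulr_ge0// ltW.
have crr : c * r <= 1 / 2 by rewrite -cr0; apply: ler_wpM2l; exact: ltW.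
have kap0 : 0 <= kap.
  have : 0 <= (2 * r) * kap by rewrite rkap; move: crr; clear - d; lra.
  by rewrite pmulr_rge0// mulr_gt0.
have ee : dot e e = 1.
  by rewrite /e dotZl dotZr -enorm_sqr -/r expr2 mulKf ?mulVf// gt_eqF.
have ut : - (2 * M / T) <= derive1 (u x) t - derive1 (u y) t.
  have du v : derivable (u v) t 1 by exact: (solution_derivable_time CS).
  have -> : derive1 (u x) t - derive1 (u y) t = derive1 (u x - u y) t.
    by rewrite !derive1E deriveB.
  apply: derive1_ge_left_max; first exact: derivableB.
  near=> s => st; have s0 : 0 < s by near: s; exact: lt_nbhsr.
  have s0T : 0 <= s <= T by rewrite (ltW s0) (le_trans st tT).
  have := max x y s s0T (ltW r_lt); rewrite /doubled !fctE/=.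
  move: (u x s) (u x t) (u y s) (u y t) (K * _) (eps * _).
  by clear - d; move=> *; lra.
move: ut; rewrite !(solution_equation CS)// !generatorE -/z.
move: (hessian (u ^~ t) x) (hessian (u ^~ t) y) (gradient (u ^~ t) x)
  (gradient (u ^~ t) y) ctc ctce => X Y gx gy ctc ctce.
move=> ut.
have [grad _] := ctc (b x) (b y).
have trc : \tr (A x *m X) - \tr (A y *m Y)
    <= - (lam / 2 * (8 * c * K - 4 * eps)) + d%:R * Lam * (4 * eps) +
       3 * d%:R * (lip * r) * (2 * (K * kap + eps)).
  apply: (@trace_coupling_le _ _ _ _ e) => //.
  - rewrite mulr_ge0 ?(ltW r_gt0)//=; apply: le_trans lip_c.
    by apply: ler_wpM2l => //; exact: ltW.
  - by rewrite mulr_ge0// ltW.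
  - by rewrite mulr_ge0// addr_ge0 ?mulr_ge0// ltW.
  - exact: (pb_sym H).
  - exact: (pb_sym H).
  - exact: (pb_ge H).
  - exact: (pb_le H).
  - exact: (pb_lipA H).
  - by move=> xi; rewrite /r /z enormBC; exact: (pb_lipA H).
  - move=> xi; have [_] := ctc xi xi; rewrite (subrr xi) dot0l.
    by move: (bform _ _ _) (bform _ _ _) => p1 p2; clear - d; lra.
  - move=> xi; have [_] := ctc xi 0.
    rewrite (subr0 xi) dot0l (_ : bform _ 0 0 = 0); last by rewrite bform_dot dot0l.
    by rewrite -/z -/r -/kap; move: (bform _ _ _) => p1; clear - d; lra.
  - move=> xi; have [_] := ctc 0 xi.
    rewrite (sub0r xi) dot0l (_ : bform _ 0 0 = 0); last by rewrite bform_dot dot0l.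
    rewrite dotNl dotNr -/z -/r -/kap; move: (bform _ _ _) => p1.
    by clear - d; lra.
have eps_norm (v : 'cV[R]_d) : eps * dot v v <= 2 * M -> eps * enorm v <= q.
  move=> ev; have h : 0 <= eps * enorm v by rewrite mulr_ge0 ?enorm_ge0// ltW.
  have : (eps * enorm v) ^+ 2 <= q ^+ 2.
    apply: le_trans ee2; rewrite exprMn enorm_sqr expr2 -mulrA.
    by apply: ler_wpM2l => //; exact: ltW.
  by rewrite ler_sqr// nnegrE ltW.
have edrift v w : eps * dot v v <= 2 * M -> - (eps * dot v (b w)) <= q * bd.
  move=> ev; rewrite -mulrN -dotNr.
  apply: (@le_trans _ _ (eps * (enorm v * bd))); last first.
    by rewrite mulrA; exact: (ler_wpM2r bd0 (eps_norm _ ev)).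
  apply: ler_wpM2l; first exact: ltW.
  apply: le_trans (dot_le _ _) _; apply: ler_wpM2l; first exact: enorm_ge0.
  by rewrite enormN (pb_drift H).
have edx := mulr_ge0 (ltW eps0) (dot_ge0 x).
have edy := mulr_ge0 (ltW eps0) (dot_ge0 y).
rewrite mulrDr in epsN.
have dx : - (eps * dot x (b x)) <= q * bd.
  by apply: edrift; move: epsN edy; clear - d; lra.
have dy : - (eps * dot y (b y)) <= q * bd.
  by apply: edrift; move: epsN edx; clear - d; lra.
have dz : - (2 * K * kap * dot z (b x - b y)) <= K * lip * r0.
  have h1 : - dot z (b x - b y) <= r * (lip * r).
    rewrite -dotNr; apply: le_trans (dot_le _ _) _; rewrite enormN.
    by apply: ler_wpM2l; [exact: enorm_ge0|exact: (pb_lipb H)].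
  have Kk : 0 <= 2 * K * kap by rewrite !mulr_ge0.
  rewrite -mulrN; apply: le_trans (ler_wpM2l Kk h1) _.
  have -> : 2 * K * kap * (r * (lip * r)) = K * lip * ((2 * r * kap) * r).
    by clear - d; ring.
  apply: ler_wpM2l; first exact: mulr_ge0.
  apply: le_trans (ltW r_lt); apply: ler_piMl; first exact: ltW.
  by rewrite rkap; move: cr_ge0; clear - d; lra.
have tr3 : 3 * d%:R * (lip * r) * (2 * (K * kap + eps)) <=
    3 * d%:R * lip * K + 2 * (3 * d%:R * lip * r0 * eps).
  have -> : 3 * d%:R * (lip * r) * (2 * (K * kap + eps)) =
      3 * d%:R * lip * (K * (2 * r * kap) + 2 * r * eps).
    by clear - d; ring.
  have -> : 3 * d%:R * lip * K + 2 * (3 * d%:R * lip * r0 * eps) =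
      3 * d%:R * lip * (K + 2 * r0 * eps) by clear - d; ring.
  apply: ler_wpM2l; first by rewrite !mulr_ge0.
  apply: lerD.
    by apply: ler_piMr => //; rewrite rkap; move: cr_ge0; clear - d; lra.
  apply: ler_wpM2r; [exact: ltW|apply: ler_wpM2l => //; exact: ltW].
move: ut grad trc tr3 dx dy dz ee3 qbd th0; rewrite /th -/z -/kap.
move: (dot x _) (dot y _) (dot z _) (dot (b x) _) (dot (b y) _) (\tr _) (\tr _).
move: (d%:R : R) (2 * M / T) (3 * _ * (lip * r) * _) => dR MT tr3'.
by clear - d; move=> *; lra.
Unshelve. all: by end_near. Qed.

End gradient_estimate.

(** * From continuous to Borel initial data *)

Section continuous_operations.
Context {R : realType} {T : topologicalType}.
Implicit Types f g : T -> R.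

Lemma continuous_fun_sub {V : normedModType R} (f g : T -> V) :
  continuous f -> continuous g -> continuous (fun x => f x - g x).
Proof. by move=> cf cg x; apply: cvgB; [exact: cf|exact: cg]. Qed.

Lemma continuous_fun_norm {V : normedModType R} (f : T -> V) :
  continuous f -> continuous (fun x => `|f x|).
Proof. by move=> cf x; apply: cvg_norm; exact: cf. Qed.

Lemma continuous_fun_mul f g : continuous f -> continuous g ->
  continuous (fun x => f x * g x).
Proof. by move=> cf cg x; apply: cvgM; [exact: cf|exact: cg]. Qed.

Lemma continuous_fun_max f g : continuous f -> continuous g ->
  continuous (fun x => Num.max (f x) (g x)).
Proof. by move=> cf cg x; apply: continuous_max; [exact: cf|exact: cg]. Qed.

Lemma continuous_fun_min f g : continuous f -> continuous g ->
  continuous (fun x => Num.min (f x) (g x)).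
Proof. by move=> cf cg x; apply: continuous_min; [exact: cf|exact: cg]. Qed.

Lemma continuous_fun_cst {V : normedModType R} (a : V) :
  continuous (fun _ : T => a).
Proof. by move=> x; exact: cvg_cst. Qed.

End continuous_operations.

Lemma dist_maxr_le {R : realDomainType} (a b c d : R) :
  `|Num.max a b - Num.max c d| <= `|a - c| + `|b - d|.
Proof.
have H (a' b' c' d' : R) : Num.max a' b' <= Num.max c' d' + (`|a' - c'| + `|b' - d'|).
  rewrite ge_max; apply/andP; split.
    rewrite -lerBlDl; apply: (@le_trans _ _ (a' - c')).
      by rewrite lerB// le_max lexx.
    by apply: (le_trans (ler_norm _)); rewrite lerDl.
  rewrite -lerBlDl; apply: (@le_trans _ _ (b' - d')).
    by rewrite lerB// le_max lexx orbT.
  by apply: (le_trans (ler_norm _)); rewrite lerDr.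
rewrite ler_distl H andbT lerBlDr.
by have := H c d a b; rewrite !(distrC c) !(distrC d).
Qed.

Section bounded_multiples.
Context {R : realType} {disp : measure_display} {T : measurableType disp}.
Variable mu : {measure set T -> \bar R}.
Implicit Types (h g : T -> R).

Lemma bounded_funP g (M : R) : (forall x, `|g x| <= M) ->
  [bounded g x | x in [set: T]].
Proof.
move=> gM; exists M; split; first exact: num_real.
by move=> N MN x _; apply: le_trans (gM x) _; exact: ltW.
Qed.

Lemma integrable_mul_bounded h g (M : R) :
  mu.-integrable setT (EFin \o h) -> measurable_fun setT g ->
  (forall x, `|g x| <= M) ->
  mu.-integrable setT (EFin \o (fun x => h x * g x)).
Proof.
by move=> ih mg gM; exact: (integrableMl measurableT ih mg (bounded_funP gM)).
Qed.

Lemma Rintegral_dominated h (g_ : nat -> T -> R) g (M : R) :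
  mu.-integrable setT (EFin \o h) ->
  (forall n, measurable_fun setT (g_ n)) -> measurable_fun setT g ->
  (forall n x, `|g_ n x| <= M) -> (forall x, g_ ^~ x @ \oo --> g x) ->
  (fun n => \int[mu]_x (h x * g_ n x)) @ \oo --> \int[mu]_x (h x * g x).
Proof.
move=> ih mg_ mg gM gcvg.
have gM' x : `|g x| <= M.
  have c : `|g_ n x| @[n --> \oo] --> `|g x| by apply: cvg_norm; exact: gcvg.
  rewrite -(cvg_lim _ c)//; apply: limr_le; first by apply/cvg_ex; eexists; exact: c.
  by apply: nearW => n.
have mh : measurable_fun setT h by exact/measurable_EFinP/(measurable_int mu).
have [|||||_ _ H] := @dominated_convergence _ _ _ mu setT measurableT
  (fun n x => (h x * g_ n x)%:E) (fun x => (h x * g x)%:E)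
  (fun x => (`|h x| * M)%:E).
- by move=> n; apply/measurable_EFinP; exact: measurable_funM.
- by apply/measurable_EFinP; exact: measurable_funM.
- apply: aeW => x _; apply: cvg_EFin; first by apply: nearW.
  by apply: cvgM; [exact: cvg_cst|exact: gcvg].
- apply: (@integrable_mul_bounded (fun x => `|h x|) (cst M) `|M|).
  + exact: integrable_norm.
  + exact: measurable_cst.
  + by [].
- apply: aeW => x n _; rewrite lee_fin normrM; exact: ler_wpM2l.
- rewrite /Rintegral; apply: fine_cvg; rewrite fineK; first exact: H.
  by apply: integrable_fin_num => //; exact: integrable_mul_bounded gM'.
Qed.

End bounded_multiples.

Section continuous_approximation.
Context {R : realType} {d : nat}.
Notation T := (Borel 'cV[R]_d).
Variable mu : {measure set T -> \bar R}.
Variable h : T -> R.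
Hypothesis ih : mu.-integrable setT (EFin \o h).
Hypothesis h0 : forall x, 0 <= h x.
Implicit Types (g c : 'cV[R]_d -> R).

Lemma continuous_Borel_measurable c : continuous c ->
  measurable_fun (setT : set T) (c : T -> R).
Proof.
move=> cc; apply: (measurability _ (RGenOpens.measurableE R)).
move=> _ [_ [a [b ->]] <-]; rewrite setTI; apply: sub_sigma_algebra.
by apply: open_comp; [move=> M _; exact: cc|exact: interval_open].
Qed.

Definition unit_valued g := forall x, 0 <= g x <= 1.

(** Density in L^1 of the finite measure h dmu, which enters through its density
    only. *)
Definition approximable g := forall e : R, 0 < e -> exists c,
  [/\ continuous c, unit_valued c & \int[mu]_x (h x * `|g x - c x|) < e].

Lemma unit_dist_le1 g c : unit_valued g -> unit_valued c ->
  forall x, `|(`|g x - c x| : R)| <= 1.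
Proof.
move=> gu cu x; have /andP[? ?] := gu x; have /andP[? ?] := cu x.
by rewrite normr_id ler_norml; lra.
Qed.

Lemma measurable_dist g c : measurable_fun (setT : set T) (g : T -> R) ->
  measurable_fun (setT : set T) (c : T -> R) ->
  measurable_fun (setT : set T) (fun x : T => `|g x - c x|).
Proof.
move=> mg mc; apply: measurableT_comp => //; exact: measurable_funB.
Qed.

Lemma integrable_dist g c : measurable_fun (setT : set T) (g : T -> R) ->
  measurable_fun (setT : set T) (c : T -> R) -> unit_valued g ->
  unit_valued c ->
  mu.-integrable setT (EFin \o (fun x : T => h x * `|g x - c x|)).
Proof.
move=> mg mc ug uc; apply: (integrable_mul_bounded ih).
  exact: measurable_dist.
exact: unit_dist_le1.
Qed.

Lemma unit_valued_max g c : unit_valued g -> unit_valued c ->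
  unit_valued (fun x => Num.max (g x) (c x)).
Proof.
move=> ug uc x; have /andP[g0 g1] := ug x; have /andP[c0 c1] := uc x.
by rewrite le_max ge_max g0 g1 c1.
Qed.

Lemma le_integral_dist3 g1 g2 g3 :
  measurable_fun (setT : set T) (g1 : T -> R) ->
  measurable_fun (setT : set T) (g2 : T -> R) ->
  measurable_fun (setT : set T) (g3 : T -> R) ->
  unit_valued g1 -> unit_valued g2 -> unit_valued g3 ->
  \int[mu]_x (h x * `|g1 x - g3 x|) <=
  \int[mu]_x (h x * `|g1 x - g2 x|) + \int[mu]_x (h x * `|g2 x - g3 x|).
Proof.
move=> m1 m2 m3 u1 u2 u3.
have I := integrable_dist.
rewrite -RintegralD//; [|exact: I|exact: I].
apply: le_Rintegral => //; [exact: I| |].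
  exact: (integrableD measurableT (I _ _ m1 m2 u1 u2) (I _ _ m2 m3 u2 u3)).
move=> x _; rewrite -mulrDr; apply: ler_wpM2l => //; exact: ler_distD.
Qed.

Lemma approximable_continuous c : continuous c -> unit_valued c -> approximable c.
Proof.
move=> cc cu e e0; exists c; split => //.
under eq_Rintegral do rewrite subrr normr0 mulr0.
by rewrite Rintegral_cst// mul0r.
Qed.

Lemma approximable_cvg (g_ : nat -> 'cV[R]_d -> R) g :
  (forall n, measurable_fun (setT : set T) (g_ n : T -> R)) ->
  measurable_fun (setT : set T) (g : T -> R) ->
  (forall n, unit_valued (g_ n)) -> unit_valued g ->
  (forall x, g_ ^~ x @ \oo --> g x) ->
  (forall n, approximable (g_ n)) -> approximable g.
Proof.
move=> mg_ mg ug_ ug gcvg ag e e0; have e20 : 0 < e / 2 by rewrite divr_gt0.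
have : (fun n => \int[mu]_x (h x * `|g x - g_ n x|)) @ \oo --> (0 : R).
  rewrite [X in _ --> X](_ : _ = \int[mu]_x (h x * (cst 0 : T -> R) x)).
    apply: (Rintegral_dominated ih _ _ (fun n => unit_dist_le1 ug (ug_ n))) => //.
      by move=> n; exact: measurable_dist.
    move=> x; rewrite [X in _ --> X](_ : _ = `|g x - g x|); last by rewrite subrr normr0.
    by apply: cvg_norm; apply: cvgB; [exact: cvg_cst|exact: gcvg].
  under eq_Rintegral do rewrite mulr0.
  by rewrite Rintegral_cst// mul0r.
move=> /cvgr_lt/(_ _ e20)[n _ /(_ n (leqnn n)) Hn].
have [c [cc cu ce]] := ag n _ e20; exists c; split => //.
have := le_integral_dist3 mg (mg_ n) (continuous_Borel_measurable cc) ug (ug_ n) cu.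
by move: Hn ce => /=; lra.
Qed.

Lemma indic_unit_valued (E : set 'cV[R]_d) : unit_valued \1_E.
Proof. by move=> x; rewrite indicE; case: (_ \in _); rewrite ?lexx ?ler01. Qed.

Let approx_set : set (set T) :=
  [set E : set T | measurable E /\ approximable \1_(E : set 'cV[R]_d)].

Lemma approximable_set0 : approx_set set0.
Proof.
split=> // e e0; exists (cst 0); split.
- exact: cst_continuous.
- by move=> x; rewrite /= lexx ler01.
- under eq_Rintegral do rewrite indic0 subrr normr0 mulr0.
  by rewrite Rintegral_cst// mul0r.
Qed.

Lemma approximable_setC (E : set T) : approx_set E -> approx_set (~` E).
Proof.
move=> [mE aE]; split=> [|e e0]; first exact: measurableC.
have [c [cc cu ce]] := aE _ e0; exists (fun x => 1 - c x); split.
- by apply: continuous_fun_sub => //; exact: continuous_fun_cst.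
- by move=> x; have /andP[? ?] := cu x; apply/andP; split; lra.
- under eq_Rintegral => x _.
    rewrite (_ : \1_(~` E) x - (1 - c x) = - (\1_E x - c x)) ?normrN; first over.
    by rewrite !indicE in_setC; case: (_ \in _) => /=; ring.
  exact: ce.
Qed.

Lemma approximable_setU (E F : set T) :
  approx_set E -> approx_set F -> approx_set (E `|` F).
Proof.
move=> [mE aE] [mF aF]; split=> [|e e0]; first exact: measurableU.
have e20 : 0 < e / 2 by rewrite divr_gt0.
have [c [cc cu ce]] := aE _ e20; have [k [kc ku ke]] := aF _ e20.
exists (fun x => Num.max (c x) (k x)); split.
- exact: continuous_fun_max.
- exact: unit_valued_max.
- have mc := continuous_Borel_measurable cc.
  have mk := continuous_Borel_measurable kc.
  have mck : measurable_fun (setT : set T) (fun x : T => Num.max (c x) (k x)).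
    exact: measurable_maxr.
  have I := integrable_dist.
  have IE := I _ _ (measurable_indic mE) mc (indic_unit_valued E) cu.
  have IF := I _ _ (measurable_indic mF) mk (indic_unit_valued F) ku.
  apply: (@le_lt_trans _ _ (\int[mu]_x (h x * `|\1_E x - c x|) +
                            \int[mu]_x (h x * `|\1_F x - k x|))); last first.
    by move: ce ke; lra.
  rewrite -RintegralD//; apply: le_Rintegral => //.
  + apply: I => //; first exact: measurable_indic (measurableU _ _ mE mF).
      exact: indic_unit_valued.
    exact: unit_valued_max.
  + exact: (integrableD measurableT IE IF).
  + move=> x _; rewrite -mulrDr; apply: ler_wpM2l => //.
    have -> : \1_(E `|` F) x = Num.max (\1_E x) (\1_F x) :> R.
      rewrite !indicE in_setU.
      by do 2 (case: (_ \in _)) => /=; rewrite ?maxxx ?(max_l ler01) ?(max_r ler01).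
    exact: dist_maxr_le.
Qed.

Lemma approximable_bigcup (E : (set T)^nat) : (forall n, approx_set (E n)) ->
  approx_set (\bigcup_n E n).
Proof.
move=> aE; split; first by apply: bigcup_measurable => n _; have [] := aE n.
pose F n := \big[setU/set0]_(i < n) E i.
have aF n : approx_set (F n).
  elim: n => [|n IH]; rewrite /F; last by rewrite big_ord_recr; exact: approximable_setU.
  by rewrite big_ord0; exact: approximable_set0.
apply: (@approximable_cvg (fun n => \1_(F n))).
- by move=> n; apply: measurable_indic; have [] := aF n.
- by apply: measurable_indic; apply: bigcup_measurable => n _; have [] := aE n.
- by move=> n; exact: indic_unit_valued.
- exact: indic_unit_valued.
- move=> x; apply: cvg_near_cst.
  have [[k _ Ekx]|nE] := pselect ((\bigcup_n E n) x).
    exists k.+1 => // n /= kn; rewrite !indicE !mem_set//; first by exists k.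
    rewrite /F -bigcup_mkord; exists k => //=; exact: kn.
  near=> n; rewrite !indicE !memNset//.
  by rewrite /F -bigcup_mkord => -[k _ Ekx]; apply: nE; exists k.
- by move=> n; have [] := aF n.
Unshelve. all: by end_near. Qed.

Lemma approximable_ball (x0 : 'cV[R]_d) (r : R) : 0 < r ->
  approx_set (ball x0 r).
Proof.
move=> r0.
have mB : measurable (ball x0 r : set T).
  by apply: sub_sigma_algebra; exact: ball_open.
split=> //.
pose c_ (n : nat) (x : 'cV[R]_d) := Num.min 1 (Num.max 0 (n%:R * (r - `|x0 - x|))).
have cc n : continuous (c_ n).
  apply: continuous_fun_min; first exact: continuous_fun_cst.
  apply: continuous_fun_max; first exact: continuous_fun_cst.
  apply: continuous_fun_mul; first exact: continuous_fun_cst.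
  apply: continuous_fun_sub; first exact: continuous_fun_cst.
  apply: continuous_fun_norm; apply: continuous_fun_sub.
    exact: continuous_fun_cst.
  by move=> x; exact: cvg_id.
have cu n : unit_valued (c_ n).
  by move=> x; rewrite /c_ le_min ge_min ler01 le_max !lexx.
apply: (@approximable_cvg c_) => //.
- by move=> n; exact: continuous_Borel_measurable.
- exact: indic_unit_valued.
- move=> x; apply: cvg_near_cst; rewrite indicE.
  have [xB|xB] := ltP `|x0 - x| r.
    have [N HN] : exists N : nat, (r - `|x0 - x|)^-1 <= N%:R.
      by exists (Num.truncn (r - `|x0 - x|)^-1).+1; exact/ltW/truncnS_gt.
    exists N => // n /= Nn; rewrite mem_set; last by rewrite -ball_normE.
    have rx : 0 < r - `|x0 - x| by rewrite subr_gt0.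
    have n1 : 1 <= n%:R * (r - `|x0 - x|).
      by rewrite -ler_pdivrMr// div1r (le_trans HN)// ler_nat.
    by rewrite /c_ max_r ?(le_trans ler01 n1)// min_l.
  near=> n; rewrite memNset; last by rewrite -ball_normE/= ltNge xB.
  rewrite /c_ max_l ?min_r//.
  by rewrite mulr_ge0_le0// subr_le0.
- by move=> n; exact: approximable_continuous.
Unshelve. all: by end_near. Qed.

Lemma approximable_open (U : set 'cV[R]_d) : open U -> approx_set U.
Proof.
move=> oU.
pose B (q : 'M[rat]_(d, 1) * nat) : set 'cV[R]_d :=
  ball (map_mx ratr q.1 : 'cV[R]_d) (q.2.+1%:R^-1).
have -> : U = \bigcup_n (if unpickle n is Some q then
    if `[< B q `<=` U >] then B q else set0 else set0).
  rewrite [LHS](open_mx_bigcup oU); apply/seteqP; split=> [x [q Sq Bqx]|x [n _]].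
    by exists (pickle q) => //; rewrite pickleK (asboolT Sq).
  by case: unpickle => // q; case: asboolP => // Sq Bqx; exists q.
apply: approximable_bigcup => n; case: unpickle => [q|]; last exact: approximable_set0.
case: ifPn => _; last exact: approximable_set0.
by apply: approximable_ball; rewrite invr_gt0.
Qed.

(** The sets with approximable indicator form a sigma-algebra containing the
    open sets. *)
Lemma approximable_indic (E : set T) : measurable E ->
  approximable \1_(E : set 'cV[R]_d).
Proof.
move=> mE; suff [] : approx_set E by [].
apply: (smallest_sub _ _ mE); last exact: approximable_open.
split=> [|A aA|A aA].
- exact: approximable_set0.
- by rewrite setTD; exact: approximable_setC.
- exact: approximable_bigcup.
Qed.

End continuous_approximation.

Section continuous_test_functions.
Context {R : realType} {d : nat}.
Notation T := (Borel 'cV[R]_d).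
Variable mu : {measure set T -> \bar R}.

(** A signed kernel q that is small against continuous functions is small in
    L^1: the sign of q is an L^1(|q|)-limit of continuous functions. *)
Lemma L1_le_of_continuous (q : 'cV[R]_d -> R) (B : R) :
  mu.-integrable [set: T] (EFin \o q) ->
  (forall f, continuous f -> (forall x, `|f x| <= 1) ->
    \int[mu]_(y in [set: T]) (q y * f y) <= B) ->
  \int[mu]_(y in [set: T]) `|q y| <= B.
Proof.
move=> iq H.
have mq : measurable_fun [set: T] (q : T -> R).
  by apply/measurable_EFinP; case/integrableP : iq.
pose h (y : T) := `|q y|.
have ih : mu.-integrable [set: T] (EFin \o h) by exact: integrable_norm.
have h0 y : 0 <= h y by exact: normr_ge0.
pose E : set T := [set y | 0 <= q y].
have mE : measurable E.
  rewrite (_ : E = [set: T] `&` q @^-1` `[0, +oo[%classic).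
    exact: mq.
  by rewrite setTI; apply/seteqP; split=> y /=; rewrite in_itv/= andbT.
apply/ler_addgt0Pr => e e0; have e20 : 0 < e / 2 by rewrite divr_gt0.
have [c [cc cu ce]] := approximable_indic ih h0 mE e20.
pose f y := 2 * c y - 1.
have cf : continuous f.
  apply: continuous_fun_sub; last exact: continuous_fun_cst.
  by apply: continuous_fun_mul => //; exact: continuous_fun_cst.
have f1 y : `|f y| <= 1.
  by have /andP[? ?] := cu y; rewrite ler_norml /f; apply/andP; split; lra.
have mf := continuous_Borel_measurable cf.
have mc := continuous_Borel_measurable cc.
have i1 := integrable_mul_bounded iq mf f1.
have md : measurable_fun [set: T] (fun y : T => `|\1_E y - c y|).
  by apply: measurable_dist => //; exact: measurable_indic.
have i2 := integrable_mul_bounded ih md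
  (unit_dist_le1 (indic_unit_valued (E : set 'cV[R]_d)) cu).
have i3 := integrableZl measurableT 2 i2.
apply: (@le_trans _ _ (\int[mu]_(y in [set: T]) (q y * f y + 2 * (h y * `|\1_E y - c y|)))).
  apply: le_Rintegral => //; first exact: (integrableD measurableT i1 i3).
  move=> y _; rewrite /f /h indicE; have /andP[c0 c1] := cu y.
  have [qy|qy] := leP 0 (q y).
    by rewrite mem_set//= (ger0_norm qy) (@ger0_norm _ (1 - c y)) ?subr_ge0//; lra.
  rewrite memNset/=; last by apply/negP; rewrite -ltNge.
  by rewrite sub0r normrN (ger0_norm c0) (ltr0_norm qy); lra.
rewrite RintegralD// RintegralZl//; apply: lerD; first exact: H.
by move: ce; lra.
Qed.

Lemma Rintegral_le_of_continuous (q g : 'cV[R]_d -> R) (B M : R) : 0 <= M ->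
  mu.-integrable [set: T] (EFin \o q) ->
  measurable_fun [set: T] (g : T -> R) ->
  (forall x, `|g x| <= M) ->
  (forall f, continuous f -> (forall x, `|f x| <= 1) ->
    \int[mu]_(y in [set: T]) (q y * f y) <= B) ->
  \int[mu]_(y in [set: T]) (q y * g y) <= M * B.
Proof.
move=> M0 iq mg gM /(L1_le_of_continuous iq) qB.
have iqg := integrable_mul_bounded iq mg gM.
apply: (le_trans (ler_norm _)); apply: le_trans (le_normr_Rintegral _ iqg) _ => //.
apply: le_trans (ler_wpM2l M0 qB).
rewrite -RintegralZl//; last exact: integrable_norm.
apply: le_Rintegral => //; first exact: integrable_norm.
  exact: (integrableZl measurableT M (integrable_norm iq)).
by move=> y _; rewrite normrM mulrC; exact: ler_wpM2r.
Qed.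

End continuous_test_functions.

(** * Trigonometric polynomials and their heat flow *)

Section heat_flow.
Context {R : realType} {d : nat}.
Implicit Types (x h xi : 'cV[R]_d) (t : R).

(** (a, xi, theta) stands for the plane wave a cos (xi . x + theta); phases are
    used instead of sines, so that differentiation in a direction h maps a wave
    to a wave. *)
Definition wave : Type := (R * 'cV[R]_d * R)%type.
Implicit Types (w : wave) (l : seq wave).

Definition wave_eval w x : R := w.1.1 * cos (dot w.1.2 x + w.2).

Definition wave_derive h w : wave := (w.1.1 * dot w.1.2 h, w.1.2, w.2 + pi / 2).

Definition wave_decay al w : R := - (al / 2 * dot w.1.2 w.1.2).

Definition wave_time al w : wave := (wave_decay al w * w.1.1, w.1.2, w.2).

Definition heat_wave al w x t : R := expR (wave_decay al w * t) * wave_eval w x.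

Definition heat_sum al l x t : R := \sum_(w <- l) heat_wave al w x t.

Definition trig_poly (f : 'cV[R]_d -> R) : Prop :=
  exists l, forall x, f x = \sum_(w <- l) wave_eval w x.

Lemma cosDpihalf (y : R) : cos (y + pi / 2) = - sin y.
Proof. by rewrite cosD cos_pihalf sin_pihalf mulr0 mulr1 sub0r. Qed.

Lemma is_derive_affine_cos (p q : R) :
  is_derive (0 : R) 1 (fun s : R => cos (p + s * q)) (q * cos (p + pi / 2)).
Proof.
rewrite cosDpihalf.
have D : is_derive (0 : R) 1 (fun s : R => p + s * q) q.
  rewrite (_ : (fun s => _) = (fun s => p + q * s + 0 * s ^+ 2)).
    by apply: (is_derive_eq (is_derive_parabola p q 0 0)); rewrite !mulr0 addr0.
  by apply/funext => s; rewrite mul0r addr0 mulrC.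
have := @is_derive1_comp R (@cos R) (fun s : R => p + s * q) 0 (- sin (p + 0 * q)) q.
rewrite mul0r addr0 => H; apply: (is_derive_eq (H _ D)).
by rewrite mulrC.
Qed.

Lemma is_derive_wave_eval w x h :
  is_derive x h (wave_eval w) (wave_eval (wave_derive h w) x).
Proof.
have [D E] : is_derive (0 : R) 1 (fun s : R => wave_eval w (s *: h + x))
    (wave_eval (wave_derive h w) x).
  rewrite (_ : (fun s : R => _) =
    w.1.1 *: (fun s : R => cos (dot w.1.2 x + w.2 + s * dot w.1.2 h))).
    apply: (is_derive_eq (is_deriveZ w.1.1 (is_derive_affine_cos _ _))).
    by rewrite /wave_eval/= addrA [_ *: _]mulrA.
  apply/funext => s; rewrite /wave_eval /=; congr (_ * cos _).
  by rewrite dotDr dotZr; ring.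
apply: DeriveDef; first exact/derivable1P.
rewrite -E /derive; congr (lim (_ @ 0^')); apply/funext => s /=.
by rewrite addr0 scale0r add0r [s *: 1]mulr1.
Qed.

Lemma is_derive_heat_sum al l x h t :
  is_derive x h (heat_sum al l ^~ t) (heat_sum al (map (wave_derive h) l) x t).
Proof.
elim: l => [|w l IH].
  have -> : heat_sum al [::] ^~ t = cst 0.
    by apply/funext => y; rewrite /heat_sum big_nil.
  by rewrite /heat_sum/= big_nil; exact: is_derive_cst.
have -> : heat_sum al (w :: l) ^~ t =
    (expR (wave_decay al w * t) *: wave_eval w) + (heat_sum al l ^~ t).
  by apply/funext => y; rewrite /heat_sum big_cons.
rewrite /heat_sum/= big_cons.
apply: is_deriveD.
exact: (is_derive_eq (is_deriveZ _ (is_derive_wave_eval w x h))).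
Qed.

Lemma partial_heat_sum al l i t : partial i (heat_sum al l ^~ t) =
  (heat_sum al (map (wave_derive (delta_mx i ord0)) l) ^~ t).
Proof.
by apply/funext => x; rewrite /partial (@derive_val _ _ _ _ _ _ _
  (is_derive_heat_sum al l x (delta_mx i ord0) t)).
Qed.

Lemma is_derive_heat_sum_time al l x t :
  is_derive t 1 (heat_sum al l x) (heat_sum al (map (wave_time al) l) x t).
Proof.
elim: l => [|w l IH].
  have -> : heat_sum al [::] x = cst 0.
    by apply/funext => y; rewrite /heat_sum big_nil.
  by rewrite /heat_sum/= ?big_nil; exact: is_derive_cst.
have -> : heat_sum al (w :: l) x =
    (wave_eval w x *: (fun s => expR (wave_decay al w * s))) + (heat_sum al l x).
  by apply/funext => y; rewrite /heat_sum big_cons /heat_wave mulrC.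
rewrite /heat_sum/= big_cons.
apply: is_deriveD.
have D : is_derive t 1 (fun s : R => wave_decay al w * s) (wave_decay al w * 1).
  exact: (@is_deriveZ _ _ _ id (wave_decay al w) t 1 1).
apply: (is_derive_eq (is_deriveZ (wave_eval w x)
  (@is_derive1_comp _ expR (fun s => wave_decay al w * s) t _ _ _ D))).
by rewrite /heat_wave /wave_eval /GRing.scale/= /wave_decay/=; ring.
Qed.

Lemma derive1_heat_sum al l x :
  derive1 (heat_sum al l x) = heat_sum al (map (wave_time al) l) x.
Proof.
by apply/funext => t; rewrite derive1E (@derive_val _ _ _ _ _ _ _
  (is_derive_heat_sum_time al l x t)).
Qed.

Lemma continuous_wave_eval w : continuous (wave_eval w).
Proof.
apply: continuous_fun_mul; first exact: continuous_fun_cst.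
move=> x; apply: (@continuous_comp _ _ _ (fun x => dot w.1.2 x + w.2)).
  apply: (@continuous_comp _ _ _ (dot w.1.2) (fun s => s + w.2)).
    apply: (@continuous_dot _ _ _ (fun=> w.1.2) id); first exact: continuous_fun_cst.
    by move=> y; exact: cvg_id.
  by apply: cvgD; [exact: cvg_id|exact: cvg_cst].
exact: continuous_cos.
Qed.

Lemma continuous_heat_sum al l :
  continuous (fun z : 'cV[R]_d * R => heat_sum al l z.1 z.2).
Proof.
apply: (@continuous_sum _ _ _ l (fun w z => heat_wave al w z.1 z.2)) => w.
apply: continuous_fun_mul => z.
  apply: (@continuous_comp _ _ _ (fun z : 'cV[R]_d * R => wave_decay al w * z.2)).
    by apply: cvgM; [exact: cvg_cst|exact: cvg_snd].
  exact: continuous_expR.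
apply: (@continuous_comp _ _ _ fst (wave_eval w)); first exact: cvg_fst.
exact: continuous_wave_eval.
Qed.

Lemma wave_derive2 w x h : wave_eval (wave_derive h (wave_derive h w)) x =
  - (dot w.1.2 h ^+ 2 * wave_eval w x).
Proof.
rewrite /wave_eval/= 2!addrA cosDpihalf sinD cos_pihalf sin_pihalf; ring.
Qed.

Lemma heat_sum_equation al l x t : heat_sum al (map (wave_time al) l) x t =
  generator (fun=> al%:M) (fun=> 0) (heat_sum al l ^~ t) x.
Proof.
rewrite generatorE dot0l subr0 mul_scalar_mx mxtraceZ /mxtrace.
transitivity (2^-1 * (al * \sum_(i < d) \sum_(w <- l)
    expR (wave_decay al w * t) * - (w.1.2 i ord0 ^+ 2 * wave_eval w x))); last first.
  congr (_ * (_ * _)); apply: eq_bigr => i _.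
  rewrite mxE !partial_heat_sum -map_comp /heat_sum big_map; apply: eq_bigr => w _.
  rewrite /heat_wave [in RHS]/= wave_derive2.
  by rewrite /wave_decay/= (dotC _ (delta_mx i ord0)) dot_delta.
rewrite exchange_big/= /heat_sum big_map !mulr_sumr; apply: eq_bigr => w _.
rewrite -mulr_sumr sumrN -mulr_suml.
have -> : \sum_(i < d) w.1.2 i ord0 ^+ 2 = dot w.1.2 w.1.2.
  by rewrite dotE; apply: eq_bigr => i _; rewrite expr2.
by rewrite /heat_wave /wave_eval/= /wave_decay/=; field.
Qed.

Lemma heat_wave_le al w x t : 0 <= al -> 0 <= t ->
  `|heat_wave al w x t| <= `|w.1.1|.
Proof.
move=> al0 t0; rewrite normrM normrM (ger0_norm (expR_ge0 _)).
apply: (@le_trans _ _ (1 * (`|w.1.1| * 1))); last by rewrite mul1r mulr1.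
apply: ler_pM => //.
- by rewrite expR_le1 /wave_decay mulNr oppr_le0 !mulr_ge0// ?dot_ge0// invr_ge0.
- by apply: ler_wpM2l => //; exact: cos_max.
Qed.

(** A plane wave stays a multiple of itself under the heat flow, with the factor
    exp (- al |xi|^2 t / 2). *)
Lemma trig_poly_cauchy al f : 0 <= al -> trig_poly f ->
  exists u, cauchy_solution (fun=> al%:M) (fun=> 0) f u.
Proof.
move=> al0 [l fE]; exists (heat_sum al l); split.
- have dsp i x t l' : derivable (heat_sum al l' ^~ t) x (delta_mx i ord0).
    by have [] := is_derive_heat_sum al l' x (delta_mx i ord0) t.
  split=> [x t _|i x t _|i j x t _|x t _|x t _|i x t _|i j x t _|x t _].
  + by have [] := is_derive_heat_sum_time al l x t.
  + exact: dsp.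
  + by rewrite partial_heat_sum; exact: dsp.
  + exact: continuous_heat_sum.
  + rewrite (_ : (fun z => _) = (fun z => heat_sum al (map (wave_time al) l) z.1 z.2)).
      exact: continuous_heat_sum.
    by apply/funext => z; rewrite derive1_heat_sum.
  + rewrite (_ : (fun z => _) = (fun z => heat_sum al
        (map (wave_derive (delta_mx i ord0)) l) z.1 z.2)).
      exact: continuous_heat_sum.
    by apply/funext => z; rewrite partial_heat_sum.
  + rewrite (_ : (fun z => _) = (fun z => heat_sum al
      (map (wave_derive (delta_mx i ord0)) (map (wave_derive (delta_mx j ord0)) l))
      z.1 z.2)).
      exact: continuous_heat_sum.
    by apply/funext => z; rewrite !partial_heat_sum.
  + by rewrite derive1_heat_sum heat_sum_equation.
- move=> x; rewrite fE /heat_sum; apply: eq_bigr => w _.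
  by rewrite /heat_wave mulr0 expR0 mul1r.
- exact/continuous_subspaceT/continuous_heat_sum.
- exists (\sum_(w <- l) `|w.1.1|) => x t t0.
  apply: (le_trans (ler_norm_sum _ _ _)); apply: ler_sum => w _.
  exact: heat_wave_le.
Qed.

Lemma trig_poly_wave (a : R) xi th : trig_poly (fun x => a * cos (dot xi x + th)).
Proof. by exists [:: (a, xi, th)] => x; rewrite big_seq1. Qed.

Lemma trig_poly_cst (a : R) : trig_poly (fun=> a).
Proof.
exists [:: (a, 0, 0)] => x.
by rewrite big_seq1 /wave_eval/= dot0l addr0 cos0 mulr1.
Qed.

Lemma trig_poly_add f g : trig_poly f -> trig_poly g ->
  trig_poly (fun x => f x + g x).
Proof.
by move=> [l fE] [k gE]; exists (l ++ k) => x; rewrite big_cat fE gE.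
Qed.

(** The product-to-sum formula for cosines. *)
Definition wave_mul w v : seq wave :=
  [:: (w.1.1 * v.1.1 / 2, w.1.2 + v.1.2, w.2 + v.2);
      (w.1.1 * v.1.1 / 2, w.1.2 - v.1.2, w.2 - v.2)].

Lemma wave_mulE w v x :
  \sum_(u <- wave_mul w v) wave_eval u x = wave_eval w x * wave_eval v x.
Proof.
rewrite big_cons big_seq1 /wave_eval/= dotDl dotBl.
have -> : dot w.1.2 x + dot v.1.2 x + (w.2 + v.2) =
  (dot w.1.2 x + w.2) + (dot v.1.2 x + v.2) by ring.
have -> : dot w.1.2 x - dot v.1.2 x + (w.2 - v.2) =
  (dot w.1.2 x + w.2) - (dot v.1.2 x + v.2) by ring.
by rewrite cosD cosB; field.
Qed.

Lemma trig_poly_mul f g : trig_poly f -> trig_poly g ->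
  trig_poly (fun x => f x * g x).
Proof.
move=> [l fE] [k gE].
exists (flatten [seq wave_mul w v | w <- l, v <- k]) => x.
rewrite big_flatten/= big_allpairs_dep/= fE gE mulr_suml; apply: eq_bigr => w _.
by rewrite mulr_sumr; apply: eq_bigr => v _; rewrite wave_mulE.
Qed.

End heat_flow.

(** * Approximation by trigonometric polynomials *)

Section bernstein.
Context {R : realType}.
Implicit Types (g : nat -> R) (y : R) (N : nat).

(** The Bernstein polynomial sum_k C(N,k) y^k (1-y)^(N-k) g(k), in the form of
    the de Casteljau recursion, which makes all its properties inductions. *)
Fixpoint bernstein N g y : R :=
  if N is N'.+1 then
    (1 - y) * bernstein N' g y + y * bernstein N' (fun k => g k.+1) y
  else g 0%N.

Lemma bernstein_cst N (a : R) y : bernstein N (fun=> a) y = a.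
Proof. by elim: N => //= N ->; ring. Qed.

Lemma bernstein_sub N g g' y :
  bernstein N g y - bernstein N g' y = bernstein N (fun k => g k - g' k) y.
Proof.
elim: N g g' => //= N IH g g'.
by rewrite -(IH g g') -(IH (fun k => g k.+1) (fun k => g' k.+1)); ring.
Qed.

Lemma bernstein_affine N (a c : R) g y :
  bernstein N (fun k => a + c * g k) y = a + c * bernstein N g y.
Proof. by elim: N g => //= N IH g; rewrite !IH; ring. Qed.

Lemma bernstein_norm_le N g g' y : 0 <= y <= 1 ->
  (forall k, `|g k| <= g' k) -> `|bernstein N g y| <= bernstein N g' y.
Proof.
move=> /andP[y0 y1]; elim: N g g' => //= N IH g g' gg'.
apply: (le_trans (ler_normD _ _)); rewrite !normrM.
rewrite (ger0_norm y0) (@ger0_norm _ (1 - y)) ?subr_ge0//.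
by apply: lerD; apply: ler_wpM2l; rewrite ?subr_ge0//; apply: IH.
Qed.

Lemma bernstein_bounded N g (M : R) y : 0 <= y <= 1 ->
  (forall k, `|g k| <= M) -> `|bernstein N g y| <= M.
Proof.
by move=> y01 gM; rewrite -[leRHS](bernstein_cst N _ y); exact: bernstein_norm_le.
Qed.

Lemma bernstein_dist_le N g g' (M : R) y : 0 <= y <= 1 ->
  (forall k, `|g k - g' k| <= M) ->
  `|bernstein N g y - bernstein N g' y| <= M.
Proof. by move=> y01 H; rewrite bernstein_sub; exact: bernstein_bounded. Qed.

Lemma bernstein_lipschitz N g (kap : R) y y' : 0 <= y <= 1 -> 0 <= y' <= 1 ->
  (forall k, `|g k.+1 - g k| <= kap) ->
  `|bernstein N g y - bernstein N g y'| <= N%:R * kap * `|y - y'|.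
Proof.
move=> y01 y'01; elim: N g => [|N IH] g Hg.
  by rewrite /= subrr normr0 !mul0r.
pose g1 k := g k.+1; rewrite /= -/g1.
have -> : (1 - y) * bernstein N g y + y * bernstein N g1 y -
    ((1 - y') * bernstein N g y' + y' * bernstein N g1 y') =
    (1 - y) * (bernstein N g y - bernstein N g y') +
    y * (bernstein N g1 y - bernstein N g1 y') +
    (y - y') * (bernstein N g1 y' - bernstein N g y') by ring.
have /andP[y0 y1] := y01.
apply: (le_trans (ler_normD _ _)).
have -> : N.+1%:R * kap * `|y - y'| = (1 - y) * (N%:R * kap * `|y - y'|) +
    y * (N%:R * kap * `|y - y'|) + `|y - y'| * kap.
  by rewrite -natr1; ring.
apply: lerD; last first.
  rewrite normrM; apply: ler_wpM2l => //.
  exact: bernstein_dist_le.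
apply: (le_trans (ler_normD _ _)); rewrite !normrM.
rewrite (ger0_norm y0) (@ger0_norm _ (1 - y)) ?subr_ge0//.
by apply: lerD; apply: ler_wpM2l; rewrite ?subr_ge0//; apply: IH => // k; exact: Hg.
Qed.

Lemma bernstein_second_moment N (a : R) y :
  bernstein N (fun k => (k%:R - a) ^+ 2) y =
  (N%:R * y - a) ^+ 2 + N%:R * y * (1 - y).
Proof.
elim: N a => [|N IH] a /=; first by rewrite !mul0r addr0.
rewrite IH (_ : (fun k => _) = (fun k => (k%:R - (a - 1)) ^+ 2)).
  by rewrite IH -[in RHS]natr1; ring.
by apply/funext => k; rewrite -natr1; congr (_ ^+ 2); ring.
Qed.

(** Chebyshev's argument: |k - m y| <= (n + (k - m y)^2 / n) / 2 with m = n^2,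
    and the second moment is at most m. *)
Lemma bernstein_approx (n : nat) g (kap v y : R) : (0 < n)%N -> 0 <= kap ->
  0 <= y <= 1 -> (forall k, `|g k - v| <= kap * `|k%:R - (n ^ 2)%:R * y|) ->
  `|bernstein (n ^ 2) g y - v| <= kap * n%:R.
Proof.
move=> n0 kap0 y01 Hg; have nR : 0 < n%:R :> R by rewrite ltr0n.
have Hg' k : `|g k - v| <=
    kap * n%:R / 2 + kap / (2 * n%:R) * (k%:R - (n ^ 2)%:R * y) ^+ 2.
  apply: le_trans (Hg k) _; set s := k%:R - _.
  have -> : kap * n%:R / 2 + kap / (2 * n%:R) * s ^+ 2 =
      kap * ((n%:R ^+ 2 + `|s| ^+ 2) / (2 * n%:R)).
    by rewrite real_normK ?num_real//; field; rewrite gt_eqF.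
  apply: ler_wpM2l => //; rewrite ler_pdivlMr ?mulr_gt0//.
  have := sqr_ge0 (n%:R - `|s|); clear; move: `|s| => q; lra.
rewrite -(bernstein_cst (n ^ 2) v y) bernstein_sub.
apply: le_trans (bernstein_norm_le (n ^ 2) y01 Hg') _.
rewrite bernstein_affine bernstein_second_moment subrr expr0n/= add0r.
have -> : kap / (2 * n%:R) * ((n ^ 2)%:R * y * (1 - y)) =
    kap * n%:R / 2 * (y * (1 - y)) by rewrite natrX; field; rewrite gt_eqF.
have kn : 0 <= kap * n%:R by rewrite mulr_ge0.
by have /andP[? ?] := y01; nra.
Qed.

End bernstein.

Section coordinates.
Context {R : realType} {d : nat}.
Implicit Types (x y : 'cV[R]_d) (i j : 'I_d) (f g : 'cV[R]_d -> R).

Definition set_coord i (c : R) x : 'cV[R]_d :=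
  \col_j (if j == i then c else x j ord0).

Lemma set_coordE i c x j :
  set_coord i c x j ord0 = if j == i then c else x j ord0.
Proof. by rewrite mxE. Qed.

Lemma set_coordK i c c' x : set_coord i c (set_coord i c' x) = set_coord i c x.
Proof. by apply/colP => j; rewrite !mxE; case: eqP. Qed.

Lemma set_coord_id i x : set_coord i (x i ord0) x = x.
Proof. by apply/colP => j; rewrite !mxE; case: eqP => [->|]. Qed.

Lemma set_coordC i j c c' x : i != j ->
  set_coord i c (set_coord j c' x) = set_coord j c' (set_coord i c x).
Proof.
move=> ij; apply/colP => k; rewrite !mxE.
by case: (eqVneq k i) => [->|//]; rewrite (negPf ij).
Qed.

(** Lipschitz in each coordinate separately, with the same constant: the form
    that is preserved exactly by the smoothing below. *)
Definition coord_lipschitz (K : R) f := forall i x c c',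
  `|f (set_coord i c x) - f (set_coord i c' x)| <= K * `|c - c'|.

Definition mix (l : seq 'I_d) x0 x : 'cV[R]_d :=
  \col_j (if j \in l then x j ord0 else x0 j ord0).

Lemma coord_lipschitz_dist K f x y : coord_lipschitz K f ->
  `|f x - f y| <= \sum_i (K * `|x i ord0 - y i ord0|).
Proof.
move=> fK; suff H l : uniq l ->
    `|f (mix l y x) - f y| <= \sum_(i <- l) (K * `|x i ord0 - y i ord0|).
  have := H _ (index_enum_uniq _).
  rewrite (_ : mix _ _ _ = x)//.
  by apply/colP => j; rewrite mxE mem_index_enum.
elim: l => [_|i l IH /= /andP[il ul]].
  rewrite big_nil (_ : mix _ _ _ = y) ?subrr ?normr0//.
  by apply/colP => j; rewrite mxE in_nil.
rewrite big_cons; apply: le_trans (ler_distD (f (mix l y x)) _ _) _.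
apply: lerD; last exact: IH.
have -> : mix (i :: l) y x = set_coord i (x i ord0) (mix l y x).
  by apply/colP => j; rewrite !mxE inE; case: eqP => // ->.
have {2}-> : mix l y x = set_coord i (y i ord0) (mix l y x).
  by apply/colP => j; rewrite !mxE; case: eqP => // ->; rewrite (negPf il).
exact: fK.
Qed.

Lemma coord_lipschitz_enorm K f x y : 0 <= K -> coord_lipschitz K f ->
  `|f x - f y| <= d%:R * K * enorm (x - y).
Proof.
move=> K0 fK; apply: le_trans (coord_lipschitz_dist _ _ fK) _.
apply: (@le_trans _ _ (\sum_(i < d) K * enorm (x - y))).
  apply: ler_sum => i _; apply: ler_wpM2l => //.
  by apply: le_trans (coord_le_enorm _ i); rewrite !mxE.
by rewrite sumr_const card_ord -mulrA mulr_natl.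
Qed.

Lemma enorm_coord_lipschitz K f : 0 <= K ->
  (forall x y, `|f x - f y| <= K * enorm (x - y)) -> coord_lipschitz K f.
Proof.
move=> K0 fK i x c c'; apply: le_trans (fK _ _) _; apply: ler_wpM2l => //.
rewrite (_ : _ - _ = (c - c') *: delta_mx i ord0); last first.
  by apply/colP => j; rewrite !mxE eqxx andbT; case: eqP => _; rewrite ?mulr1// subrr mulr0.
by rewrite enormZ enormE dot_delta mxE !eqxx sqrtr1 mulr1.
Qed.

End coordinates.

Section smoothing.
Context {R : realType} {d : nat}.
Implicit Types (x y : 'cV[R]_d) (i j : 'I_d) (f g : 'cV[R]_d -> R).
Variables (n : nat) (r : R).
Hypotheses (n0 : (0 < n)%N) (r0 : 0 < r).

Definition node (k : nat) : R := - r + 2 * r * k%:R / (n ^ 2)%:R.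

Definition angle (s : R) : R := (1 + sin (s / r)) / 2.

(** The Bernstein operator of [- r, r] in the i-th coordinate, evaluated at
    r sin (x_i / r): the substitution makes the result a bounded trigonometric
    polynomial in x_i on the whole line, and does not increase increments. *)
Definition smooth i f x : R :=
  bernstein (n ^ 2) (fun k => f (set_coord i (node k) x)) (angle (x i ord0)).

Lemma angle01 s : 0 <= angle s <= 1.
Proof.
have := sin_le1 (s / r); have := sin_geN1 (s / r); rewrite /angle.
by move=> ? ?; apply/andP; split; lra.
Qed.

Lemma sin_dist_le (a b : R) : `|sin a - sin b| <= `|a - b|.
Proof.
have df (y : R) : derivable (@sin R) y 1.
  by have [] := @is_derive_sin R y.
have [t _] := @mvt_line R R (@sin R) b 1 (a - b) df.
rewrite [(a - b) *: 1]mulr1 (addrC b) subrK => ->.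
rewrite (@derive_val _ _ _ _ _ _ _ (is_derive_sin _)) normrM.
by rewrite ler_piMr// cos_max.
Qed.

Lemma angle_dist_le s s' : 2 * r * `|angle s - angle s'| <= `|s - s'|.
Proof.
have -> : angle s - angle s' = (sin (s / r) - sin (s' / r)) / 2.
  by rewrite /angle; field.
rewrite normrM (@ger0_norm _ 2^-1)//; set v := `|_ - _|.
have -> : 2 * r * (v / 2) = v * r by field.
rewrite {}/v -ler_pdivlMr//; apply: le_trans (sin_dist_le _ _) _.
by rewrite -mulrBl normrM (@gtr0_norm _ r^-1) ?invr_gt0.
Qed.

Let n2_gt0 : 0 < (n ^ 2)%:R :> R.
Proof. by rewrite ltr0n expn_gt0 n0. Qed.

Lemma node_dist k (s : R) : `|node k - r * sin (s / r)| =
  2 * r / (n ^ 2)%:R * `|k%:R - (n ^ 2)%:R * angle s|.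
Proof.
rewrite -[in RHS](@gtr0_norm _ (2 * r / (n ^ 2)%:R)); last first.
  by rewrite divr_gt0// mulr_gt0.
rewrite -normrM; congr `|_|; rewrite /node /angle.
by move: n2_gt0; move: ((n ^ 2)%:R : R) => N h; field; rewrite gt_eqF.
Qed.

Lemma smooth_bounded i f (M : R) : (forall x, `|f x| <= M) ->
  forall x, `|smooth i f x| <= M.
Proof. by move=> fM x; apply: bernstein_bounded => //; exact: angle01. Qed.

Lemma smooth_coord_lipschitz i K f : 0 <= K ->
  coord_lipschitz K f -> coord_lipschitz K (smooth i f).
Proof.
move=> K0 fK j x c c'; rewrite /smooth.
have [<-{j}|ji] := eqVneq i j.
  rewrite !set_coordE eqxx.
  under eq_fun do rewrite set_coordK.
  rewrite [X in _ - bernstein _ X _](_ : _ = (fun k => f (set_coord i (node k) x))).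
    apply: (le_trans (bernstein_lipschitz (kap := K * (2 * r / (n ^ 2)%:R)) _ _ _ _)).
    - exact: angle01.
    - exact: angle01.
    - move=> k; apply: le_trans (fK _ _ _ _) _; apply: ler_wpM2l => //.
      rewrite (_ : node k.+1 - node k = 2 * r / (n ^ 2)%:R).
        by rewrite gtr0_norm// divr_gt0// mulr_gt0.
      rewrite /node -[k.+1%:R]natr1; move: n2_gt0; move: ((n ^ 2)%:R : R).
      by move=> N h; field; rewrite gt_eqF.
    - have -> : (n ^ 2)%:R * (K * (2 * r / (n ^ 2)%:R)) = K * (2 * r).
        by move: n2_gt0; move: ((n ^ 2)%:R : R) => N h; field; rewrite gt_eqF.
      by rewrite -mulrA; apply: ler_wpM2l => //; exact: angle_dist_le.
  by apply/funext => k; rewrite set_coordK.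
rewrite !set_coordE (negPf ji).
apply: bernstein_dist_le => [|k]; first exact: angle01.
by rewrite !(set_coordC _ _ _ ji); exact: fK.
Qed.

Lemma smooth_dist i K f x : 0 <= K -> coord_lipschitz K f ->
  `|smooth i f x - f x| <=
    2 * r * K / n%:R + K * `|r * sin (x i ord0 / r) - x i ord0|.
Proof.
move=> K0 fK; pose s := x i ord0.
apply: le_trans (ler_distD (f (set_coord i (r * sin (s / r)) x)) _ _) _.
apply: lerD; last by have := fK i x (r * sin (s / r)) s; rewrite set_coord_id.
have -> : 2 * r * K / n%:R = K * (2 * r / (n ^ 2)%:R) * n%:R.
  by rewrite natrX; field; rewrite gt_eqF// ltr0n.
apply: bernstein_approx => //.
- by rewrite !mulr_ge0// ?invr_ge0 ltW.
- exact: angle01.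
- move=> k; apply: le_trans (fK _ _ _ _) _.
  by rewrite node_dist mulrA.
Qed.

Lemma trig_poly_bernstein N (G : nat -> 'cV[R]_d -> R) Y :
  (forall k, trig_poly (G k)) -> trig_poly Y ->
  trig_poly (fun x => bernstein N (fun k => G k x) (Y x)).
Proof.
move=> + tY; elim: N G => [|N IH] G tG; first exact: tG.
apply: trig_poly_add; apply: trig_poly_mul => //.
- have -> : (fun x => 1 - Y x) = (fun x => 1 + (-1) * Y x).
    by apply/funext => x; rewrite mulN1r.
  apply: trig_poly_add; first exact: trig_poly_cst.
  by apply: trig_poly_mul => //; exact: trig_poly_cst.
- exact: IH.
- by apply: (IH (fun k => G k.+1)).
Qed.

Lemma trig_poly_angle i : trig_poly (fun x => angle (x i ord0)).
Proof.
have -> : (fun x : 'cV[R]_d => angle (x i ord0)) =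
  (fun x => 1 / 2 + 1 / 2 * cos (dot (r^-1 *: delta_mx i ord0) x + - (pi / 2))).
  apply/funext => x; rewrite dotZl dot_delta cosB cos_pihalf sin_pihalf.
  by rewrite /angle (mulrC r^-1); field.
apply: trig_poly_add; first exact: trig_poly_cst.
exact: trig_poly_wave.
Qed.

Definition smooth_all f := foldr smooth f (index_enum 'I_d).

(** The coordinates outside l are frozen at those of x0; smoothing in a new
    coordinate i unfreezes it. *)
Lemma trig_poly_smooth_frozen f l x0 : uniq l ->
  trig_poly (fun x => foldr smooth f l (mix l x0 x)).
Proof.
elim: l x0 => [x0 _|i l IH x0 /= /andP[il ul]].
  have -> : (fun x => foldr smooth f [::] (mix [::] x0 x)) = (fun=> f x0).
    by apply/funext => x /=; congr f; apply/colP => j; rewrite mxE in_nil.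
  exact: trig_poly_cst.
have -> : (fun x => smooth i (foldr smooth f l) (mix (i :: l) x0 x)) =
  (fun x => bernstein (n ^ 2)
    (fun k => foldr smooth f l (mix l (set_coord i (node k) x0) x))
    (angle (x i ord0))).
  apply/funext => x; rewrite /smooth -/smooth mxE mem_head; congr bernstein.
  apply/funext => k; congr (foldr smooth f l _); apply/colP => j; rewrite !mxE inE.
  by case: eqP => // ->; rewrite (negPf il).
apply: trig_poly_bernstein; last exact: trig_poly_angle.
by move=> k; exact: IH.
Qed.

Lemma trig_poly_smooth_all f : trig_poly (smooth_all f).
Proof.
have := trig_poly_smooth_frozen f 0 (index_enum_uniq 'I_d).
congr trig_poly; apply/funext => x; congr (foldr smooth f _ _).
by apply/colP => j; rewrite mxE mem_index_enum.
Qed.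

Lemma smooth_all_bounded f (M : R) : (forall x, `|f x| <= M) ->
  forall x, `|smooth_all f x| <= M.
Proof.
by rewrite /smooth_all; elim: (index_enum _) => //= i l IH fM; exact/smooth_bounded/IH.
Qed.

Lemma smooth_all_coord_lipschitz K f : 0 <= K ->
  coord_lipschitz K f -> coord_lipschitz K (smooth_all f).
Proof.
move=> K0 fK; rewrite /smooth_all; elim: (index_enum _) => //= i l IH.
exact: smooth_coord_lipschitz.
Qed.

Lemma smooth_all_dist K f x : 0 <= K -> coord_lipschitz K f ->
  `|smooth_all f x - f x| <= \sum_i
    (2 * r * K / n%:R + K * `|r * sin (x i ord0 / r) - x i ord0|).
Proof.
move=> K0 fK; rewrite /smooth_all.
suff [] : coord_lipschitz K (foldr smooth f (index_enum 'I_d)) /\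
    `|foldr smooth f (index_enum 'I_d) x - f x| <= \sum_i
    (2 * r * K / n%:R + K * `|r * sin (x i ord0 / r) - x i ord0|) by [].
elim: (index_enum _) => [|i l [IH1 IH2]] /=.
  by rewrite big_nil subrr normr0.
split; first exact: smooth_coord_lipschitz.
rewrite big_cons; apply: le_trans (ler_distD (foldr smooth f l x) _ _) _.
by apply: lerD => //; exact: smooth_dist.
Qed.

End smoothing.

Lemma cvg_scaled_sin {R : realType} (s : R) :
  (fun m : nat => m.+1%:R * sin (s / m.+1%:R)) @ \oo --> s.
Proof.
have D : is_derive (0 : R) 1 (fun h : R => sin (s * h)) (cos (s * 0) * (s * 1)).
  have D : is_derive (0 : R) 1 (fun h : R => s * h) (s * 1).
    exact: (@is_deriveZ _ _ _ id s (0 : R) 1 1).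
  exact: (@is_derive1_comp _ (@sin R) (fun h => s * h) _ _ _ _ D).
have [+ E] := D; rewrite /derivable => dc.
have : (fun h : R => h^-1 *: (((fun h => sin (s * h)) \o shift 0) (h *: 1) -
    sin (s * 0))) @ 0^' --> s.
  by rewrite mulr0 cos0 mul1r mulr1 in E; rewrite -[X in _ --> X]E; exact: dc.
move=> /cvgrPdist_lt H; apply/cvgrPdist_lt => e e0.
have [q /= q0 Hq] := H e e0; near=> m.
have m0 : 0 < m.+1%:R^-1 :> R by rewrite invr_gt0.
have := Hq (m.+1%:R^-1); rewrite /ball_/= sub0r normrN gtr0_norm// gt_eqF//.
rewrite invrK addr0 [_ *: 1]mulr1 mulr0 sin0 subr0 [_ *: _]/GRing.scale/=; apply => //.
near: m; have := @near_infty_natSinv_lt R (PosNum q0); exact.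
Unshelve. all: by end_near. Qed.

Lemma cvg_sum_seq {R : realType} {I : Type} (s : seq I) (u : I -> nat -> R)
    (l : I -> R) : (forall i, u i @ \oo --> l i) ->
  (fun m => \sum_(i <- s) u i m) @ \oo --> \sum_(i <- s) l i.
Proof.
move=> ul; elim: s => [|i s IH].
  by rewrite big_nil; under eq_fun do rewrite big_nil; exact: cvg_cst.
rewrite big_cons (_ : (fun m => _) = (fun m => u i m + \sum_(j <- s) u j m)).
  exact: cvgD.
by apply/funext => m; rewrite big_cons.
Qed.

(** With r = m + 1 and n = r^2 in smooth, r sin (x_i / r) tends to x_i and the
    error 2 r K / n of the Bernstein operator tends to 0, while the supremum and
    the coordinatewise Lipschitz constants are those of f for every m. *)
Lemma trig_poly_approx {R : realType} {d : nat} (f : 'cV[R]_d -> R) (M K : R) :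
  0 <= K -> (forall x, `|f x| <= M) -> coord_lipschitz K f ->
  exists f_ : nat -> 'cV[R]_d -> R, [/\ forall m, trig_poly (f_ m),
    forall m x, `|f_ m x| <= M, forall m, coord_lipschitz K (f_ m) &
    forall x, f_ ^~ x @ \oo --> f x].
Proof.
move=> K0 fM fK; pose r m : R := m.+1%:R.
exists (fun m => smooth_all (m.+1 ^ 2) (r m) f); split.
- by move=> m; apply: trig_poly_smooth_all; rewrite ?expn_gt0 ?ltr0n.
- by move=> m x; apply: smooth_all_bounded.
- by move=> m; apply: smooth_all_coord_lipschitz => //; rewrite ?expn_gt0 ?ltr0n.
- move=> x; pose err m := \sum_i
    (2 * K / m.+1%:R + K * `|m.+1%:R * sin (x i ord0 / m.+1%:R) - x i ord0|).
  have err0 : err @ \oo --> (0 : R).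
    rewrite [X in _ --> X](_ : 0 = \sum_(i < d)
        (2 * K * 0 + K * `|x i ord0 - x i ord0|)); last first.
      by rewrite big1// => i _; rewrite subrr normr0 !mulr0 addr0.
    apply: cvg_sum_seq => i; apply: cvgD.
      by apply: cvgM; [exact: cvg_cst|exact: cvg_harmonic].
    apply: cvgM; first exact: cvg_cst.
    apply: cvg_norm; apply: cvgB; last exact: cvg_cst.
    exact: cvg_scaled_sin.
  apply/cvgrPdist_le => e e0; near=> m.
  rewrite distrC; apply: (@le_trans _ _ (err m)).
    have m0 : 0 < m.+1%:R :> R by rewrite ltr0n.
    apply: (le_trans (smooth_all_dist _ _ _ K0 fK)); rewrite ?expn_gt0//.
    rewrite /err /r; apply: ler_sum => i _; rewrite lerD2r natrX.
    by rewrite le_eqVlt; apply/orP; left; apply/eqP; field; rewrite gt_eqF.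
  by near: m; exact: (cvgr_le _ err0 _ e0).
Unshelve. all: by end_near. Qed.

(** * Two-sided bounds for bounded Cauchy problems *)

Section opposite_solution.
Context {R : realType} {d : nat}.
Implicit Types (A : 'cV[R]_d -> 'M[R]_d) (b : 'cV[R]_d -> 'cV[R]_d).

Lemma partial_opp i (f : 'cV[R]_d -> R) x :
  derivable f x (delta_mx i ord0) -> partial i (fun y => - f y) x = - partial i f x.
Proof. by move=> df; rewrite /partial -deriveN. Qed.

(** The derivatives of a classical solution exist at positive times only, so the
    identity between them and those of its opposite is available near (x, t). *)
Lemma continuous_opp_positive_time (g g' : 'cV[R]_d * R -> R) x t : 0 < t ->
  (forall z, 0 < z.2 -> g' z = - g z) -> {for (x, t), continuous g} ->
  {for (x, t), continuous g'}.
Proof.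
move=> t0 gE cg; rewrite /prop_for /continuous_at (gE (x, t) t0).
apply: cvg_trans (cvgN cg); apply: near_eq_cvg.
have : \forall z \near (x, t), 0 < (z : 'cV[R]_d * R).2.
  exact: (@cvg_snd 'cV[R]_d R (nbhs x) (nbhs t) _ _ (lt_nbhsr t0)).
by apply: filterS => z /gE ->.
Qed.

Lemma cauchy_solution_opp A b f u : cauchy_solution A b f u ->
  cauchy_solution A b (fun x => - f x) (fun x t => - u x t).
Proof.
move=> S; have CS := cauchy_classical S.
have p1 i x t : 0 < t -> partial i (fun y => - u y t) x = - partial i (u ^~ t) x.
  by move=> t0; apply: partial_opp; exact: (solution_derivable_space CS).
have p1f i t : 0 < t -> partial i (fun y => - u y t) = (fun x => - partial i (u ^~ t) x).
  by move=> t0; apply/funext => x; exact: p1.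
have p2 i j x t : 0 < t -> partial i (partial j (fun y => - u y t)) x =
    - partial i (partial j (u ^~ t)) x.
  move=> t0; rewrite p1f//; apply: partial_opp.
  exact: (solution_derivable_space2 CS).
have dt x t : 0 < t -> derive1 (fun s => - u x s) t = - derive1 (u x) t.
  by move=> t0; rewrite !derive1E -deriveN//; exact: (solution_derivable_time CS).
split.
- split=> [x t t0|i x t t0|i j x t t0|x t t0|x t t0|i x t t0|i j x t t0|x t t0].
  + by apply: derivableN; exact: (solution_derivable_time CS).
  + by apply: derivableN; exact: (solution_derivable_space CS).
  + rewrite p1f//; apply: derivableN; exact: (solution_derivable_space2 CS).
  + apply: (continuous_opp_positive_time t0) (@solution_continuous _ _ _ _ _ CS x t t0).
    by [].
  + apply: (continuous_opp_positive_time t0)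
      (@solution_continuous_time _ _ _ _ _ CS x t t0).
    by move=> z; exact: dt.
  + apply: (continuous_opp_positive_time t0)
      (@solution_continuous_space _ _ _ _ _ CS i x t t0).
    by move=> z; exact: p1.
  + apply: (continuous_opp_positive_time t0)
      (@solution_continuous_space2 _ _ _ _ _ CS i j x t t0).
    by move=> z; exact: p2.
  + rewrite dt// (solution_equation CS)// !generatorE.
    have -> : hessian (fun y => - u y t) x = - hessian (u ^~ t) x.
      by apply/matrixP => i j; rewrite !mxE p2.
    have -> : gradient (fun y => - u y t) x = - gradient (u ^~ t) x.
      by apply/colP => i; rewrite !mxE p1.
    by rewrite mulmxN dotNr raddfN/=; ring.
- by move=> x; rewrite (cauchy_initial S).
- by move=> z; apply: cvgN; exact: (cauchy_continuous S).
- have [M uM] := cauchy_bounded S; exists M => x t t0.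
  by rewrite normrN; exact: uM.
Qed.

Lemma cauchy_solution_bounded A b lam Lam lip bd f u (M : R) : (0 < d)%N ->
  parabolic_bounds A b lam Lam lip bd -> cauchy_solution A b f u ->
  (forall x, `|f x| <= M) -> forall x (t : R), 0 <= t -> `|u x t| <= M.
Proof.
move=> d0 H S fM x t t0; rewrite ler_norml lerNl; apply/andP; split.
  apply: (maximum_principle d0 H (cauchy_solution_opp S)) => // y.
  by have := fM y; rewrite ler_norml lerNl => /andP[].
apply: (maximum_principle d0 H S) => // y.
by have := fM y; rewrite ler_norml => /andP[].
Qed.

Lemma cauchy_solution_cst A b lam Lam lip bd (a : R) u : (0 < d)%N ->
  parabolic_bounds A b lam Lam lip bd -> cauchy_solution A b (fun=> a) u ->
  forall x (t : R), 0 <= t -> u x t = a.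
Proof.
move=> d0 H S x t t0; apply/eqP; rewrite eq_le -[a <= _]lerN2.
apply/andP; split; first exact: (maximum_principle d0 H S).
exact: (maximum_principle d0 H (cauchy_solution_opp S)).
Qed.

(** gradient_estimate with M = T = 1 and K = 8 c, where c is so large that
    lam c dominates the lower order terms. *)
Lemma exists_gradient_constant A b lam Lam lip bd : (0 < d)%N ->
  parabolic_bounds A b lam Lam lip bd -> exists2 K : R, 0 <= K &
  forall f u, cauchy_solution A b f u -> (forall x, `|f x| <= 1) ->
    forall x y, u x 1 - u y 1 <= K * enorm (x - y).
Proof.
move=> d0 H; have lam0 := pb_lam H; have lip0 := pb_lip H.
pose s := lip * (3 / 2 * d%:R + 1 / 2) + 1.
have s0 : 0 < s by rewrite ltr_wpDl// mulr_ge0// addr_ge0// mulr_ge0.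
pose c := 1 + s / lam.
have c1 : 1 <= c by rewrite lerDl divr_ge0// ltW.
have c0 : 0 < c by apply: lt_le_trans c1.
have lamc : s <= lam * c.
  by rewrite /c mulrDr mulr1 mulrCA divff ?gt_eqF// mulr1 lerDr ltW.
have lips : lip <= s.
  have := mulr_ge0 lip0 (ler0n R d); have : (1 : R) <= d%:R by rewrite ler1n.
  by move=> d1 _; rewrite /s; have := ler_wpM2l lip0 d1; lra.
have invc : (2 * c)^-1 <= 1 / 2.
  rewrite invfM div1r -[leRHS]mulr1; apply: ler_wpM2l; first by rewrite invr_ge0.
  by rewrite invf_le1.
exists (8 * c); first by rewrite mulr_ge0// ltW.
move=> f u S f1 x y; have u1 := cauchy_solution_bounded d0 H S f1.
apply: (gradient_estimate d0 H S u1 (c := c)) => //.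
- rewrite invfM mulrCA [leRHS]mulrC; apply: ler_wpM2l; first by rewrite invr_ge0.
  by rewrite ler_pdivrMr//; apply: (le_trans lips).
- by rewrite mulr1.
- have h : 8 * c * lip * (3 / 2 * d%:R + (2 * c)^-1) <= 8 * c * (s - 1).
    rewrite -mulrA /s addrK; apply: ler_wpM2l; first by rewrite mulr_ge0// ltW.
    by apply: ler_wpM2l => //; rewrite lerD2l.
  have h2 : 8 * c * s <= 8 * c * (lam * c).
    by apply: ler_wpM2l => //; rewrite mulr_ge0// ltW.
  have h3 : 0 <= 8 * c * s by rewrite !mulr_ge0// ltW.
  by move: h h2 h3 c1; rewrite divr1; clear - d; lra.
Qed.

End opposite_solution.

(** * The random equation in a fixed environment *)

Section environment_bounds.
Context {R : realType} {d : nat}.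

Lemma random_environment_bounds {disp} {Omega : measurableType disp}
    (P : probability Omega R) tau (A : 'cV[R]_d -> Omega -> 'M[R]_d)
    (b : 'cV[R]_d -> Omega -> 'cV[R]_d) nu eta0 w :
  random_environment P tau A b nu eta0 ->
  exists C : R, parabolic_bounds (A ^~ w) (b ^~ w) nu^-1 nu C C.
Proof.
move=> H; have [C C0 HC] := env_bounded_lipschitz H; exists C; split.
- by rewrite invr_gt0 (lt_trans ltr01)// (env_nu H).
- exact: ltW.
- exact: ltW.
- by move=> x; exact: (env_symmetric H).
- move=> x xi; rewrite -enorm_sqr.
  by have /andP[] := env_elliptic H x w xi.
- move=> x xi; rewrite -enorm_sqr.
  by have /andP[] := env_elliptic H x w xi.
- move=> x y xi; apply: le_trans (bform_enorm_le _ _) _.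
  by apply: ler_wpM2r; [exact: dot_ge0|have [] := HC x y w].
- by move=> x; have [] := HC x x w.
- by move=> x y; have [] := HC x y w.
Qed.

Lemma heat_bounds (al : R) : 0 < al -> @parabolic_bounds R d
  (fun=> al%:M) (fun=> 0) al al 0 0.
Proof.
move=> al0; split=> // [x|x xi|x xi|x y xi|x|x y].
- by rewrite tr_scalar_mx.
- by rewrite bform_scalar.
- by rewrite bform_scalar.
- by rewrite bformBm subrr !mul0r.
- by rewrite enorm0.
- by rewrite subrr enorm0 mul0r.
Qed.

Variables (A : 'cV[R]_d -> 'M[R]_d) (b : 'cV[R]_d -> 'cV[R]_d).
Variables (lam Lam lip bd : R).
Hypotheses (d0 : (0 < d)%N) (H : parabolic_bounds A b lam Lam lip bd).
Variable p : R -> 'cV[R]_d -> 'cV[R]_d -> R.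
Hypothesis G : greens_function A b p.
Notation T := (Borel 'cV[R]_d).

Lemma green_op_gt0 (t : R) f x : 0 < t -> green_op p t f x =
  \int[lebesgue_cV d]_(y in [set: T]) (p t x y * f y).
Proof. by move=> t0; rewrite /green_op gt_eqF. Qed.

Lemma green_op_cst (a t : R) x : 0 <= t -> green_op p t (fun=> a) x = a.
Proof.
move=> t0; have S : cauchy_solution A b (fun=> a)
    (fun x t => green_op p t (fun=> a) x).
  by apply: (green_cauchy G); [exact: continuous_fun_cst|exists `|a|].
exact: (cauchy_solution_cst d0 H S).
Qed.

(** The gradient bound for continuous data controls the total variation of
    p_1(x, .) - p_1(y, .), and with it all bounded Borel data. *)
Lemma exists_green_lipschitz : exists2 K : R, 0 <= K &
  forall (g : 'cV[R]_d -> R) (M : R), 0 <= M ->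
    measurable_fun [set: T] (g : T -> R) -> (forall x, `|g x| <= M) ->
    forall x y, `|green_op p 1 g x - green_op p 1 g y| <= M * K * enorm (x - y).
Proof.
have [K K0 HK] := exists_gradient_constant d0 H; exists K => // g M M0 mg gM.
have int x := green_integrable G x (@ltr01 R).
have dif f (B : R) x y : measurable_fun [set: T] (f : T -> R) ->
    (forall z, `|f z| <= B) -> green_op p 1 f x - green_op p 1 f y =
    \int[lebesgue_cV d]_(z in [set: T]) ((p 1 x z - p 1 y z) * f z).
  move=> mf fB; rewrite !green_op_gt0// -RintegralB//.
  - by apply: eq_Rintegral => z _; rewrite mulrBl.
  - exact: integrable_mul_bounded (int x) mf fB.
  - exact: integrable_mul_bounded (int y) mf fB.
suff one x y : green_op p 1 g x - green_op p 1 g y <= M * K * enorm (x - y).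
  move=> x y; rewrite ler_norml one andbT lerNl opprB enormBC; exact: one.
rewrite (dif _ _ _ _ mg gM) -mulrA; apply: Rintegral_le_of_continuous => //.
  exact: (integrableB measurableT (int x) (int y)).
move=> f cf f1; rewrite -(dif f 1 x y (continuous_Borel_measurable cf) f1).
apply: (HK f (fun x t => green_op p t f x)) => //.
by apply: (green_cauchy G) => //; exists 1.
Qed.

Lemma green_op_cvg (t : R) (f_ : nat -> 'cV[R]_d -> R) f (M : R) x : 0 < t ->
  (forall m, continuous (f_ m)) -> measurable_fun [set: T] (f : T -> R) ->
  (forall m y, `|f_ m y| <= M) -> (forall y, f_ ^~ y @ \oo --> f y) ->
  (fun m => green_op p t (f_ m) x) @ \oo --> green_op p t f x.
Proof.
move=> t0 cf_ mf fM fcvg; rewrite green_op_gt0//.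
under eq_fun do rewrite green_op_gt0//.
apply: (Rintegral_dominated (green_integrable G x t0)) fM fcvg => // m.
exact: continuous_Borel_measurable.
Qed.

End environment_bounds.

(** * One application of the Hoelder control *)

Section holder_norms.
Context {R : realType} {d : nat} (k : parameters R).
Hypothesis hbeta : 0 < beta k <= 2^-1.
Implicit Types (f : 'cV[R]_d -> R) (x y : 'cV[R]_d).

Let beta_gt0 : 0 < beta k.
Proof. by case/andP: hbeta. Qed.

Let beta_le1 : beta k <= 1.
Proof. by case/andP: hbeta => _ /le_trans; apply; rewrite invf_le1// ler1n. Qed.

(** For |x - y| <= 1 the Lipschitz bound is the stronger one, as beta <= 1;
    for |x - y| >= 1 the supremum suffices. *)
Lemma holder_quotient_le f (M K : R) x y : x != y -> 0 <= K ->
  (forall z, `|f z| <= M) -> `|f x - f y| <= K * enorm (x - y) ->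
  `|f x - f y| / enorm (x - y) `^ beta k <= K + 2 * M.
Proof.
move=> xy K0 fM fK; set r := enorm (x - y) in fK *.
have r0 : 0 < r by rewrite enorm_gt0 subr_eq0.
have M0 : 0 <= M by apply: le_trans (fM x).
rewrite ler_pdivrMr ?powR_gt0// mulrDl.
have rb0 := powR_ge0 r (beta k).
have [r1|r1] := leP r 1.
  apply: (le_trans fK); rewrite -[leLHS]addr0; apply: lerD; last by rewrite !mulr_ge0.
  apply: ler_wpM2l => //; rewrite -{1}(powRr1 (ltW r0)).
  by apply: ger_powR => //; rewrite r0.
have rb1 : 1 <= r `^ beta k.
  by rewrite -(powRr0 r); apply: ler_powR; exact: ltW.
apply: (@le_trans _ _ (2 * M)).
  apply: (le_trans (ler_normB _ _)); have := fM x; have := fM y; clear - R; lra.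
rewrite -[leLHS]add0r; apply: lerD; first exact: mulr_ge0.
by apply: ler_peMr => //; rewrite mulr_ge0.
Qed.

Lemma holder_norm_le (l M N : R) f : (forall x, `|f x| <= M) ->
  (forall x y, x != y -> `|f x - f y| / enorm (x - y) `^ beta k <= N) ->
  (holder_norm k l f <= (M + l `^ beta k * N)%:E)%E.
Proof.
move=> fM fN; rewrite /holder_norm EFinD EFinM; apply: leeD.
  by apply: ub_ereal_sup => _ [x _ <-]; rewrite lee_fin.
apply: lee_wpmul2l; first by rewrite lee_fin powR_ge0.
by apply: ub_ereal_sup => _ [[x y] /= xy <-]; rewrite lee_fin; exact: fN.
Qed.

Lemma holder_norm_ge (l : R) f x y : x != y ->
  ((l `^ beta k * (`|f x - f y| / enorm (x - y) `^ beta k))%:E <=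
   holder_norm k l f)%E.
Proof.
move=> xy; rewrite /holder_norm -[leLHS]add0e EFinM; apply: leeD.
  apply: (@le_trans _ _ `|f x|%:E); first by rewrite lee_fin.
  by apply: ereal_sup_ubound; exists x.
apply: lee_wpmul2l; first by rewrite lee_fin powR_ge0.
by apply: ereal_sup_ubound; exists (x, y).
Qed.

End holder_norms.

Lemma cutoff_eq1 {R : realType} (k : parameters R) d n (y : 'cV[R]_d) :
  enorm y <= 30 * Num.sqrt d%:R * L k n -> cutoff k n 0 y = 1.
Proof.
move=> yL; rewrite /cutoff subr0 enormZ; set a := _ * L k n in yL *.
have ya : `|a^-1| * enorm y <= 1.
  have a0 : 0 <= a by apply: le_trans yL; exact: enorm_ge0.
  have [->|an0] := eqVneq a 0; first by rewrite invr0 normr0 mul0r ler01.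
  by rewrite ger0_norm ?invr_ge0// mulrC ler_pdivrMr ?mul1r// lt_def an0.
by rewrite max_r ?min_l//; move: ya; clear - R; lra.
Qed.

Lemma trig_poly_continuous {R : realType} {d : nat} (f : 'cV[R]_d -> R) :
  trig_poly f -> continuous f.
Proof.
move=> [l fE]; rewrite (_ : f = (fun x => \sum_(w <- l) wave_eval w x)).
  by apply: continuous_sum => w; exact: continuous_wave_eval.
by apply/funext => x; rewrite fE.
Qed.

(** gradient_estimate for the heat equation with c = nu / l: the gradient at
    time l^2 is of order 1 / l. *)
Lemma heat_gradient_le {R : realType} {d : nat} (al nu l M : R) f u :
  (0 < d)%N -> 1 < nu -> (2 * nu)^-1 <= al -> 0 < l -> 0 <= M ->
  cauchy_solution (fun=> al%:M) (fun=> 0 : 'cV[R]_d) f u ->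
  (forall x, `|f x| <= M) -> forall x y,
  `|u x (l ^+ 2) - u y (l ^+ 2)| <= 8 * nu * (M + 1) / l * enorm (x - y).
Proof.
move=> d0 nu1 alnu l0 M0 S fM.
have nu0 : 0 < nu by apply: lt_trans nu1.
have al0 : 0 < al by apply: lt_le_trans alnu; rewrite invr_gt0 mulr_gt0.
have uM := cauchy_solution_bounded d0 (@heat_bounds R d al al0) S fM.
have T0 : 0 < l ^+ 2 by rewrite exprn_gt0.
suff one x y : u x (l ^+ 2) - u y (l ^+ 2) <= 8 * nu * (M + 1) / l * enorm (x - y).
  by move=> x y; rewrite ler_norml one andbT lerNl opprB enormBC; exact: one.
apply: (gradient_estimate d0 (@heat_bounds R d al al0) S uM T0 (c := nu / l)) => //.
- by rewrite divr_gt0.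
- by rewrite mul0r divr_ge0// ltW.
- have -> : 8 * (nu / l) * M = 8 * nu / l * M by ring.
  have -> : 8 * nu * (M + 1) / l = 8 * nu / l * (M + 1) by ring.
  by apply: ler_wpM2l; [rewrite divr_ge0 ?mulr_ge0// ltW|rewrite lerDl].
- rewrite mulr0 mul0r add0r.
  have -> : 2 * al * (nu / l) * (8 * nu * (M + 1) / l) =
      16 * (al * nu) * nu * (M + 1) / l ^+ 2 by field; rewrite gt_eqF.
  rewrite ltr_pM2r ?invr_gt0//.
  have alnu2 : 1 / 2 <= al * nu.
    have -> : 1 / 2 = (2 * nu)^-1 * nu by field; rewrite gt_eqF.
    by apply: ler_wpM2r => //; exact: ltW.
  apply: (@lt_le_trans _ _ (8 * (M + 1))); first by move: M0; clear - R; lra.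
  have M1 : 0 <= M + 1 by rewrite addr_ge0.
  rewrite -mulrA; apply: (@le_trans _ _ (16 * (1 / 2) * (1 * (M + 1)))).
    by clear - R; lra.
  apply: ler_pM.
  + by rewrite mulr_ge0// divr_ge0.
  + by rewrite mul1r.
  + exact: ler_wpM2l.
  + by apply: ler_wpM2r => //; exact: ltW.
Qed.

Section scale_estimate.
Context {R : realType} {d : nat} {disp : measure_display}.
Context {Omega : measurableType disp}.
Variables (P : probability Omega R).
Variables (A : 'cV[R]_d -> Omega -> 'M[R]_d) (b : 'cV[R]_d -> Omega -> 'cV[R]_d).
Variables (Q : 'cV[R]_d -> Omega -> probability (PathSpace R d) R).
Variables (k : parameters R) (w : Omega) (n : nat).
Variable nu : R.
Variable p : R -> 'cV[R]_d -> 'cV[R]_d -> R.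
Hypotheses (d0 : (0 < d)%N) (hbeta : 0 < beta k <= 2^-1) (nu1 : 1 < nu).
Hypothesis G : greens_function (A ^~ w) (b ^~ w) p.
Hypothesis control : holder_control k P A b Q n 0 w.
Hypothesis al_ge : (2 * nu)^-1 <= alpha k P Q n.
Hypothesis L1 : 1 <= L k n.
Let l := L k n.
Let T := l ^+ 2.

Let l0 : 0 < l.
Proof. by apply: lt_le_trans L1. Qed.

(** The cut-off is 1 near the origin, so there the Hoelder control bounds the
    increments of the difference of the random and the homogenized solutions;
    those of the homogenized one are bounded by the heat gradient estimate. *)
Lemma scale_estimate_trig f (M K : R) x y : 0 <= M -> 0 <= K -> trig_poly f ->
  (forall z, `|f z| <= M) ->
  (forall z z', `|f z - f z'| <= K * enorm (z - z')) ->
  x != y -> enorm x <= 30 * Num.sqrt d%:R * l ->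
  enorm y <= 30 * Num.sqrt d%:R * l ->
  `|green_op p T f x - green_op p T f y| <=
    l `^ (- delta k) * (K + 3 * M) * enorm (x - y) `^ beta k +
    8 * nu * (M + 1) / l * enorm (x - y).
Proof.
move=> M0 K0 tf fM fK xy xl yl.
have al0 : 0 < alpha k P Q n.
  by apply: lt_le_trans al_ge; rewrite invr_gt0 mulr_gt0// (lt_trans ltr01).
have [un Sun] := trig_poly_cauchy (ltW al0) tf.
pose u z t := green_op p t f z.
have Su : cauchy_solution (A ^~ w) (b ^~ w) f u.
  by apply: (green_cauchy G); [exact: trig_poly_continuous|exists M].
have HQ z z' : z != z' ->
    `|f z - f z'| / enorm (z - z') `^ beta k <= K + 2 * M.
  by move=> zz; apply: holder_quotient_le.
have Hf (s : R) := @holder_norm_le R d k s M (K + 2 * M) f fM HQ.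
have := control (le_lt_trans (Hf 1) (ltry _)) Su Sun.
set F := (fun z => _) => HF.
have rb0 : 0 < enorm (x - y) `^ beta k.
  by rewrite powR_gt0// enorm_gt0 subr_eq0.
have lb0 : 0 < l `^ beta k by rewrite powR_gt0.
have lb1 : 1 <= l `^ beta k.
  by rewrite -(powRr0 l); apply: ler_powR => //; case/andP: hbeta => /ltW.
have FE : `|F x - F y| <=
    l `^ (- delta k) * (K + 3 * M) * enorm (x - y) `^ beta k.
  have := le_trans (holder_norm_ge k l F xy) HF.
  have D0 : (0 <= (l `^ (- delta k))%:E)%E by rewrite lee_fin powR_ge0.
  move=> /le_trans/(_ (lee_wpmul2l D0 (Hf l))).
  rewrite -EFinM lee_fin => h.
  rewrite -ler_pdivrMr// -(ler_pM2l lb0); apply: (le_trans h).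
  rewrite [leRHS]mulrCA; apply: ler_wpM2l; first exact: powR_ge0.
  have -> : l `^ beta k * (K + 3 * M) = l `^ beta k * (K + 2 * M) + l `^ beta k * M.
    by clear - R; ring.
  by rewrite addrC lerD2l; apply: ler_peMl.
have Fval z : enorm z <= 30 * Num.sqrt d%:R * l -> F z = u z T - un z T.
  by move=> zl; rewrite /F cutoff_eq1// mul1r.
have heat := heat_gradient_le d0 nu1 al_ge l0 M0 Sun fM x y.
have -> : green_op p T f x - green_op p T f y = (F x - F y) + (un x T - un y T).
  by rewrite !Fval// /u; clear - R; ring.
apply: (le_trans (ler_normD _ _)); exact: lerD.
Qed.

(** The estimate for trigonometric polynomials passes to the pointwise limit, as
    it involves only their supremum and Lipschitz constant; the factor d comes
    from the passage from coordinatewise to Euclidean Lipschitz constants. *)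
Lemma scale_estimate_lipschitz f (M K : R) x y : 0 <= M -> 0 <= K ->
  (forall z, `|f z| <= M) ->
  (forall z z', `|f z - f z'| <= K * enorm (z - z')) ->
  measurable_fun [set: Borel 'cV[R]_d] (f : Borel 'cV[R]_d -> R) ->
  x != y -> enorm x <= 30 * Num.sqrt d%:R * l ->
  enorm y <= 30 * Num.sqrt d%:R * l ->
  `|green_op p T f x - green_op p T f y| <=
    l `^ (- delta k) * (d%:R * K + 3 * M) * enorm (x - y) `^ beta k +
    8 * nu * (M + 1) / l * enorm (x - y).
Proof.
move=> M0 K0 fM fK mf xy xl yl.
have [f_ [tf_ fM_ fK_ fcvg]] := trig_poly_approx K0 fM (enorm_coord_lipschitz K0 fK).
have T0 : 0 < T by rewrite exprn_gt0.
have cf m := trig_poly_continuous (tf_ m).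
have gc z : (fun m => green_op p T (f_ m) z) @ \oo --> green_op p T f z.
  exact: (green_op_cvg G T0 cf mf fM_ fcvg).
have c : (fun m => `|green_op p T (f_ m) x - green_op p T (f_ m) y|) @ \oo -->
    `|green_op p T f x - green_op p T f y|.
  by apply: cvg_norm; apply: cvgB; exact: gc.
rewrite -(cvg_lim _ c)//; apply: limr_le; first by apply/cvg_ex; eexists; exact: c.
apply: nearW => m; apply: scale_estimate_trig => //.
  by rewrite mulr_ge0.
by move=> z z'; exact: coord_lipschitz_enorm.
Qed.

End scale_estimate.

(** * Frequently good scales *)

(** Each tail union contains E n for arbitrarily large n, so its complement has
    probability at most a n for all these n, that is, probability 0. *)
Lemma limsup_full_probability {R : realType} {disp} {Omega : measurableType disp}
    (P : probability Omega R) (E : nat -> set Omega) (a : nat -> R) :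
  (forall n, measurable (E n)) -> (forall n, (P (~` E n) <= (a n)%:E)%E) ->
  a @ \oo --> (0 : R) ->
  let S := \bigcap_N \bigcup_(n in [set n | (N <= n)%N]) E n in
  measurable S /\ P S = 1%E.
Proof.
move=> mE Ea a0 S; pose F N := \bigcup_(n in [set n | (N <= n)%N]) E n.
have mF N : measurable (F N) by apply: bigcup_measurable.
have mS : measurable S by apply: bigcapT_measurable.
split=> //.
have PF N : P (~` F N) = 0%E.
  apply/eqP; rewrite eq_le measure_ge0 andbT; apply/lee_addgt0Pr => e e0.
  rewrite add0e; have /cvgr_le/(_ _ e0)[m _ Hm] := a0.
  have PE := Ea (maxn N m); apply: (@le_trans _ _ (a (maxn N m))%:E).
    apply: le_trans PE; apply: le_measure; [rewrite inE; exact: measurableC..|].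
    by apply: subsetC => x Ex; exists (maxn N m) => //=; exact: leq_maxl.
  by rewrite lee_fin; apply: Hm; exact: leq_maxr.
have PS : P (~` S) = 0%E.
  have : P.-negligible (~` S).
    rewrite /S setC_bigcap; apply: negligible_bigcup => N.
    by apply/negligibleP; [exact/measurableC/mF|exact: PF].
  by move/negligibleP; apply; exact: measurableC.
by have := probability_setC P (measurableC mS); rewrite setCK PS sube0.
Qed.

Section scales_growth.
Context {R : realType} (k : parameters R).
Hypothesis L0_gt0 : (0 < L0 k)%N.
Hypothesis incr : forall n, L k n < L k n.+1.

Lemma ltn_scale n : (n < scale k n)%N.
Proof.
elim: n => [|n IH]; first exact: L0_gt0.
by have := incr n; rewrite /L ltr_nat; apply: leq_ltn_trans.
Qed.

Lemma L_ge_nat n : n.+1%:R <= L k n.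
Proof. by rewrite /L ler_nat; exact: ltn_scale. Qed.

Lemma L_powRN_cvg0 (a : R) : 0 < a -> (fun n => L k n `^ (- a)) @ \oo --> (0 : R).
Proof.
move=> a0; apply/cvgrPdist_le => e e0.
exists (Num.truncn (e^-1 `^ a^-1)).+1 => // n /= Nn.
have Ln0 : 0 < L k n by apply: lt_le_trans (L_ge_nat n); rewrite ltr0n.
rewrite sub0r normrN ger0_norm ?powR_ge0// powRN.
rewrite -[leRHS]invrK lef_pV2 ?posrE ?powR_gt0// ?invr_gt0//.
have ei : 0 <= e^-1 by rewrite invr_ge0 ltW.
rewrite -[leLHS](@powRr1 _ e^-1)// -(mulVf (lt0r_neq0 a0)) powRrM.
apply: ge0_ler_powR; rewrite ?nnegrE ?powR_ge0// ?ltW//.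
apply: lt_le_trans (truncnS_gt _) _; apply: le_trans (L_ge_nat n).
by rewrite ler_nat; apply: leq_trans Nn _.
Qed.

End scales_growth.

(** * The Liouville property *)

Theorem theorem1p2 (R : realType) (d : nat) (hd : (3 <= d)%N)
  (disp : measure_display) (Omega : measurableType disp)
  (P : probability Omega R) (tau : 'cV[R]_d -> Omega -> Omega)
  (A : 'cV[R]_d -> Omega -> 'M[R]_d) (b : 'cV[R]_d -> Omega -> 'cV[R]_d)
  (nu eta0 : R) (heta0 : 0 < eta0)
  (henv : random_environment P tau A b nu eta0)
  (p : Omega -> R -> 'cV[R]_d -> 'cV[R]_d -> R)
  (hp : forall w, greens_function (A ^~ w) (b ^~ w) (p w))
  (Q : 'cV[R]_d -> Omega -> probability (PathSpace R d) R)
  (hQ : forall x w, diffusion_law (A ^~ w) (b ^~ w) x (Q x w))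
  (hQm : forall x (E : set (PathSpace R d)), measurable E ->
     measurable_fun [set: Omega] (fun w => Q x w E))
  (k : parameters R) (hk : admissible k d)
  (hfix : fixed_constants k P A b Q nu) :
  exists Omega' : set Omega,
    [/\ measurable Omega', P Omega' = 1%E &
      forall w, Omega' w -> forall v : 'cV[R]_d -> R -> R,
        entire_bounded_solution (p w) (Q ^~ w) v <->
        exists c : R, forall x t, v x t = c].

Proof.
have d0 : (0 < d)%N by apply: leq_trans hd.
have [hbeta _ _ _ hM0 [hL0 _]] := hk.
have incr n : L k n < L k n.+1.
  by have [h1 h2 h3] := scale_order hfix n; exact: lt_trans h1 (lt_trans h2 h3).
have delta0 : 0 < delta k.
  by rewrite /delta; apply: mulr_gt0; [rewrite divr_gt0|case/andP: hbeta].
have M0_gt0 : 0 < M0 k.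
  apply: lt_le_trans hM0; have /andP[a0 _] := adm_expo hk.
  by rewrite mulr_gt0 ?mulr_gt0 ?ltr0n// exprn_gt0// addr_gt0.
have Lcvg := L_powRN_cvg0 hL0 incr.
have [mS PS] := limsup_full_probability (control_measurable hfix)
  (control_probability hfix) (Lcvg _ M0_gt0).
exists (\bigcap_N \bigcup_(n in [set n | (N <= n)%N]) control_event k P A b Q n 0).
split=> // w Sw v.
have [C H] := random_environment_bounds w henv; have G := hp w.
split=> [sol|[c vc]]; last first.
  have vE t : v ^~ t = cst c by apply/funext => x; exact: vc.
  split.
  - by exists `|c| => x t; rewrite vc.
  - by move=> t; rewrite vE; exact: measurable_cst.
  - by move=> x s t s0; rewrite vc vE (green_op_cst d0 H G).
  - move=> x s t s0; rewrite vc; under eq_Rintegral do rewrite vc.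
    rewrite Rintegral_cst// [X in fine X](_ : _ = 1%E) ?mulr1//.
    exact: probability_setT.
have [M vM] := entire_bounded sol.
have M_ge0 : 0 <= M by apply: le_trans (vM 0 0).
have mv := entire_borel sol.
have [K K0 HK] := exists_green_lipschitz d0 H G.
have vK t x y : `|v x t - v y t| <= M * K * enorm (x - y).
  have vE z : v z t = green_op (p w) 1 (v ^~ (t - 1)) z.
    by rewrite -(entire_green sol)// subrK.
  by rewrite !vE; apply: HK.
have space x y t : v x t = v y t.
  have [->//|xy] := eqVneq x y.
  apply/eqP; rewrite -subr_eq0 -normr_le0; apply/ler_addgt0Pr => e e0.
  rewrite add0r.
  pose rhs n := L k n `^ (- delta k) * (d%:R * (M * K) + 3 * M) *
      enorm (x - y) `^ beta k + 8 * nu * (M + 1) / L k n * enorm (x - y).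
  have rhs0 : rhs @ \oo --> (0 : R).
    rewrite [X in _ --> X](_ : 0 = 0 * (d%:R * (M * K) + 3 * M) *
      enorm (x - y) `^ beta k + 8 * nu * (M + 1) * 0 * enorm (x - y)); last first.
      by rewrite !mul0r mulr0 mul0r addr0.
    apply: cvgD; apply: cvgM; try exact: cvg_cst; apply: cvgM; try exact: cvg_cst.
      exact: Lcvg.
    rewrite (_ : (fun n => _) = (fun n => L k n `^ (- 1))); first exact: Lcvg.
    by apply/funext => n; rewrite powR_inv1// /L.
  have /cvgr_le/(_ _ e0)[N1 _ HN1] := rhs0.
  (* from the scale N2 on, x and y lie in the region where the cutoff is 1 *)
  pose N2 := Num.truncn (enorm x + enorm y).
  have [n /= Nn [hc _]] := Sw (maxn N1 N2) I.
  have n1 : (N1 <= n)%N by apply: leq_trans Nn; exact: leq_maxl.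
  have n2 : (N2 <= n)%N by apply: leq_trans Nn; exact: leq_maxr.
  apply: le_trans (HN1 _ n1).
  have L1 : 1 <= L k n by apply: le_trans (L_ge_nat hL0 incr n); rewrite ler1n.
  have xyL : enorm x + enorm y <= 30 * Num.sqrt d%:R * L k n.
    apply: (@le_trans _ _ (L k n)).
      apply/ltW/(lt_le_trans (truncnS_gt _)).
      by apply: le_trans (L_ge_nat hL0 incr n); rewrite ler_nat ltnS.
    apply: ler_peMl; first exact: le_trans L1.
    have s1 : 1 <= Num.sqrt (d%:R : R) by rewrite -[leLHS]sqrtr1 ler_sqrt// ler1n.
    by apply: le_trans s1 _; apply: ler_peMl; [exact: sqrtr_ge0|rewrite ler1n].
  have xL : enorm x <= 30 * Num.sqrt d%:R * L k n.
    by apply: le_trans xyL; rewrite lerDl enorm_ge0.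
  have yL : enorm y <= 30 * Num.sqrt d%:R * L k n.
    by apply: le_trans xyL; rewrite lerDr enorm_ge0.
  have al_ge : (2 * nu)^-1 <= alpha k P Q n.
    by have /andP[] := alpha_bounds hfix n.
  have vE z : v z t = green_op (p w) (L k n ^+ 2) (v ^~ (t - L k n ^+ 2)) z.
    by rewrite -(entire_green sol) ?sqr_ge0// subrK.
  have est := scale_estimate_lipschitz d0 hbeta (env_nu henv) G hc al_ge L1
    M_ge0 (mulr_ge0 M_ge0 K0) (fun z => vM z (t - L k n ^+ 2))
    (vK (t - L k n ^+ 2)) (mv (t - L k n ^+ 2)) xy xL yL.
  by rewrite !vE.
have time x t s : 0 <= s -> v x (t + s) = v x t.
  move=> s0; rewrite (entire_green sol)//.
  have -> : v ^~ t = (fun=> v x t) by apply/funext => y; exact: space.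
  exact: (green_op_cst d0 H G).
exists (v 0 0) => x t; rewrite (space x 0).
have [t0|t0] := leP 0 t; first by rewrite -(time 0 0 t t0) add0r.
by rewrite -(time 0 t (- t)) ?subrr// oppr_ge0 ltW.
Qed.
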